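(* A closed subspace $N$ of $H_E^2\oplus H_F^2$ is an invariant subspace of $S_E\oplus S_F^*$ if and only if $$N=\mathrm{Span}\{R(V_\Phi),K_\Theta\}$$ for some $\Phi\in\Gamma_{E\oplus F}^\infty$ which is zero or partial isometry-valued, and some $\Theta\in H^\infty_{B(F_1,F)}$, $F_1\subset F$, which is zero or left inner and right extremal, where $K_\Theta=H_F^2\ominus\Theta H_{F_1}^2$.
   Context: $E$ and $F$ are complex separable Hilbert spaces; subspaces such as $E_0\subset E\oplus F$ or $F_1\subset F$ are closed. $\mathbb T$ is the unit circle with normalized Lebesgue measure. $L_E^2$ is the space of square integrable $E$-valued functions on $\mathbb T$ and $H_E^2\subset L_E^2$ the $E$-valued Hardy space. $L^\infty_{B(E,F)}$ is the space of bounded measurable functions on $\mathbb T$ with values in $B(E,F)$ (bounded operators from $E$ to $F$), and $H^\infty_{B(E,F)}$ the bounded analytic ones; $B(E)=B(E,E)$. $P$ is the orthogonal projection of a vector-valued $L^2$ space onto the corresponding $H^2$. $S_E=T_z$ is the shift (multiplication by $z$) on $H_E^2$. For $\Phi\in L^\infty_{B(E,F)}$ the Toeplitz operator $T_\Phi:H_E^2\to H_F^2$ is $T_\Phi h=P[\Phi h]$, and the Hankel operator $H_\Phi:H_E^2\to H_F^2$ is $H_\Phi h=PJ[\Phi h]$, where $Jf(z)=\overline z f(\overline z)$ for $f\in L_F^2$. (Likewise for other pairs of spaces.) $\Gamma^\infty_{E\oplus F}$ is the set of all symbols $$\Phi(z)=\begin{bmatrix} A(z)&B(z)\\ C(z)&D(z)\end{bmatrix}:E\oplus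 F\to E\oplus F$$ with $A\in H^\infty_{B(E)}$, $B\in H^\infty_{B(F,E)}$, $C\in L^\infty_{B(E,F)}$, $D\in L^\infty_{B(F)}$. For such $\Phi$, $$V_\Phi=\begin{bmatrix} T_A&T_B\\ H_C&H_D\end{bmatrix}:H_E^2\oplus H_F^2\to H_E^2\oplus H_F^2 ,$$ and $R(V_\Phi)$ is its range. $\Phi$ is partial isometry-valued if there is a fixed subspace $E_0\subset E\oplus F$ with $\Phi(z)^*\Phi(z)=I_{E_0}$ for a.e. $z\in\mathbb T$, meaning that $\Phi(z)^*\Phi(z)=I_{E_0}\oplus0$ is the orthogonal projection onto $E_0$. $\Theta\in H^\infty_{B(F_1,F)}$ (with $F_1\subset F$, $F_1\neq\{0\}$) is left inner if $\Theta(z)^*\Theta(z)=I_{F_1}$ for a.e. $z\in\mathbb T$. A left inner $\Theta$ is right extremal if it cannot be factored as $\Theta=\Theta_1\Delta$ with $\Theta_1$ left inner and $\Delta\in H^\infty_{B(F_1)}$ a non-constant square inner function (i.e. $\Delta$ is not constant and $\Delta(z)^*\Delta(z)=\Delta(z)\Delta(z)^*=I_{F_1}$ a.e.). $K_\Theta\subset H_F^2$ is regarded as the subspace $\{0\}\oplus K_\Theta$ of $H_E^2\oplus H_F^2$ (so $K_\Theta=H_F^2$ if $\Theta=0$). $\mathrm{Span}$ denotes closed linear span. *)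

(* Defs.v *)
From HB Require Import structures.
From mathcomp Require Import all_boot all_order all_algebra.
From mathcomp Require Import ring lra complex.
From mathcomp Require Import all_classical all_reals all_analysis.

Set Implicit Arguments.
Unset Strict Implicit.
Unset Printing Implicit Defensive.
Import Order.TTheory GRing.Theory Num.Theory.
Import numFieldNormedType.Exports.

Local Open Scope classical_set_scope.
Local Open Scope complex_scope.
Local Open Scope ring_scope.

HB.mixin Record NormedModule_hasInner (R : realType) E
    of NormedModule R[i] E := {
  iprod : E -> E -> R[i];
  iprod_linear : forall (a : R[i]) (x y z : E),
    iprod (a *: x + y) z = a * iprod x z + iprod y z;
  iprodC : forall x y : E, iprod x y = (iprod y x)^*;
  iprod_norm : forall x : E, iprod x x = `|x| ^+ 2
}.

#[short(type="preHilbertType")]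
HB.structure Definition PreHilbert (R : realType) :=
  {E of NormedModule R[i] E & NormedModule_hasInner R E}.

#[short(type="hilbertType")]
HB.structure Definition Hilbert (R : realType) :=
  {E of PreHilbert R E & Complete E}.

HB.factory Record Lmodule_hasInner (R : realType) E of GRing.Lmodule R[i] E := {
  iprod : E -> E -> R[i];
  iprod_linear : forall (a : R[i]) (x y z : E),
    iprod (a *: x + y) z = a * iprod x z + iprod y z;
  iprodC : forall x y : E, iprod x y = (iprod y x)^*;
  iprod_ge0 : forall x : E, 0 <= iprod x x;
  iprod_eq0 : forall x : E, iprod x x = 0 -> x = 0
}.

HB.builders Context R E of Lmodule_hasInner R E.

Let iprodDl x y z : iprod (x + y) z = iprod x z + iprod y z.
Proof. by rewrite -[x]scale1r iprod_linear scale1r mul1r. Qed.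

Let iprod0l z : iprod 0 z = 0.
Proof. by apply: (addrI (iprod 0 z)); rewrite -iprodDl !addr0. Qed.

Let iprodZl a x z : iprod (a *: x) z = a * iprod x z.
Proof. by rewrite -[a *: x]addr0 iprod_linear iprod0l addr0. Qed.

Let iprodDr x y z : iprod x (y + z) = iprod x y + iprod x z.
Proof. by rewrite iprodC iprodDl rmorphD/= -!iprodC. Qed.

Let iprodZr a x y : iprod x (a *: y) = a^* * iprod x y.
Proof. by rewrite iprodC iprodZl rmorphM/= -!iprodC. Qed.

Let norm (x : E) : R[i] := sqrtC (iprod x x).

Let normrZ (a : R[i]) (x : E) : norm (a *: x) = `|a| * norm x.
Proof.
rewrite /norm iprodZl iprodZr mulrA -normCK sqrtCM ?qualifE/= ?exprn_ge0//.
  by rewrite exprCK.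
exact: iprod_ge0.
Qed.

Let norm_eq0 (x : E) : norm x = 0 -> x = 0.
Proof. by move=> /eqP; rewrite sqrtC_eq0 => /eqP/iprod_eq0. Qed.

Let cauchy_schwarz (x y : E) : `|iprod x y| ^+ 2 <= iprod x x * iprod y y.
Proof.
have [y0|y0] := eqVneq (iprod y y) 0.
  by rewrite y0 (iprod_eq0 y0) iprodC iprod0l rmorph0 normr0 expr0n mulr0.
have yp : 0 < iprod y y by rewrite lt_neqAle eq_sym y0 iprod_ge0.
have := iprod_ge0 (iprod y y *: x + (- iprod x y) *: y).
rewrite !(iprodDl, iprodDr, iprodZl, iprodZr) !rmorphN/=.
rewrite -(iprodC y y) -(iprodC y x).
rewrite [X in 0 <= X](_ : _ =
  iprod y y * (iprod x x * iprod y y - iprod x y * iprod y x)); last by ring.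
by rewrite pmulr_rge0// subr_ge0 (iprodC y x) -normCK.
Qed.

Let ler_normD (x y : E) : norm (x + y) <= norm x + norm y.
Proof.
have n0 z : 0 <= norm z by rewrite sqrtC_ge0 iprod_ge0.
rewrite -(@ler_pXn2r _ 2)// ?nnegrE ?addr_ge0// sqrrD !sqrtCK.
rewrite !(iprodDl, iprodDr) (iprodC y x).
rewrite [leLHS](_ : _ = iprod x x + (iprod x y + (iprod x y)^*) + iprod y y);
  last by ring.
rewrite lerD2r lerD2l.
rewrite [leLHS](_ : _ = 'Re (iprod x y) *+ 2); last first.
  by rewrite ReE -mulr_natr divfK// pnatr_eq0.
rewrite [leRHS](_ : _ = (norm x * norm y) *+ 2); last by ring.
rewrite lerMn2r/=; apply: le_trans (real_ler_norm (Creal_Re _)) _.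
apply: le_trans (leif_normC_Re_Creal _) _.
rewrite -(@ler_pXn2r _ 2)// ?nnegrE ?mulr_ge0// exprMn !sqrtCK.
exact: cauchy_schwarz.
Qed.

HB.instance Definition _ :=
  @Lmodule_isNormed.Build R[i] E norm ler_normD normrZ norm_eq0.

Let iprod_norm (x : E) : iprod x x = `|x| ^+ 2.
Proof. by rewrite -[LHS]sqrtCK. Qed.

HB.instance Definition _ :=
  @NormedModule_hasInner.Build R E iprod iprod_linear iprodC iprod_norm.
HB.end.

Definition separable_space (T : topologicalType) : Prop :=
  exists2 D : set T, countable D & dense D.

(* The carrier of the product is wrapped because the library equips the bare
   product with the sup norm. *)
Definition dsum (R : realType) (E F : hilbertType R) : Type := (E * F)%type.

Section dsum.
Context {R : realType} (E F : hilbertType R).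
Local Notation S := (dsum E F).

HB.instance Definition _ := GRing.Lmodule.copy S (E * F)%type.

Definition dsum_inner (u v : S) : R[i] := iprod u.1 v.1 + iprod u.2 v.2.

Let dsum_inner_linear (a : R[i]) (x y z : S) :
  dsum_inner (a *: x + y) z = a * dsum_inner x z + dsum_inner y z.
Proof. by rewrite /dsum_inner !iprod_linear mulrDr addrACA. Qed.

Let dsum_innerC (x y : S) : dsum_inner x y = (dsum_inner y x)^*.
Proof. by rewrite /dsum_inner rmorphD/= -!iprodC. Qed.

Let dsum_inner_ge0 (x : S) : 0 <= dsum_inner x x.
Proof. by rewrite /dsum_inner !iprod_norm addr_ge0// exprn_ge0. Qed.

Let dsum_inner_eq0 (x : S) : dsum_inner x x = 0 -> x = 0.
Proof.
rewrite /dsum_inner !iprod_norm => /eqP; rewrite paddr_eq0 ?exprn_ge0//.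
by rewrite !expf_eq0/= !normr_eq0; case: x => x y /= /andP[/eqP-> /eqP->].
Qed.

HB.instance Definition _ := Lmodule_hasInner.Build R S
  dsum_inner_linear dsum_innerC dsum_inner_ge0 dsum_inner_eq0.

Let dsum_normE (x : S) : `|x| ^+ 2 = `|x.1| ^+ 2 + `|x.2| ^+ 2.
Proof. by rewrite -!iprod_norm. Qed.

Let norm_fst (x : S) : `|x.1| <= `|x|.
Proof.
by rewrite -(@ler_pXn2r _ 2)// ?nnegrE// dsum_normE lerDl exprn_ge0.
Qed.

Let norm_snd (x : S) : `|x.2| <= `|x|.
Proof.
by rewrite -(@ler_pXn2r _ 2)// ?nnegrE// dsum_normE lerDr exprn_ge0.
Qed.

Let norm_le (x : S) : `|x| <= `|x.1| + `|x.2|.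
Proof.
rewrite -(@ler_pXn2r _ 2)// ?nnegrE ?addr_ge0// dsum_normE sqrrD.
by rewrite lerD2r lerDl mulrn_wge0// mulr_ge0.
Qed.

Let dsum_complete (G : set_system S) : ProperFilter G -> cauchy G -> cvg G.
Proof.
move=> PG /cauchy_ballP cG.
have cG1 : cauchy (fst @ G).
  apply/cauchy_ballP => e e0; have [/= [A B] [GA GB] AB] := cG _ e0.
  exists (fst @` A, fst @` B) => /=.
    by split; [apply: filterS GA|apply: filterS GB] => x Ax; exists x.
  move=> [_ _] /= [[x Ax <-] [y By <-]]; have := AB (x, y) (conj Ax By).
  by rewrite /= -!ball_normE/=; apply: le_lt_trans; exact: (norm_fst (x - y)).
have cG2 : cauchy (snd @ G).
  apply/cauchy_ballP => e e0; have [/= [A B] [GA GB] AB] := cG _ e0.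
  exists (snd @` A, snd @` B) => /=.
    by split; [apply: filterS GA|apply: filterS GB] => x Ax; exists x.
  move=> [_ _] /= [[x Ax <-] [y By <-]]; have := AB (x, y) (conj Ax By).
  by rewrite /= -!ball_normE/=; apply: le_lt_trans; exact: (norm_snd (x - y)).
have [l1 Gl1] := (cvg_ex _).1 (cauchy_cvg _ cG1).
have [l2 Gl2] := (cvg_ex _).1 (cauchy_cvg _ cG2).
apply/cvg_ex; exists ((l1, l2) : S); apply/(@cvgrPdist_lt _ S _ G _ id) => e e0.
have e2 : 0 < e / 2 by rewrite divr_gt0.
have H1 := ((cvgrPdist_lt _ _).1 Gl1) _ e2.
have H2 := ((cvgrPdist_lt _ _).1 Gl2) _ e2.
have {}H1 : \forall x \near G, `|l1 - x.1| < e / 2 by exact: H1.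
have {}H2 : \forall x \near G, `|l2 - x.2| < e / 2 by exact: H2.
near=> x; apply: le_lt_trans (norm_le _) _.
rewrite [ltRHS](splitr e) ltrD//=; near: x.
- exact: H1.
- exact: H2.
Unshelve. all: by end_near. Qed.

HB.instance Definition _ := Uniform_isComplete.Build S dsum_complete.

End dsum.

Record subspace_of (R : realType) (E : hilbertType R) := Subspace {
  subspace_set : set E;
  subspace0 : subspace_set 0;
  subspaceP : forall (a : R[i]) (x y : E),
    subspace_set x -> subspace_set y -> subspace_set (a *: x + y);
  subspace_closed : closed subspace_set
}.

Record subspace_sort (R : realType) (E : hilbertType R) (V : subspace_of E) :=
  SubspaceElt {
    subspace_incl :> E;
    subspace_inclP : subspace_incl \in subspace_set V
  }.
Coercion subspace_sort : subspace_of >-> Sortclass.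

Section subspace.
Context {R : realType} {E : hilbertType R} (V : subspace_of E).

HB.instance Definition _ := [isSub for @subspace_incl R E V].
HB.instance Definition _ := [Choice of V by <:].

Let in_carrier_submod : submod_closed [pred x : E | x \in subspace_set V].
Proof.
split=> [|a x y]; rewrite !inE; first exact: subspace0.
exact: subspaceP.
Qed.

HB.instance Definition _ :=
  GRing.SubChoice_isSubLmodule.Build _ _ _ V in_carrier_submod.

Definition subspace_inner (u v : V) : R[i] :=
  iprod (subspace_incl u) (subspace_incl v).

Let subspace_inner_linear (a : R[i]) (x y z : V) :
  subspace_inner (a *: x + y) z = a * subspace_inner x z + subspace_inner y z.
Proof. exact: iprod_linear. Qed.

Let subspace_innerC (x y : V) : subspace_inner x y = (subspace_inner y x)^*.
Proof. exact: iprodC. Qed.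

Let subspace_inner_ge0 (x : V) : 0 <= subspace_inner x x.
Proof. by rewrite /subspace_inner iprod_norm exprn_ge0. Qed.

Let subspace_inner_eq0 (x : V) : subspace_inner x x = 0 -> x = 0.
Proof.
rewrite /subspace_inner iprod_norm => /eqP.
by rewrite expf_eq0/= normr_eq0 => /eqP x0; exact: val_inj.
Qed.

HB.instance Definition _ := Lmodule_hasInner.Build R V subspace_inner_linear
  subspace_innerC subspace_inner_ge0 subspace_inner_eq0.

Let norm_subspace_incl (x : V) : `|x| = `|subspace_incl x|.
Proof.
by apply/eqP; rewrite -(@eqrXn2 _ 2)// -!iprod_norm.
Qed.

Let subspace_inclB (x y : V) :
  subspace_incl (x - y) = subspace_incl x - subspace_incl y.
Proof. by []. Qed.

Let subspace_complete (G : set_system V) : ProperFilter G -> cauchy G -> cvg G.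
Proof.
move=> PG /cauchy_ballP cG.
have cG1 : cauchy (@subspace_incl _ _ V @ G).
  apply/cauchy_ballP => e e0; have [/= [A B] [GA GB] AB] := cG _ e0.
  exists (@subspace_incl _ _ V @` A, @subspace_incl _ _ V @` B) => /=.
    by split; [apply: filterS GA|apply: filterS GB] => x Ax; exists x.
  move=> [_ _] /= [[x Ax <-] [y By <-]]; have := AB (x, y) (conj Ax By).
  by rewrite /= -!ball_normE/= norm_subspace_incl.
have [l Gl] := (cvg_ex _).1 (cauchy_cvg _ cG1).
have Vl : subspace_set V l.
  apply: (closed_cvg (subspace_set V) (@subspace_closed _ _ V) _ l Gl).
  by apply: nearW => x; exact/set_mem/subspace_inclP.
apply/cvg_ex; exists (SubspaceElt (mem_set Vl)).
apply/(@cvgrPdist_lt _ V _ G _ id) => e e0.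
have {}Gl : \forall x \near G, `|l - subspace_incl x| < e.
  exact: ((cvgrPdist_lt _ _).1 Gl _ e0).
by apply: filterS Gl => x; rewrite norm_subspace_incl subspace_inclB.
Qed.

HB.instance Definition _ := Uniform_isComplete.Build V subspace_complete.

End subspace.

Section circle.
Context {R : realType}.

Definition unit_circle : set R[i]^o := [set z | `|z| = 1].

Definition circle : Type := set_type unit_circle.

HB.instance Definition _ := Topological.on circle.

Let unit1 : (1 : R[i]^o) \in unit_circle.
Proof. by apply/mem_set; rewrite /unit_circle/= normr1. Qed.

HB.instance Definition _ := isPointed.Build circle (SigSub unit1).

HB.instance Definition _ :=
  Measurable.copy circle (g_sigma_algebraType (@open circle)).

Definition zval (z : circle) : R[i] := set_val z.

Let conj_subproof (z : circle) : ((zval z)^* : R[i]^o) \in unit_circle.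
Proof.
by apply/mem_set; rewrite /unit_circle/= norm_conjC; exact: (set_mem (valP z)).
Qed.

Definition conjT (z : circle) : circle := SigSub (conj_subproof z).

Let arc_subproof (t : R) :
  ((cos (2 * pi * t) +i* sin (2 * pi * t)) : R[i]^o) \in unit_circle.
Proof.
by apply/mem_set; rewrite /unit_circle/= normc_def/= cos2Dsin2 sqrtr1.
Qed.

Definition circle_arc (t : R) : circle := SigSub (arc_subproof t).

End circle.

Section circle_measure.
Context {R : realType}.

Let continuous_pair (f g : R -> R) : continuous f -> continuous g ->
  continuous ((fun t => f t +i* g t) : R -> R[i]^o).
Proof.
move=> cf cg x; apply/(@cvgrPdist_lt R[i] R[i]^o) => e e0.
have [r re] : exists r : R, e = r%:C.
  exists (complex.Re e); move: e0; case: e => a b.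
  by rewrite ltcE/= => /andP[/eqP-> _].
move: e0; rewrite {e}re ltcR => r0.
have r2 : 0 < r / 2 by rewrite divr_gt0.
have Hf : \forall t \near x, `|f x - f t| < r / 2.
  exact: ((cvgrPdist_lt _ _).1 (cf x) _ r2).
have Hg : \forall t \near x, `|g x - g t| < r / 2.
  exact: ((cvgrPdist_lt _ _).1 (cg x) _ r2).
near=> t.
have ft : `|f x - f t| < r / 2 by near: t; exact: Hf.
have gt : `|g x - g t| < r / 2 by near: t; exact: Hg.
rewrite normc_def/= ltcR (le_lt_trans (y := `|f x - f t| + `|g x - g t|))//.
  rewrite -(@ler_pXn2r _ 2)// ?nnegrE ?addr_ge0// ?sqrtr_ge0//.
  rewrite sqr_sqrtr ?addr_ge0 ?sqr_ge0// [leRHS]sqrrD !real_normK ?num_real//.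
  by rewrite lerD2r lerDl mulrn_wge0// mulr_ge0.
by rewrite (splitr r) ltrD.
Unshelve. all: by end_near. Qed.

Let continuous_circle_arc : continuous (@circle_arc R).
Proof.
apply/continuousP => A [B oB <-]; rewrite -comp_preimage.
move: B oB; apply/continuousP.
rewrite (_ : _ \o _ = (fun t => cos (2 * pi * t) +i* sin (2 * pi * t)))//.
have ct : continuous (fun t : R => 2 * pi * t).
  by move=> x; exact: mulrl_continuous.
by apply: continuous_pair => x; apply: continuous_comp;
  [exact: ct|exact: continuous_cos|exact: ct|exact: continuous_sin].
Qed.

Let measurable_circle_arc :
  measurable_fun [set: measurableTypeR R] (@circle_arc R).
Proof.
apply: (@measurability _ _ _ _ _ _ (@open (@circle R))) => //.
move=> _ [A oA <-]; rewrite setTI; apply: measurable_realfun.open_measurable.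
by move/continuousP: continuous_circle_arc => /(_ _ oA).
Qed.

Definition circle_measure : set (@circle R) -> \bar R :=
  pushforward (mrestr lebesgue_measure (measurable_itv `[0%R, 1%R])) circle_arc.

Let mu : {measure set (@circle R) -> \bar R} :=
  measure_function_pushforward__canonical__measure_function_Measure
    (mrestr lebesgue_measure (measurable_itv `[0%R, 1%R]))
    measurable_circle_arc.

HB.instance Definition _ := isMeasure.Build _ _ _ circle_measure
  (measure0 mu) (measure_ge0 mu) (@measure_semi_sigma_additive _ _ _ mu).
End circle_measure.

Arguments circle R : clear implicits.
Arguments circle_measure R : clear implicits.

Section hardy.
Context {R : realType}.
Local Notation T := (circle R).
Local Notation m := (circle_measure R).
Implicit Types E F : hilbertType R.

Definition cintegral (f : T -> R[i]) : R[i] :=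
  Rintegral m setT (fun z => complex.Re (f z)) +i*
  Rintegral m setT (fun z => complex.Im (f z)).

Definition borel_fun E (f : T -> E) : Prop :=
  measurable_fun [set: T] (f : T -> g_sigma_algebraType (@open E)).

Definition sqnormL2 E (f : T -> E) : \bar R :=
  (\int[m]_z ((complex.Re `|f z|) ^+ 2)%:E)%E.

(* Elements of L2 are represented by functions. Operators on H2 return an
   arbitrary representative of the class of their value; this is harmless since
   a closed subspace contains every function equal a.e. to one of its elements
   (the L2 distance between the two is 0). *)
Definition L2 E : set (T -> E) :=
  [set f | borel_fun f /\ (sqnormL2 f < +oo)%E].

Definition iprodL2 E (f g : T -> E) : R[i] :=
  cintegral (fun z => iprod (f z) (g z)).

(* The integral is the Fourier coefficient of index -(n+1), tested weakly. *)
Definition H2 E : set (T -> E) :=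
  [set f | L2 f /\ forall (n : nat) (x : E),
     cintegral (fun z => zval z ^+ n.+1 * iprod (f z) x) = 0].

Definition projH2 E (f : T -> E) : T -> E :=
  xget 0 [set g | H2 g /\ forall h, H2 h -> iprodL2 (f - g) h = 0].

Record bop E F := Bop {
  bop_fun :> {linear E -> F};
  bop_bounded : exists M : R, forall x, `|bop_fun x| <= M%:C * `|x|
}.

(* Measurability is the strong-operator one: for infinite-dimensional spaces,
   norm measurability would exclude most inner functions. *)
Definition Linf E F : set (T -> bop E F) :=
  [set Phi | (forall x, borel_fun (fun z => Phi z x)) /\
     exists M : R, \forall z \ae m, forall x, `|Phi z x| <= M%:C * `|x|].

Definition Hinf E F : set (T -> bop E F) :=
  [set Phi | Linf Phi /\ forall (n : nat) (x : E) (y : F),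
     cintegral (fun z => zval z ^+ n.+1 * iprod (Phi z x) y) = 0].

Definition mulop E F (Phi : T -> bop E F) (h : T -> E) : T -> F :=
  fun z => Phi z (h z).

Definition flipJ F (f : T -> F) : T -> F :=
  fun z => (zval z)^* *: f (conjT z).

Definition toeplitz E F (Phi : T -> bop E F) (h : T -> E) : T -> F :=
  projH2 (mulop Phi h).

Definition hankel E F (Phi : T -> bop E F) (h : T -> E) : T -> F :=
  projH2 (flipJ (mulop Phi h)).

Definition shiftH E (f : T -> E) : T -> E := fun z => zval z *: f z.

Definition adjointH2 E F (S : (T -> E) -> (T -> F)) (g : T -> F) : T -> E :=
  xget 0 [set k | H2 k /\ forall h, H2 h -> iprodL2 (S h) g = iprodL2 h k].

Definition closed_subspaceH2 E F (N : set ((T -> E) * (T -> F))) : Prop :=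
  [/\ N `<=` @H2 E `*` @H2 F,
      N 0,
      forall (a : R[i]) p q, N p -> N q -> N (a *: p + q)
    & forall p, (@H2 E `*` @H2 F) p ->
        (forall e : R, 0 < e -> exists2 q, N q &
          (sqnormL2 (p.1 - q.1)%R + sqnormL2 (p.2 - q.2)%R < e%:E)%E) -> N p].

Definition closed_span E F (S : set ((T -> E) * (T -> F))) :
  set ((T -> E) * (T -> F)) := smallest (@closed_subspaceH2 E F) S.

Definition shift_invariant E F (N : set ((T -> E) * (T -> F))) : Prop :=
  forall p, N p -> N (shiftH p.1, adjointH2 (@shiftH F) p.2).

Definition adjoint E F (A : E -> F) (y : F) : E :=
  xget 0 [set x | forall u, iprod (A u) y = iprod u x].

Definition orthoproj E (V : subspace_of E) (x : E) : E :=
  xget 0 [set y | subspace_set V y /\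
    forall w, subspace_set V w -> iprod (x - y) w = 0].

Record symbol E F := Symbol {
  symA : T -> bop E E;
  symB : T -> bop F E;
  symC : T -> bop E F;
  symD : T -> bop F F
}.

Definition symbol_op E F (Phi : symbol E F) (z : T) (u : dsum E F) : dsum E F :=
  (symA Phi z u.1 + symB Phi z u.2, symC Phi z u.1 + symD Phi z u.2).

Definition Gamma E F : set (symbol E F) :=
  [set Phi | [/\ Hinf (symA Phi), Hinf (symB Phi),
                 Linf (symC Phi) & Linf (symD Phi)]].

Definition Vop E F (Phi : symbol E F) (p : (T -> E) * (T -> F)) :
    (T -> E) * (T -> F) :=
  (toeplitz (symA Phi) p.1 + toeplitz (symB Phi) p.2,
   hankel (symC Phi) p.1 + hankel (symD Phi) p.2).

Definition rangeV E F (Phi : symbol E F) : set ((T -> E) * (T -> F)) :=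
  Vop Phi @` (@H2 E `*` @H2 F).

Definition symbol_zero E F (Phi : symbol E F) : Prop :=
  \forall z \ae m, forall u, symbol_op Phi z u = 0.

Definition partial_isometry_valued E F (Phi : symbol E F) : Prop :=
  exists E0 : subspace_of (dsum E F), \forall z \ae m, forall u,
    adjoint (symbol_op Phi z) (symbol_op Phi z u) = orthoproj E0 u.

Definition op_zero E F (Theta : T -> bop E F) : Prop :=
  \forall z \ae m, forall x, Theta z x = 0.

Definition left_inner F (F1 : subspace_of F) (Theta : T -> bop F1 F) : Prop :=
  [/\ exists x : F1, x != 0, Hinf Theta &
      \forall z \ae m, forall x, adjoint (Theta z) (Theta z x) = x].

Definition square_inner E (Delta : T -> bop E E) : Prop :=
  Hinf Delta /\ \forall z \ae m, forall x,
    adjoint (Delta z) (Delta z x) = x /\ Delta z (adjoint (Delta z) x) = x.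

Definition op_constant E F (Delta : T -> bop E F) : Prop :=
  exists D : bop E F, \forall z \ae m, forall x, Delta z x = D x.

Definition right_extremal F (F1 : subspace_of F) (Theta : T -> bop F1 F) :
    Prop :=
  ~ exists (Theta1 : T -> bop F1 F) (Delta : T -> bop F1 F1),
      [/\ left_inner Theta1, square_inner Delta, ~ op_constant Delta &
          \forall z \ae m, forall x, Theta z x = Theta1 z (Delta z x)].

Definition Kspace F (F1 : subspace_of F) (Theta : T -> bop F1 F) :
    set (T -> F) :=
  [set g | H2 g /\ forall h, H2 h -> iprodL2 g (mulop Theta h) = 0].

End hardy.

(* Main.v *)
From HB Require Import structures.
Require Import Defs.
From mathcomp Require Import all_boot all_order all_algebra.
From mathcomp Require Import ring lra complex.
From mathcomp Require Import all_classical all_reals all_analysis.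
From mathcomp Require Import measurable_realfun.
Set Implicit Arguments.
Unset Strict Implicit.
Unset Printing Implicit Defensive.
Import Order.TTheory GRing.Theory Num.Theory.
Import numFieldNormedType.Exports.
Local Open Scope classical_set_scope.
Local Open Scope complex_scope.
Local Open Scope ring_scope.

(* Let J be the flip and put
     M = {(f, g) in L2_E + L2_F | (f, P J g) in N}.
   Since P J intertwines multiplication by z on L2_F with the backward shift, N
   is invariant under S + S^* exactly when M is invariant under multiplication by
   z, and N is recovered from M.  By the Wold decomposition M is generated by its
   wandering subspace, which gives a partial isometry-valued Phi, together with
   the reducing part M_oo = {g | z^-n g in M for all n}.  The first components of
   M lie in H2_E; hence the first row of Phi is analytic and M_oo lies in
   0 + L2_F.  The functions of H2_F orthogonal to J M_oo form a shift-invariant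
   space Theta H2_F1, and M_oo contributes its complement K_Theta to N.  If Theta =
   Theta1 Delta with Delta inner, then Theta1 takes its values in that same space,
   so Delta^* is analytic as well and Delta is constant.

   Fourier uniqueness: the integrable functions with vanishing Fourier
   coefficients are stable under multiplication by trigonometric polynomials, hence
   by indicators of balls, hence of Borel sets.  In the Wold decomposition, E_0 is
   the span of the values at one point z0 of a sequence of wandering functions
   that is orthonormal at every point. *)

(** * The real inner product of a Hilbert space *)

(** Elements of L2 are functions rather than classes, and H2 is given by vanishing weak
    coefficients. Generation statements therefore take the form of induction principles: a closed
    subspace containing the evident generators contains the whole space. They are proved by
    projecting onto the closed subspace and showing that the remainder is null. Operators need only
    be bounded, and linear up to null functions.

    The wandering functions can be made orthonormal at every point because w_i is orthogonal to
    z^(n+1) w_j and conversely, so that <w_i, w_j> has only its mean as Fourier coefficient;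
    countability lets one null set serve all pairs. Phi(z) sends w_i(z0) to w_i(z), so its initial
    space does not depend on z.

    A function of M_oo has a first component f with z^-n f analytic for all n, hence f = 0. As P J
    kills H2_F, M contains 0 + H2_F; hence what is orthogonal to M has a second component that J
    makes analytic, and this is how K_Theta is recognised inside N. *)

Lemma ex_invS_lt (R : realType) (e : R) :
  0 < e -> exists n : nat, n.+1%:R^-1 < e.
Proof. by move=> e0; have [n] := ltr_add_invr e0; rewrite add0r => hn; exists n. Qed.

Lemma ltc_real (R : realType) (e : R[i]) : 0 < e -> exists2 r : R, 0 < r & e = r%:C.
Proof. by case: e => a b; rewrite ltcE/= => /andP[/eqP-> a0]; exists a. Qed.

Section RealInner.
Context {R : realType} {G : hilbertType R}.
Implicit Types (x y z : G) (c : R[i]).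

Definition nrm x : R := complex.Re `|x|.
(* Working with the real inner product loses nothing: a complex subspace has the
   same orthogonal complement for [rip] as for [iprod]. *)
Definition rip x y : R := complex.Re (iprod x y).

Lemma normr_nrm x : `|x| = (nrm x)%:C.
Proof.
rewrite /nrm; have := normr_ge0 x; case: (`|x|) => a b.
by rewrite lecE /= => /andP[/eqP -> _].
Qed.

Lemma nrm_ge0 x : 0 <= nrm x.
Proof. by have := normr_ge0 x; rewrite normr_nrm lecR. Qed.

Lemma ripxx x : rip x x = nrm x ^+ 2.
Proof. by rewrite /rip iprod_norm normr_nrm -rmorphXn. Qed.

Lemma rip_ge0 x : 0 <= rip x x.
Proof. by rewrite ripxx sqr_ge0. Qed.

Lemma rip_sym x y : rip x y = rip y x.
Proof. by rewrite /rip iprodC; case: (iprod y x). Qed.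

Lemma iprodDl x y z : iprod (x + y) z = iprod x z + iprod y z.
Proof. by rewrite -[x]scale1r iprod_linear scale1r mul1r. Qed.

Lemma iprod0l z : iprod (0 : G) z = 0.
Proof. by apply: (addrI (iprod 0 z)); rewrite -iprodDl !addr0. Qed.

Lemma iprodZl c x z : iprod (c *: x) z = c * iprod x z.
Proof. by rewrite -[c *: x]addr0 iprod_linear iprod0l addr0. Qed.

Lemma iprodDr x y z : iprod x (y + z) = iprod x y + iprod x z.
Proof. by rewrite iprodC iprodDl rmorphD/= -!iprodC. Qed.

Lemma iprodZr c x y : iprod x (c *: y) = c^* * iprod x y.
Proof. by rewrite iprodC iprodZl rmorphM/= -!iprodC. Qed.

Lemma iprod0r z : iprod z (0 : G) = 0.
Proof. by rewrite iprodC iprod0l rmorph0. Qed.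

Lemma iprodNl x z : iprod (- x) z = - iprod x z.
Proof. by rewrite -scaleN1r iprodZl mulN1r. Qed.

Lemma iprodBl x y z : iprod (x - y) z = iprod x z - iprod y z.
Proof. by rewrite iprodDl iprodNl. Qed.

Lemma ripDl x y z : rip (x + y) z = rip x z + rip y z.
Proof. by rewrite /rip iprodDl raddfD. Qed.

Lemma ripNl x z : rip (- x) z = - rip x z.
Proof. by rewrite /rip iprodNl raddfN. Qed.

Lemma ripDr x y z : rip x (y + z) = rip x y + rip x z.
Proof. by rewrite ![rip x _]rip_sym ripDl. Qed.

Lemma ripNr x z : rip x (- z) = - rip x z.
Proof. by rewrite ![rip x _]rip_sym ripNl. Qed.

Lemma ripBl x y z : rip (x - y) z = rip x z - rip y z.
Proof. by rewrite ripDl ripNl. Qed.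

Lemma ripBr x y z : rip x (y - z) = rip x y - rip x z.
Proof. by rewrite ripDr ripNr. Qed.

Lemma rip0l z : rip 0 z = 0. Proof. by rewrite /rip iprod0l. Qed.
Lemma rip0r z : rip z 0 = 0. Proof. by rewrite rip_sym rip0l. Qed.

Lemma ripZl (r : R) x z : rip (r%:C *: x) z = r * rip x z.
Proof.
by rewrite /rip iprodZl; case: (iprod x z) => a b /=; rewrite mul0r subr0.
Qed.

Lemma ripZr (r : R) x z : rip x (r%:C *: z) = r * rip x z.
Proof. by rewrite rip_sym ripZl rip_sym. Qed.

Lemma rip_scale c x y : rip (c *: x) y = rip x (c^* *: y).
Proof. by rewrite /rip iprodZl iprodZr conjCK. Qed.

Lemma Im_iprod x y : complex.Im (iprod x y) = rip x ('i%C *: y).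
Proof.
rewrite /rip iprodZr; case: (iprod x y) => a b /=.
by rewrite mul0r mulN1r opprK add0r.
Qed.

Lemma iprodE x y : iprod x y = rip x y +i* rip x ('i%C *: y).
Proof. by rewrite -Im_iprod /rip; case: (iprod x y). Qed.

Lemma rip_scalel c x y :
  rip (c *: x) y = complex.Re c * rip x y - complex.Im c * rip x ('i%C *: y).
Proof. by rewrite -Im_iprod /rip iprodZl; case: c (iprod x y) => a b [a' b']. Qed.

Lemma nrm0 : nrm 0 = 0. Proof. by rewrite /nrm normr0. Qed.

Lemma nrmZ c x : nrm (c *: x) = complex.Re `|c| * nrm x.
Proof.
rewrite /nrm normrZ normr_nrm; case: (`|c|) => a b /=; by rewrite mulr0 subr0.
Qed.

Lemma nrmN x : nrm (- x) = nrm x. Proof. by rewrite /nrm normrN. Qed.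
Lemma nrmB x y : nrm (x - y) = nrm (y - x). Proof. by rewrite -nrmN opprB. Qed.

Lemma nrmD x y : nrm (x + y) <= nrm x + nrm y.
Proof. by have := ler_normD x y; rewrite !normr_nrm -rmorphD /= lecR. Qed.

Lemma nrm_eq0 x : nrm x = 0 -> x = 0.
Proof. by move=> h; apply/eqP; rewrite -normr_eq0 normr_nrm h. Qed.

Lemma ripxx_eq0 x : rip x x = 0 -> x = 0.
Proof. by rewrite ripxx => /eqP; rewrite sqrf_eq0 => /eqP /nrm_eq0. Qed.

Lemma cauchy_schwarz x y : rip x y <= nrm x * nrm y.
Proof.
have [->|x0] := eqVneq x 0; first by rewrite rip0l nrm0 mul0r.
have nx : 0 < nrm x.
  by rewrite lt_neqAle nrm_ge0 andbT eq_sym; apply/eqP => /nrm_eq0/eqP; apply/negP.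
(* The square of |y| x - |x| y equals 2 |x| |y| (|x| |y| - <x, y>). *)
have := rip_ge0 ((nrm y)%:C *: x - (nrm x)%:C *: y).
rewrite !(ripBl, ripBr, ripZl, ripZr) !ripxx [rip y x]rip_sym.
have [y0|y0] := eqVneq y 0; first by rewrite y0 rip0r nrm0 mulr0.
have ny : 0 < nrm y.
  by rewrite lt_neqAle nrm_ge0 andbT eq_sym; apply/eqP => /nrm_eq0/eqP; apply/negP.
move=> h; rewrite -(ler_pM2l (mulr_gt0 nx ny)).
move: (nrm x) (nrm y) (rip x y) h => a b r; nra.
Qed.

Lemma rip_le x y : 2 * rip x y <= rip x x + rip y y.
Proof.
have := rip_ge0 (x - y); rewrite !(ripBl, ripBr) [rip y x]rip_sym; lra.
Qed.

Lemma rip_abs x y : `|rip x y| <= rip x x + rip y y.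
Proof.
have := rip_le x y; have := rip_le x (- y).
rewrite !(ripNl, ripNr) opprK; have := rip_ge0 x; have := rip_ge0 y.
by move=> ? ? ? ?; rewrite ler_norml; apply/andP; split; lra.
Qed.

Lemma ripD2 x y : rip (x + y) (x + y) <= 2 * rip x x + 2 * rip y y.
Proof.
have := rip_le x y; rewrite !(ripDl, ripDr) [rip y x]rip_sym; lra.
Qed.

Lemma abs_rip x y : `|rip x y| <= nrm x * nrm y.
Proof.
rewrite ler_norml cauchy_schwarz andbT lerNl -ripNl.
by rewrite -(nrmN x) cauchy_schwarz.
Qed.

Lemma rip_inj x y : (forall u, rip u x = rip u y) -> x = y.
Proof.
move=> h; apply/eqP; rewrite -subr_eq0; apply/eqP/ripxx_eq0.
by rewrite ripBr h subrr.
Qed.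

Lemma hilbert_complete (u : nat -> G) :
  (forall e : R, 0 < e -> exists N, forall n m, (N <= n)%N -> (N <= m)%N ->
     nrm (u n - u m) < e) ->
  exists l, forall e : R, 0 < e -> exists N, forall n, (N <= n)%N ->
     nrm (u n - l) < e.
Proof.
move=> cu.
have : cauchy (u @ \oo).
  apply/cauchy_ballP => _ /ltc_real[r r0 ->].
  have [N hN] := cu _ r0.
  exists ([set x | exists2 n, (N <= n)%N & x = u n],
          [set x | exists2 n, (N <= n)%N & x = u n]) => /=.
    by split; exists N => // n /= Nn; exists n.
  move=> [_ _] /= [[n Nn ->] [m Nm ->]].
  by rewrite -ball_normE /= normr_nrm ltcR; apply: hN.
move=> /cauchy_cvg /(cvg_ex _).1 [l hl]; exists l => e e0.
have e0' : (0 : R[i]) < e%:C by rewrite ltcR.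
have [N _ hN] := (cvgrPdist_lt _ _).1 hl _ e0'.
by exists N => n Nn; have := hN n Nn; rewrite /= normr_nrm ltcR nrmB.
Qed.

Lemma open_nrmP (U : set G) :
  open U <-> forall x, U x -> exists2 e : R, 0 < e & forall y, nrm (x - y) < e -> U y.
Proof.
split=> [oU x Ux|h].
  have := open_nbhs_nbhs (conj oU Ux); rewrite -nbhs_ballE => -[e /= /ltc_real[r r0 ->] he].
  exists r => // y xy.
  by apply: he; rewrite -ball_normE /= normr_nrm ltcR.
rewrite openE => x Ux; have [e e0 he] := h _ Ux.
rewrite /interior -nbhs_ballE; exists e%:C; first by rewrite /= ltcR.
by move=> y; rewrite -ball_normE /= normr_nrm ltcR; exact: he.
Qed.

Lemma closed_nrmP (A : set G) :
  (forall x, (forall e : R, 0 < e -> exists2 y, A y & nrm (x - y) < e) -> A x) ->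
  closed A.
Proof.
move=> h; rewrite -openC; apply/open_nrmP => x Ax.
apply: contrapT => H; apply: Ax; apply: h => e e0.
apply: contrapT => H2; apply: H; exists e => // y xy Ay; by apply: H2; exists y.
Qed.

End RealInner.

Definition dense_sequence (R : realType) (G : hilbertType R) : Prop :=
  exists d : nat -> G, forall x (e : R), 0 < e -> exists k, nrm (x - d k) < e.

(** Test [x - y] against a [d k] closer to it than its own norm. *)
Lemma iprod_dense_inj (R : realType) (G : hilbertType R) (d : nat -> G) (x y : G) :
  (forall u (e : R), 0 < e -> exists k, nrm (u - d k) < e) ->
  (forall k, iprod x (d k) = iprod y (d k)) -> x = y.
Proof.
move=> hd h; apply/eqP; rewrite -subr_eq0; apply/eqP/nrm_eq0.
have := nrm_ge0 (x - y); case: ltgtP => // n0 _.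
have [k hk] := hd (x - y) _ n0.
have : rip (x - y) (x - y) = rip (x - y) (x - y - d k).
  rewrite [RHS]ripBr (_ : rip (x - y) (d k) = 0) ?subr0//.
  by rewrite /rip iprodBl h subrr.
rewrite ripxx => E; have := cauchy_schwarz (x - y) (x - y - d k).
by rewrite -E expr2 ler_pM2l// leNgt hk.
Qed.

Lemma separable_dense_sequence (R : realType) (G : hilbertType R) :
  separable_space G -> dense_sequence G.
Proof.
move=> [D cD dD].
have [x0 [_ Dx0]] : (setT `&` D) !=set0 by apply: dD; [exists 0|exact: openT].
have /countable_injP[f finj] := cD.
exists (fun n => xget x0 [set x | D x /\ f x = n]) => x e e0.
have oB : open [set y : G | nrm (x - y) < e].
  apply/open_nrmP => y /= xy; exists (e - nrm (x - y)); first by rewrite subr_gt0.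
  move=> z yz; have := nrmD (x - y) (y - z); rewrite addrA subrK => h.
  by apply: le_lt_trans h _; rewrite addrC -ltrBrDr.
have [y [/= xy Dy]] := dD _ (ex_intro _ x (eq_ind_r (fun t => t < e) e0
   (eq_trans (congr1 nrm (subrr x)) nrm0))) oB.
exists (f y); case: xgetP => [z _ [Dz fz]|/(_ y)]; last by case.
by have -> : z = y by apply: finj; rewrite ?inE.
Qed.

Lemma rip_dsum (R : realType) (E F : hilbertType R) (u v : dsum E F) :
  rip u v = rip u.1 v.1 + rip u.2 v.2.
Proof. by rewrite /rip -raddfD. Qed.

Lemma nrm_dsum (R : realType) (E F : hilbertType R) (u : dsum E F) :
  nrm u ^+ 2 = nrm u.1 ^+ 2 + nrm u.2 ^+ 2.
Proof. by rewrite -!ripxx rip_dsum. Qed.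

Lemma dense_sequence_dsum (R : realType) (E F : hilbertType R) :
  dense_sequence E -> dense_sequence F -> dense_sequence (dsum E F).
Proof.
move=> [d hd] [d' hd'].
exists (fun n => if unpickle n is Some (i, j) then (d i, d' j) : dsum E F else 0).
move=> x e e0; have e2 : 0 < e / 2 by rewrite divr_gt0.
have [i hi] := hd x.1 _ e2; have [j hj] := hd' x.2 _ e2.
exists (pickle (i, j)); rewrite pickleK.
have h : x - ((d i, d' j) : dsum E F) = ((x.1 - d i, 0) : dsum E F) + (0, x.2 - d' j).
  by case: x {hi hj} => x1 x2; congr pair; rewrite /= ?addr0 ?add0r.
rewrite h; apply: le_lt_trans (nrmD _ _) _; rewrite (splitr e) ltrD //.
  by rewrite -(@ltr_pXn2r _ 2) ?nnegrE ?nrm_ge0 ?ltW // nrm_dsum nrm0 expr0n addr0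
      ltr_pXn2r ?nnegrE ?nrm_ge0 ?ltW.
by rewrite -(@ltr_pXn2r _ 2) ?nnegrE ?nrm_ge0 ?ltW // nrm_dsum nrm0 expr0n add0r
  ltr_pXn2r ?nnegrE ?nrm_ge0 ?ltW.
Qed.

Lemma nrm_subspace (R : realType) (G : hilbertType R) (V : subspace_of G) (x : V) :
  nrm x = nrm (subspace_incl x).
Proof.
by apply/eqP; rewrite -(@eqrXn2 _ 2) ?nrm_ge0// -!ripxx.
Qed.

(** The points [d k] need not lie in [V]: for each ball of radius 1/(n+1) about a [d k], a point of
    [V] inside it is picked whenever there is one. *)
Lemma dense_sequence_subspace (R : realType) (G : hilbertType R) (V : subspace_of G) :
  dense_sequence G -> dense_sequence V.
Proof.
move=> [d hd].
pose P k n := [set x : V | nrm (d k - subspace_incl x) < n.+1%:R^-1].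
exists (fun m => if unpickle m is Some (k, n) then xget 0 (P k n) else 0).
move=> x e e0; have [n hn] := ex_invS_lt (divr_gt0 e0 (ltr0Sn R 1)).
have n0 : (0 : R) < n.+1%:R^-1 by rewrite invr_gt0.
have [k hk] := hd (subspace_incl x) _ n0.
exists (pickle (k, n)); rewrite pickleK; case: xgetP => [y _ /= Py|/(_ x)]; last first.
  by rewrite /P /= nrmB.
rewrite nrm_subspace.
have -> : subspace_incl (x - y) = (subspace_incl x - d k) + (d k - subspace_incl y).
  by rewrite addrA subrK.
apply: le_lt_trans (nrmD _ _) _; rewrite (splitr e) ltrD //.
  exact: lt_trans hk hn.
exact: lt_trans Py hn.
Qed.

(** * Weak and Borel measurability *)

Section Measurability.
Context {R : realType} {G : hilbertType R}.
Local Notation T := (circle R).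
Implicit Types (f g : T -> G).

(** Scalar measurability passes to sums and pointwise limits without any argument about open sets of
    [G]. For separable [G] it coincides with [borel_fun] (Pettis): see [borel_wmeas] and
    [wmeas_borel]. *)
Definition wmeas f : Prop :=
  forall x, measurable_fun [set: T] (fun z => rip (f z) x : R).

Hypothesis sepG : dense_sequence G.

Lemma borel_wmeas f : borel_fun f -> wmeas f.
Proof.
move=> mf x; apply: (measurability _ (measurable_realfun.RGenOInfty.measurableE R)).
move=> _ [_ [a ->] <-]; rewrite setTI.
have : open [set u : G | a < rip u x].
  apply/open_nrmP => u /= au.
  exists ((rip u x - a) / (nrm x + 1)).
    by rewrite divr_gt0 ?subr_gt0// ltr_wpDl ?nrm_ge0.
  move=> v; rewrite ltr_pdivlMr; last by rewrite ltr_wpDl ?nrm_ge0.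
  move=> uv; have := cauchy_schwarz (u - v) x; rewrite ripBl => h.
  have : nrm (u - v) * nrm x <= nrm (u - v) * (nrm x + 1).
    by rewrite ler_wpM2l ?nrm_ge0// lerDl.
  lra.
move=> oU.
have mU : measurable ([set u | a < rip u x] : set (g_sigma_algebraType (@open G))).
  exact: sub_sigma_algebra.
have := mf measurableT _ mU.
by rewrite setTI; congr measurable; apply/seteqP; split => z /=; rewrite in_itv/= andbT.
Qed.

(** The norm as a countable supremum of functionals, written without dividing by [nrm (d k)], which
    may vanish. It turns weak measurability into measurability of the norm. *)
Lemma nrm_gtP (r : R) : 0 <= r -> exists d : nat -> G, forall x,
  r < nrm x <-> exists k, r * nrm (d k) < rip x (d k).
Proof.
move=> r0; have [d hd] := sepG; exists d => x; split=> [rx|[k]]; last first.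
  move=> h; have := lt_le_trans h (cauchy_schwarz x (d k)).
  have := nrm_ge0 (d k); case: (ltgtP (nrm (d k)) 0) => // [dk _|->].
    by rewrite ltr_pM2r.
  by rewrite !mulr0 ltxx.
have x0 : 0 < nrm x by apply: le_lt_trans rx.
(* With t the distance from [x] to [d k], it suffices that t (r + |x|) < (|x| - r) |x|, since |d k|
   <= |x| + t and <x, d k> >= |x|^2 - t |x|. *)
pose e := (nrm x - r) * nrm x / (r + nrm x + 1).
have D : 0 < r + nrm x + 1 by lra.
have e0 : 0 < e by rewrite divr_gt0// mulr_gt0// subr_gt0.
have [k hk] := hd x e e0; exists k.
have h1 := nrmD (d k - x) x; rewrite subrK nrmB in h1.
have h2 := cauchy_schwarz x (x - d k); rewrite ripBr ripxx in h2.
have h3 : nrm (x - d k) * (r + nrm x + 1) < (nrm x - r) * nrm x.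
  by rewrite -ltr_pdivlMr.
have h4 := nrm_ge0 (x - d k).
have h5 : r * nrm (d k) <= r * (nrm (x - d k) + nrm x) by rewrite ler_wpM2l.
have : nrm x * nrm (x - d k) + r * nrm (x - d k) < (nrm x - r) * nrm x by lra.
lra.
Qed.

Lemma wmeasB_cst f x : wmeas f -> wmeas (fun z => f z - x).
Proof.
move=> mf y; have -> : (fun z => rip (f z - x) y) = (fun z => rip (f z) y - rip x y).
  by apply/funext => z; rewrite ripBl.
by apply: measurable_funB => //; exact: mf.
Qed.

Lemma measurable_nrm_gt f (r : R) : 0 <= r -> wmeas f ->
  measurable [set z | r < nrm (f z)].
Proof.
move=> r0 mf; have [d hd] := nrm_gtP r0.
rewrite (_ : [set _ | _] = \bigcup_k [set z | r * nrm (d k) < rip (f z) (d k)]); last first.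
  apply/seteqP; split=> z /=; first by move=> /hd[k hk]; exists k.
  by move=> [k _ hk]; apply/hd; exists k.
apply: bigcupT_measurable => k.
have := mf (d k) measurableT _ (measurable_itv `]r * nrm (d k), +oo[%R).
by rewrite setTI; congr measurable; apply/seteqP; split => z /=; rewrite in_itv/= andbT.
Qed.

Lemma measurable_ball_preimage f x (r : R) : wmeas f ->
  measurable [set z | nrm (f z - x) < r].
Proof.
move=> mf; have [r0|r0] := leP r 0.
  rewrite (_ : [set _ | _] = set0) //; apply/seteqP; split=> z //=.
  by move=> h; have := nrm_ge0 (f z - x); lra.
(* The radii r (1 - 1/(n+1)) increase to r, which expresses the open ball through sets where the
   distance exceeds a given number. *)
have q0 (n : nat) : 0 <= r * (1 - n.+1%:R^-1) :> R.
  by rewrite mulr_ge0 ?(ltW r0)// subr_ge0 invf_le1// ler1n.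
rewrite (_ : [set _ | _] =
  \bigcup_n (~` [set z | r * (1 - n.+1%:R^-1) < nrm (f z - x)])).
  by apply: bigcupT_measurable => n; apply: measurableC;
    apply: measurable_nrm_gt; [exact: q0|exact: wmeasB_cst].
apply/seteqP; split=> z /=.
  move=> h; have h' : 0 < (r - nrm (f z - x)) / r by rewrite divr_gt0// subr_gt0.
  have [n] := ex_invS_lt h'; rewrite ltr_pdivlMr// => hn.
  by exists n => //=; apply/negP; rewrite -leNgt; move: (n.+1%:R^-1) hn => q hn; lra.
move=> [n _ /= /negP]; rewrite -leNgt => /le_lt_trans; apply.
by rewrite mulrBr mulr1 ltrBlDr ltrDl mulr_gt0// invr_gt0.
Qed.

(** An open set is a countable union of balls about the points [d k], and preimages of balls are
    measurable. *)
Lemma wmeas_borel f : wmeas f -> borel_fun f.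
Proof.
move=> mf; have [d hd] := sepG.
apply: (@measurability _ _ _ (g_sigma_algebraType (@open G)) setT f (@open G)) => //.
move=> _ [U oU <-]; rewrite setTI.
pose W k n := [set u : G | nrm (u - d k) < n.+1%:R^-1].
rewrite (_ : _ @^-1` _ =
  \bigcup_k \bigcup_(n in [set n | W k n `<=` U]) (f @^-1` (W k n))); last first.
  apply/seteqP; split=> z /=; last by move=> [k _ [n /= WU]]; exact: WU.
  move=> /((open_nrmP U).1 oU)[e e0 he].
  have [n hn] := ex_invS_lt (divr_gt0 e0 (ltr0Sn R 1)).
  have n0 : (0 : R) < n.+1%:R^-1 by rewrite invr_gt0.
  have [k hk] := hd (f z) _ n0; exists k => //; exists n => //= u Wu.
  apply: he; rewrite -(subrK (d k) (f z)) -addrA; apply: le_lt_trans (nrmD _ _) _.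
  by rewrite (splitr e) ltrD // ?(lt_trans hk)// nrmB (lt_trans Wu).
apply: bigcupT_measurable => k; apply: bigcup_measurable => n _.
exact: measurable_ball_preimage.
Qed.

End Measurability.

(** * Integration on the circle *)

Section CircleMeasure.
Context {R : realType}.
Local Notation T := (circle R).
Local Notation m := (circle_measure R).

Lemma normC_Re (c : R[i]) : (complex.Re `|c|)%:C = `|c|.
Proof. by case: c => a b; rewrite normc_def. Qed.

Lemma abs_Re (c : R[i]) : `|complex.Re c| <= complex.Re `|c|.
Proof.
case: c => x y /=; rewrite -sqrtr_sqr ler_sqrt ?addr_ge0 ?sqr_ge0//.
by rewrite lerDl sqr_ge0.
Qed.

Lemma abs_Im (c : R[i]) : `|complex.Im c| <= complex.Re `|c|.
Proof.
case: c => x y /=; rewrite -sqrtr_sqr ler_sqrt ?addr_ge0 ?sqr_ge0//.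
by rewrite lerDr sqr_ge0.
Qed.

Lemma Re_norm_le (c : R[i]) : complex.Re `|c| <= `|complex.Re c| + `|complex.Im c|.
Proof.
case: c => x y /=; rewrite -(@ler_pXn2r _ 2)// ?nnegrE ?addr_ge0// ?sqrtr_ge0//.
rewrite sqr_sqrtr ?addr_ge0 ?sqr_ge0// [leRHS]sqrrD !real_normK ?num_real//.
by rewrite lerD2r lerDl mulrn_wge0// mulr_ge0.
Qed.

Lemma continuous_complex_part (p : {additive R[i] -> R}) :
  (forall c, `|p c| <= complex.Re `|c|) -> continuous (p : R[i]^o -> R).
Proof.
move=> hp x; apply/(@cvgrPdist_lt R R^o _ (nbhs (x : R[i]^o)) _ p) => e e0.
have e0' : (0 : R[i]) < e%:C by rewrite ltcR.
apply: filterS (nbhsx_ballx (x : R[i]^o) _ e0') => y; rewrite -ball_normE /= -raddfB.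
by rewrite -normC_Re ltcR; apply: le_lt_trans.
Qed.

Lemma continuous_Re : continuous (fun z : R[i]^o => complex.Re z : R).
Proof. exact: (continuous_complex_part (p := @complex.Re R) abs_Re). Qed.

Lemma continuous_Im : continuous (fun z : R[i]^o => complex.Im z : R).
Proof. exact: (continuous_complex_part (p := @complex.Im R) abs_Im). Qed.

Lemma continuous_zval : continuous (@zval R : T -> R[i]^o).
Proof. exact: initial_continuous. Qed.

Lemma measurable_circle_continuous (f : T -> R) :
  continuous f -> measurable_fun [set: T] f.
Proof.
move=> cf; apply: (measurability _ (RGenOpens.measurableE R)).
move=> _ [_ [a [b ->] <-]]; rewrite setTI; apply: sub_sigma_algebra.
move/continuousP: cf; apply; exact: interval_open.
Qed.

Definition cmeas (f : T -> R[i]) : Prop :=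
  measurable_fun [set: T] (fun z => complex.Re (f z)) /\
  measurable_fun [set: T] (fun z => complex.Im (f z)).

Lemma cmeas_zval : cmeas (@zval R).
Proof.
split; apply: measurable_circle_continuous => x.
  by apply: continuous_comp; [exact: continuous_zval|exact: continuous_Re].
by apply: continuous_comp; [exact: continuous_zval|exact: continuous_Im].
Qed.

Lemma cmeasM f g : cmeas f -> cmeas g -> cmeas (fun z => f z * g z).
Proof.
move=> [f1 f2] [g1 g2]; split.
  rewrite (_ : (fun _ => _) = (fun z => complex.Re (f z) * complex.Re (g z) -
                       complex.Im (f z) * complex.Im (g z))).
    by apply: measurable_funB; exact: measurable_funM.
  by apply/funext => z; case: (f z) (g z) => ? ? [].
rewrite (_ : (fun _ => _) = (fun z => complex.Re (f z) * complex.Im (g z) +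
                       complex.Im (f z) * complex.Re (g z))).
  by apply: measurable_funD; exact: measurable_funM.
by apply/funext => z; case: (f z) (g z) => ? ? [].
Qed.

Lemma cmeas_cst c : cmeas (fun=> c).
Proof. by split; exact: measurable_cst. Qed.

Lemma cmeasJ f : cmeas f -> cmeas (fun z => (f z)^*).
Proof.
move=> [f1 f2]; split.
  by rewrite (_ : (fun _ => _) = (fun z => complex.Re (f z)))//;
    apply/funext => z; case: (f z).
rewrite (_ : (fun _ => _) = (fun z => - complex.Im (f z))).
  exact: measurable_funN.
by apply/funext => z; case: (f z).
Qed.

Lemma cmeasX f n : cmeas f -> cmeas (fun z => f z ^+ n).
Proof.
move=> mf; elim: n => [|n IH].
  by rewrite (_ : (fun _ => _) = fun=> 1)//; apply: cmeas_cst.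
rewrite (_ : (fun _ => _) = (fun z => f z * f z ^+ n)); first exact: cmeasM.
by apply/funext => z; rewrite exprS.
Qed.

Lemma normr_zval (z : T) : `|zval z| = 1.
Proof. exact: (set_mem (valP z)). Qed.

Lemma zval_conj (z : T) : zval z * (zval z)^* = 1.
Proof. by rewrite -normCK normr_zval expr1n. Qed.

Lemma conj_zval (z : T) : (zval z)^* * zval z = 1.
Proof. by rewrite mulrC zval_conj. Qed.

Lemma zval_conjT (z : T) : zval (conjT z) = (zval z)^*.
Proof. by []. Qed.

Lemma zval_inj (z w : T) : zval z = zval w -> z = w.
Proof. exact: val_inj. Qed.

Lemma conjTK : involutive (@conjT R).
Proof. by move=> z; apply: zval_inj; rewrite !zval_conjT conjCK. Qed.

Lemma measurable_conjT : measurable_fun [set: T] (@conjT R).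
Proof.
apply: (@measurability _ _ _ T setT (@conjT R) (@open T)) => //.
move=> _ [A [B oB <-] <-]; rewrite setTI; apply: sub_sigma_algebra.
exists ((fun c : R[i] => c^* : R[i]) @^-1` B) => //.
rewrite openE => c /= Bc.
have : nbhs (c^* : R[i]^o) B by exact: open_nbhs_nbhs.
rewrite /interior -!nbhs_ballE => -[e /= e0 he]; exists e => // y.
rewrite -ball_normE /= => cy; apply: he; rewrite -ball_normE /= -rmorphB.
by rewrite norm_conjC.
Qed.

Definition arcc (t : R) : R[i] := cos (2 * pi * t) +i* sin (2 * pi * t).

Lemma zval_arc t : zval (circle_arc t) = arcc t.
Proof. by []. Qed.

Lemma measurable_arc : measurable_fun [set: measurableTypeR R] (@circle_arc R).
Proof.
apply: (@measurability _ _ _ T setT (@circle_arc R) (@open T)) => //.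
move=> _ [_ [B oB <-] <-]; rewrite setTI; apply: open_measurable.
rewrite openE => t /= Bt.
have : nbhs (arcc t : R[i]^o) B by exact: open_nbhs_nbhs.
rewrite -nbhs_ballE => -[e /= /ltc_real[r r0 ->] he].
have r2 : 0 < r / 2 by rewrite divr_gt0.
have ct : continuous (fun t : R => 2 * pi * t).
  by move=> x; exact: mulrl_continuous.
have c1 : continuous (fun t : R => cos (2 * pi * t)).
  by move=> x; apply: continuous_comp; [exact: ct|exact: continuous_cos].
have c2 : continuous (fun t : R => sin (2 * pi * t)).
  by move=> x; apply: continuous_comp; [exact: ct|exact: continuous_sin].
have H1 := (cvgrPdist_lt _ _).1 (c1 t) _ r2.
have H2 := (cvgrPdist_lt _ _).1 (c2 t) _ r2.
rewrite /interior; near=> s; apply: he; rewrite -ball_normE /=.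
have ft : `|cos (2 * pi * t) - cos (2 * pi * s)| < r / 2 by near: s; exact: H1.
have gt : `|sin (2 * pi * t) - sin (2 * pi * s)| < r / 2 by near: s; exact: H2.
rewrite -normC_Re ltcR; apply: le_lt_trans (Re_norm_le _) _; rewrite !raddfB.
by rewrite (splitr r) ltrD.
Unshelve. all: by end_near. Qed.

Local Notation leb := (mrestr (@lebesgue_measure R) (measurable_itv `[0%R, 1%R])).

Lemma circle_measureE (A : set T) :
  m A = lebesgue_measure ((@circle_arc R @^-1` A) `&` `[0%R, 1%R]).
Proof. by []. Qed.

Lemma circle_measureT : m setT = 1%E.
Proof.
by rewrite circle_measureE preimage_setT setTI lebesgue_measure_itv /= lte_fin ltr01 sube0.
Qed.

HB.instance Definition _ := @Measure_isProbability.Build _ _ R m circle_measureT.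

Lemma arcc1B t : arcc (1 - t) = (arcc t)^*.
Proof.
rewrite /arcc mulrBr mulr1 cosB sinB mulr_natl cos2pi sin2pi mul1r !mul0r addr0 add0r.
by rewrite mul1r.
Qed.

Lemma conjT_arc (t : R) : conjT (circle_arc (1 - t)) = circle_arc t.
Proof. by apply: zval_inj; rewrite zval_conjT !zval_arc arcc1B conjCK. Qed.

(** In the parameter t of the arc, conjugation is t -> 1 - t, which preserves [0, 1] and Lebesgue
    measure; the latter follows from uniqueness of Lebesgue measure given its values on half-open
    intervals. *)
Lemma conjT_measure (A : set T) : measurable A -> m (@conjT R @^-1` A) = m A.
Proof.
move=> mA; rewrite !circle_measureE.
pose onem := (fun t : R => 1 - t) : measurableTypeR R -> measurableTypeR R.
have monem : measurable_fun setT onem by exact: measurable_funB.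
have H B : measurable B -> lebesgue_measure (onem @^-1` B) = lebesgue_measure B.
  move=> mB.
  apply/esym/(@lebesgue_measure_unique _
    (measure_function_pushforward__canonical__measure_function_Measure
      (@lebesgue_measure R) monem)) => //= _ [[a b]] _ <-.
  rewrite /pushforward (_ : onem @^-1` _ = `[1 - b, 1 - a[%classic); last first.
    apply/seteqP; split=> t /=; rewrite /onem !in_itv /= => /andP[h1 h2];
      apply/andP; split; lra.
  rewrite !lebesgue_measure_itv/= !lte_fin -!EFinB.
  have -> : 1 - b < 1 - a = (a < b) by rewrite ltrD2l ltrN2.
  by congr (if _ then _ else _); congr EFin; ring.
rewrite -H; last first.
  apply: measurableI => //; rewrite -[X in measurable X]setTI; apply: measurable_arc => //.
  by rewrite -[X in measurable X]setTI; exact: measurable_conjT.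
congr lebesgue_measure; apply/seteqP; split=> t /=; rewrite /onem !in_itv /=.
  by move=> [+ /andP[h1 h2]]; rewrite conjT_arc; split => //; apply/andP; split; lra.
by rewrite conjT_arc => -[h /andP[h1 h2]]; split => //; apply/andP; split; lra.
Qed.

Definition cint (f : T -> R) : Prop := m.-integrable setT (EFin \o f).

Lemma cint_meas f : cint f -> measurable_fun [set: T] f.
Proof. by move=> /measurable_int /measurable_EFinP. Qed.

Lemma cint_le (f g : T -> R) : measurable_fun [set: T] f -> cint g ->
  (forall z, `|f z| <= g z) -> cint f.
Proof.
move=> mf ig h; apply: le_integrable ig => //; first exact/measurable_EFinP.
move=> z _ /=; rewrite lee_fin; apply: le_trans (h z) _; exact: ler_norm.
Qed.

Lemma cintD f g : cint f -> cint g -> cint (fun z => f z + g z).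
Proof. by move=> fi gi; apply: (integrableD measurableT fi gi). Qed.

Lemma cintZ (r : R) f : cint f -> cint (fun z => r * f z).
Proof. by move=> fi; apply: (integrableZl measurableT r fi). Qed.

Lemma cint_cst (r : R) : cint (fun=> r).
Proof. exact: finite_measure_integrable_cst. Qed.

Lemma ge0_integral_conjT (g : T -> \bar R) : measurable_fun setT g ->
  (forall z, 0 <= g z)%E -> (\int[m]_z g (conjT z) = \int[m]_z g z)%E.
Proof.
move=> mg g0; transitivity (\int[pushforward m (@conjT R)]_z g z)%E.
  by rewrite (ge0_integral_pushforward measurable_conjT m measurableT mg).
apply: (@eq_measure_integral _ _ _ _ m
  (measure_function_pushforward__canonical__measure_function_Measure m measurable_conjT)).
by move=> A mA _; exact: conjT_measure.
Qed.

Lemma cintJ (f : T -> R) : cint f -> cint (fun z => f (conjT z)).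
Proof.
move=> fi; have mf := cint_meas fi.
have mfJ := measurableT_comp mf measurable_conjT.
apply/integrableP; split; first exact/measurable_EFinP.
have /integrableP[_] := fi; rewrite -ge0_integral_conjT //.
by apply: measurableT_comp => //; exact/measurable_EFinP.
Qed.

Lemma RintegralJ (f : T -> R) : cint f ->
  \int[m]_z f (conjT z) = \int[m]_z f z.
Proof.
move=> fi; rewrite /Rintegral; congr fine; have mf := cint_meas fi.
transitivity (\int[pushforward m (@conjT R)]_z (f z)%:E)%E.
  apply/esym/(@integral_pushforward _ _ _ _ _ _ measurable_conjT m setT (EFin \o f)) => //.
    exact/measurable_EFinP.
  exact: cintJ.
apply: (@eq_measure_integral _ _ _ _ m
  (measure_function_pushforward__canonical__measure_function_Measure m measurable_conjT)).
by move=> A mA _; exact: conjT_measure.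
Qed.

Lemma arcX t n : arcc t ^+ n = arcc (n%:R * t).
Proof.
elim: n => [|n IH]; first by rewrite /arcc mul0r mulr0 cos0 sin0 expr0.
rewrite exprS IH /arcc -(natr1 n) (mulrDl n%:R) mul1r mulrDr cosD sinD.
apply/eqP; rewrite eq_complex /=; apply/andP; split; apply/eqP; ring.
Qed.

(** Brings integrals on the circle to [0, 1], where the fundamental theorem of calculus applies. *)
Lemma integral_circle (f : T -> R) : cint f ->
  (\int[m]_z (f z)%:E = \int[lebesgue_measure]_(t in `[0%R, 1%R]) (f (circle_arc t))%:E)%E.
Proof.
move=> fi; have mf := cint_meas fi.
have mfE : measurable_fun setT (EFin \o f) by exact/measurable_EFinP.
have mN : measurable (~` `[0%R, 1%R] : set (measurableTypeR R)).
  by apply: measurableC; exact: measurable_itv.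
have lT : (leb setT < +oo)%E.
  by rewrite /= /mrestr setTI lebesgue_measure_itv /= lte_fin ltr01 sube0 ltry.
have iF : leb.-integrable setT (EFin \o (f \o @circle_arc R)).
  apply/integrableP; split.
    apply/measurable_EFinP; apply: measurableT_comp mf _; exact: measurable_arc.
  have /integrableP[_] := fi.
  rewrite (ge0_integral_pushforward measurable_arc leb measurableT _) //.
  by apply: measurableT_comp => //; exact: mfE.
transitivity (\int[leb]_t (f (circle_arc t))%:E)%E.
  exact: (@integral_pushforward _ _ _ _ _ _ measurable_arc leb setT (EFin \o f)).
rewrite (@negligible_integral _ _ _ leb setT (~` `[0%R, 1%R])) //; last first.
  by rewrite /= /mrestr setICl measure0.
rewrite setDE setTI setCK.
apply: eq_measure_integral => A mA Asub.
by rewrite /= /mrestr setIidl.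
Qed.

Lemma Rintegral_zvalX n : (0 < n)%N -> forall c,
  \int[m]_z complex.Re (c * zval z ^+ n) = 0.
Proof.
move=> n0 [a b]; have fi : cint (fun z : T => complex.Re ((a +i* b) * zval z ^+ n)).
  apply: (@cint_le _ (fun=> complex.Re `|a +i* b|)).
  - by case: (cmeasM (cmeas_cst (a +i* b)) (cmeasX n cmeas_zval)).
  - exact: cint_cst.
  - move=> z; apply: le_trans (abs_Re _) _.
    by rewrite normrM normrX normr_zval expr1n mulr1.
rewrite /Rintegral integral_circle //.
pose w : R := 2 * pi * n%:R.
have w0 : w != 0 by rewrite !mulf_neq0 ?pnatr_eq0 -?lt0n// gt_eqF// pi_gt0.
(* Primitive of [g], the real part of (a + ib) exp(iwt). The boundary terms cancel because exp(iw) =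
   1. *)
pose F t := (a * sin (w * t) + b * cos (w * t)) / w.
pose g t := a * cos (w * t) - b * sin (w * t).
have dF (t : R) : is_derive t 1 F (g t).
  have dw : is_derive t 1 (fun t : R => w * t) w.
    by apply: is_derive_eq; rewrite /GRing.scale /= mulr1.
  have ds : is_derive t 1 (fun t : R => sin (w * t)) (w * cos (w * t)).
    by rewrite mulrC; apply: (is_derive1_comp (f := sin) (g := fun t => w * t)).
  have dc : is_derive t 1 (fun t : R => cos (w * t)) (w * - sin (w * t)).
    by rewrite mulrC; apply: (is_derive1_comp (f := cos) (g := fun t => w * t)).
  have da : is_derive t 1 (fun t : R => a * sin (w * t) + b * cos (w * t)) (w * g t).
    apply: is_derive_eq; rewrite /g /GRing.scale /=; ring.
  rewrite (_ : F = fun t => w^-1 * (a * sin (w * t) + b * cos (w * t))); last first.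
    by apply/funext => x; rewrite /F mulrC.
  by apply: is_derive_eq; rewrite /GRing.scale /= mulKf.
under eq_integral => t _.
  rewrite zval_arc arcX /arcc [complex.Re _](_ : _ = g t); last first.
    by rewrite /g /w /=; congr (_ * cos _ - _ * sin _); ring.
  over.
have ct : continuous (fun t : R => w * t) by move=> x; exact: mulrl_continuous.
have cg : continuous g.
  move=> x; apply: cvgB; apply: cvgMr; apply: continuous_comp;
    [exact: ct|exact: continuous_cos|exact: ct|exact: continuous_sin].
have cF : continuous F.
  by move=> x; apply: differentiable_continuous; apply/derivable1_diffP; case: (dF x).
rewrite (@continuous_FTC2 _ g F) //.
- rewrite -EFinB /= /F !mulr0 sin0 cos0 mulr0 add0r !mulr1.
  have : arcc n%:R = 1.
    by rewrite -[n%:R]mulr1 -arcX /arcc mulr1 mulr_natl cos2pi sin2pi expr1n.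
  by rewrite /arcc -/w => -[-> ->]; rewrite mulr0 add0r mulr1 subrr.
- exact: continuous_subspaceT.
- split.
  + by move=> x _; case: (dF x).
  + by apply: cvg_at_right_filter; exact: cF.
  + by apply: cvg_at_left_filter; exact: cF.
- by move=> x _; rewrite derive1E; case: (dF x).
Qed.

End CircleMeasure.

(** * Uniqueness of Fourier coefficients *)

Section FourierUniqueness.
Context {R : realType}.
Local Notation T := (circle R).
Local Notation m := (circle_measure R).

Definition ccint (f : T -> R[i]) : Prop :=
  cint (fun z => complex.Re (f z)) /\ cint (fun z => complex.Im (f z)).

Lemma ccint_cmeas f : ccint f -> cmeas f.
Proof. by move=> [f1 f2]; split; exact: cint_meas. Qed.

Lemma Re_normM (c d : R[i]) : complex.Re `|c * d| = complex.Re `|c| * complex.Re `|d|.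
Proof.
by rewrite normrM; case: c d => a b [a' b']; rewrite !normc_def /= mul0r subr0.
Qed.

Lemma Re_norm_ge0 (c : R[i]) : 0 <= complex.Re `|c|.
Proof. by case: c => a b /=; exact: sqrtr_ge0. Qed.

Lemma ccintM (a f : T -> R[i]) (C : R) : cmeas a -> (forall z, complex.Re `|a z| <= C) ->
  ccint f -> ccint (fun z => a z * f z).
Proof.
move=> ma aC fi; have [m1 m2] := cmeasM ma (ccint_cmeas fi); case: fi => f1 f2.
have fi : cint (fun z => C * (`|complex.Re (f z)| + `|complex.Im (f z)|)).
  apply/cintZ/cintD; [exact: (integrable_norm f1)|exact: (integrable_norm f2)].
have H z : complex.Re `|a z * f z| <= C * (`|complex.Re (f z)| + `|complex.Im (f z)|).
  rewrite Re_normM; apply: ler_pM => //; try exact: Re_norm_ge0; exact: Re_norm_le.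
split; apply: (cint_le _ fi) => // z.
  exact: le_trans (abs_Re _) (H z).
exact: le_trans (abs_Im _) (H z).
Qed.

Lemma ccintD f g : ccint f -> ccint g -> ccint (fun z => f z + g z).
Proof.
move=> [f1 f2] [g1 g2]; split.
  rewrite (_ : (fun _ => _) = (fun z => complex.Re (f z) + complex.Re (g z))).
    exact: cintD.
  by apply/funext => z; rewrite raddfD.
rewrite (_ : (fun _ => _) = (fun z => complex.Im (f z) + complex.Im (g z))).
  exact: cintD.
by apply/funext => z; rewrite raddfD.
Qed.

Lemma ccintZ c f : ccint f -> ccint (fun z => c * f z).
Proof. by apply: (ccintM (C := complex.Re `|c|)) => //; exact: cmeas_cst. Qed.

Lemma norm_zvalX n (z : T) : complex.Re `|zval z ^+ n| = 1.
Proof. by rewrite normrX normr_zval expr1n. Qed.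

Lemma norm_zvalJX n (z : T) : complex.Re `|(zval z)^* ^+ n| = 1.
Proof. by rewrite normrX norm_conjC normr_zval expr1n. Qed.

Lemma ccint_zX n f : ccint f -> ccint (fun z => zval z ^+ n * f z).
Proof.
apply: (ccintM (C := 1)) => [|z]; first exact/cmeasX/cmeas_zval.
by rewrite norm_zvalX.
Qed.

Lemma ccint_zJX n f : ccint f -> ccint (fun z => (zval z)^* ^+ n * f z).
Proof.
apply: (ccintM (C := 1)) => [|z]; first exact/cmeasX/cmeasJ/cmeas_zval.
by rewrite norm_zvalJX.
Qed.

(** All Fourier coefficients vanish. Letting [c] range over the complex numbers recovers each
    coefficient from real parts, so only real integrals occur. *)
Definition fourier0 (f : T -> R[i]) : Prop := ccint f /\
  forall n c, \int[m]_z complex.Re (c * (zval z ^+ n * f z)) = 0 /\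
              \int[m]_z complex.Re (c * ((zval z)^* ^+ n * f z)) = 0.

Lemma fourier0_eq f g : fourier0 f -> f =1 g -> fourier0 g.
Proof. by move=> + /funext <-. Qed.

Lemma fourier0D f g : fourier0 f -> fourier0 g -> fourier0 (fun z => f z + g z).
Proof.
move=> [fi fZ] [gi gZ]; split; first exact: ccintD.
move=> n c; have [f1 f2] := fZ n c; have [g1 g2] := gZ n c; split.
  have := RintegralD measurableT (proj1 (ccintZ c (ccint_zX n fi)))
    (proj1 (ccintZ c (ccint_zX n gi))).
  rewrite f1 g1 addr0 => <-; apply: eq_Rintegral => z _.
  by rewrite mulrDr mulrDr raddfD.
have := RintegralD measurableT (proj1 (ccintZ c (ccint_zJX n fi)))
  (proj1 (ccintZ c (ccint_zJX n gi))).
rewrite f2 g2 addr0 => <-; apply: eq_Rintegral => z _.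
by rewrite mulrDr mulrDr raddfD.
Qed.

Lemma fourier0Z a f : fourier0 f -> fourier0 (fun z => a * f z).
Proof.
move=> [fi fZ]; split; first exact: ccintZ.
move=> n c; have [f1 f2] := fZ n (c * a); split.
  by rewrite -f1; apply: eq_Rintegral => z _; congr complex.Re; ring.
by rewrite -f2; apply: eq_Rintegral => z _; congr complex.Re; ring.
Qed.

Lemma fourier0_z f : fourier0 f -> fourier0 (fun z => zval z * f z).
Proof.
move=> [fi fZ]; split.
  by have := ccint_zX 1 fi; under eq_fun do rewrite expr1.
move=> n c; split.
  have [<- _] := fZ n.+1 c; apply: eq_Rintegral => z _.
  by rewrite exprSr !mulrA.
case: n => [|n].
  have [<- _] := fZ 1%N c; apply: eq_Rintegral => z _; by rewrite expr0 expr1 mul1r.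
have [_ <-] := fZ n c; apply: eq_Rintegral => z _.
by rewrite exprSr -!mulrA (mulrA _^* (zval z)) conj_zval mul1r.
Qed.

Lemma fourier0_zJ f : fourier0 f -> fourier0 (fun z => (zval z)^* * f z).
Proof.
move=> [fi fZ]; split.
  by have := ccint_zJX 1 fi; under eq_fun do rewrite expr1.
move=> n c; split; last first.
  have [_ <-] := fZ n.+1 c; apply: eq_Rintegral => z _.
  by rewrite exprSr !mulrA.
case: n => [|n].
  have [_ <-] := fZ 1%N c; apply: eq_Rintegral => z _; by rewrite expr0 expr1 mul1r.
have [<- _] := fZ n c; apply: eq_Rintegral => z _.
by rewrite exprSr -!mulrA (mulrA (zval z) _^*) zval_conj mul1r.
Qed.

(** Closure of these multipliers under products and bounded pointwise limits takes the place of a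
    density theorem for trigonometric polynomials. *)
Definition fmult (h : T -> R) : Prop := measurable_fun [set: T] h /\
  forall f, fourier0 f -> fourier0 (fun z => (h z)%:C * f z).

Lemma fmult_eq h g : fmult h -> h =1 g -> fmult g.
Proof. by move=> + /funext <-. Qed.

Lemma fmult_cst (r : R) : fmult (fun=> r).
Proof. by split => [|f]; [exact: measurable_cst|exact: fourier0Z]. Qed.

Lemma fmultD h g : fmult h -> fmult g -> fmult (fun z => h z + g z).
Proof.
move=> [mh hZ] [mg gZ]; split; first exact: measurable_funD.
move=> f fZ; apply: fourier0_eq (fourier0D (hZ _ fZ) (gZ _ fZ)) _ => z.
by rewrite rmorphD mulrDl.
Qed.

Lemma fmultM h g : fmult h -> fmult g -> fmult (fun z => h z * g z).
Proof.
move=> [mh hZ] [mg gZ]; split; first exact: measurable_funM.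
move=> f fZ; apply: fourier0_eq (hZ _ (gZ _ fZ)) _ => z.
by rewrite rmorphM mulrA.
Qed.

Lemma fmultX h n : fmult h -> fmult (fun z => h z ^+ n).
Proof.
move=> mh; elim: n => [|n IH]; first by under eq_fun do rewrite expr0; exact: fmult_cst.
by under eq_fun do rewrite exprS; exact: fmultM.
Qed.

Lemma fmult_1B h : fmult h -> fmult (fun z => 1 - h z).
Proof.
move=> mh; apply: fmult_eq (fmultD (fmult_cst 1) (fmultM (fmult_cst (- 1)) mh)) _ => z.
by rewrite mulN1r.
Qed.

(** The factor 1/4 brings the squared chord into [0, 1], where [bump] is controlled; in z it is the
    trigonometric polynomial of [chord2E]. *)
Definition chord2 (w z : T) : R := (complex.Re `|zval z - zval w|) ^+ 2 / 4.

Lemma chord2E w z : (chord2 w z)%:C =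
  2^-1 - (4^-1 * (zval w)^*) * zval z - (4^-1 * zval w) * (zval z)^*.
Proof.
have -> : (chord2 w z)%:C = (4^-1) * `|zval z - zval w| ^+ 2.
  by rewrite /chord2 rmorphM rmorphXn /= normC_Re mulrC fmorphV /= rmorph_nat.
rewrite normCK rmorphB /= mulrBr !mulrBl zval_conj.
rewrite (_ : zval w * (zval w)^* = 1) ?zval_conj//.
have -> : 2^-1 = 4^-1 * 2 :> R[i] by field.
ring.
Qed.

Lemma fmult_chord2 w : fmult (chord2 w).
Proof.
have E f : fourier0 f -> fourier0 (fun z => (chord2 w z)%:C * f z).
  move=> fZ.
  have := fourier0D (fourier0D (fourier0Z 2^-1 fZ)
   (fourier0Z (- (4^-1 * (zval w)^*)) (fourier0_z fZ)))
   (fourier0Z (- (4^-1 * zval w)) (fourier0_zJ fZ)).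
  by move/fourier0_eq; apply => z; rewrite chord2E; ring.
split => //; have [m1 m2] := @cmeas_zval R.
rewrite (_ : chord2 w = fun z => ((complex.Re (zval z) - complex.Re (zval w)) ^+ 2 +
  (complex.Im (zval z) - complex.Im (zval w)) ^+ 2) / 4).
  apply: measurable_funM; last exact: measurable_cst.
  by apply: measurable_funD; apply: measurable_funX;
    apply: measurable_funB => //; exact: measurable_cst.
apply/funext => z; rewrite /chord2; case: (zval z) (zval w) => a b [a' b'] /=.
by rewrite sqr_sqrtr ?addr_ge0 ?sqr_ge0.
Qed.

Lemma chord2_ge0 w z : 0 <= chord2 w z.
Proof. by rewrite divr_ge0 ?sqr_ge0. Qed.

Lemma chord2_le1 w z : chord2 w z <= 1.
Proof.
rewrite ler_pdivrMr// mul1r.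
have -> : 4 = 2 ^+ 2 :> R by ring.
rewrite ler_pXn2r ?nnegrE ?Re_norm_ge0//.
have := ler_normB (zval z) (zval w); rewrite !normr_zval -normC_Re.
by rewrite (_ : 1 + 1 = (2 : R)%:C) ?lecR// rmorph_nat.
Qed.

Lemma dominated_zero (h : nat -> T -> R) (l g : T -> R) :
  (forall n, measurable_fun [set: T] (h n)) -> cint g ->
  (forall n z, `|h n z| <= g z) -> (forall z, h ^~ z @ \oo --> l z) ->
  (forall n, \int[m]_z h n z = 0) -> cint l /\ \int[m]_z l z = 0.
Proof.
move=> mh ig hg hl h0.
have ml : measurable_fun [set: T] l by apply: (measurable_fun_cvg mh) => z _; exact: hl.
have [|||||il _ H] := @dominated_convergence _ _ _ m setT measurableT
  (fun n => EFin \o h n) (EFin \o l) (EFin \o g).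
- by move=> n; exact/measurable_EFinP.
- exact/measurable_EFinP.
- by apply: nearW => z _; apply/fine_cvgP; split; [exact: nearW|exact: hl].
- exact: ig.
- by apply: nearW => z n _ /=; rewrite lee_fin.
split; first exact: il.
have hi n : cint (h n) by apply: cint_le ig _.
move: H; rewrite (_ : [sequence _]_n = fun=> 0%E); last first.
  apply/funext => n /=; rewrite -[LHS]fineK.
    by rewrite -[fine _]/(Rintegral m setT (h n)) h0.
  exact: integrable_fin_num (hi n).
move=> H; rewrite /Rintegral (_ : (\int[m]_z _)%E = 0%E)//.
by have := cvg_lim (@ereal_hausdorff R) H; rewrite lim_cst// => <-.
Qed.

(** The bound 1 lets |K| dominate the products of h_n with K, where K is the real part of c z^n f or
    of c z^-n f. *)
Lemma fmult_lim (h : nat -> T -> R) (l : T -> R) : (forall n, fmult (h n)) ->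
  (forall n z, `|h n z| <= 1) -> (forall z, h ^~ z @ \oo --> l z) -> fmult l.
Proof.
move=> hm h1 hl.
have mh n : measurable_fun [set: T] (h n) by case: (hm n).
have ml : measurable_fun [set: T] l by apply: (measurable_fun_cvg mh) => z _; exact: hl.
split=> // f fZ.
have l1 z : `|l z| <= 1.
  rewrite -(cvg_lim _ (cvg_norm (hl z)))//; apply: limr_le; last exact: nearW.
  exact: cvgP (cvg_norm (hl z)).
have RM (r : R) (c : R[i]) : complex.Re (r%:C * c) = r * complex.Re c.
  by case: c => a b /=; rewrite mul0r subr0.
have key (K : T -> R) : cint K -> (forall k, \int[m]_z (h k z * K z) = 0) ->
    \int[m]_z (l z * K z) = 0.
  move=> Ki hK; have mK := cint_meas Ki.
  apply: (proj2 (@dominated_zero (fun k z => h k z * K z) _ (fun z => `|K z|) _ _ _ _ _)) => //.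
  - by move=> k; exact: measurable_funM.
  - exact: (integrable_norm Ki).
  - by move=> k z; rewrite normrM ler_piMl.
  - by move=> z; apply: cvgM; [exact: hl|exact: cvg_cst].
split.
  apply: (ccintM (C := 1)); last by case: fZ.
    by split => //=; exact: measurable_cst.
  by move=> z; rewrite normc_def /= expr0n addr0 sqrtr_sqr.
have [fi _] := fZ.
move=> n c; split.
  have := key _ (proj1 (ccintZ c (ccint_zX n fi))) _; move=> <-.
    by apply: eq_Rintegral => z _; rewrite -RM; congr complex.Re; ring.
  move=> k; have [_ /(_ n c)[<- _]] := (hm k).2 _ fZ.
  by apply: eq_Rintegral => z _; rewrite -RM; congr complex.Re; ring.
have := key _ (proj1 (ccintZ c (ccint_zJX n fi))) _; move=> <-.
  by apply: eq_Rintegral => z _; rewrite -RM; congr complex.Re; ring.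
move=> k; have [_ /(_ n c)[_ <-]] := (hm k).2 _ fZ.
by apply: eq_Rintegral => z _; rewrite -RM; congr complex.Re; ring.
Qed.

(** With s the square root of r, n s^n stays below 1/(1 - s) by [bern], and the remaining factor s^n
    tends to 0. *)
Lemma cvg_expr_mulrn (r : R) : 0 <= r < 1 -> (fun n => n%:R * r ^+ n) @ \oo --> (0 : R).
Proof.
move=> /andP[r0 r1]; pose s := Num.sqrt r.
have s0 : 0 <= s by exact: sqrtr_ge0.
have s1 : s < 1 by rewrite -sqrtr1 ltr_sqrt.
have sr : r = s ^+ 2 by rewrite sqr_sqrtr.
have sX n : 0 <= s ^+ n <= 1 by rewrite exprn_ge0// exprn_ile1// ltW.
have bern n : n%:R * s ^+ n * (1 - s) <= 1 - s ^+ n.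
  elim: n => [|n IH]; first by rewrite !mul0r expr0 subrr.
  have [h0 h1] := andP (sX n); rewrite -(natr1 n) exprS.
  have p1 := ler_wpM2l s0 IH.
  have p2 : 0 <= (1 - s) * (1 - s * s ^+ n).
    by rewrite mulr_ge0 ?subr_ge0 ?(ltW s1)// mulr_ile1// ltW.
  move: (s ^+ n) (n%:R : R) p1 p2 => x k p1 p2; lra.
apply: (@squeeze_cvgr _ _ _ _ (fun=> 0) (fun n => (1 - s)^-1 * s ^+ n)).
- apply: nearW => n; rewrite mulr_ge0 ?exprn_ge0//= sr -exprM mulnC exprM expr2 mulrA.
  have [h0 h1] := andP (sX n).
  apply: ler_wpM2r => //; rewrite -[leRHS]mul1r ler_pdivlMr ?subr_gt0//.
  by apply: le_trans (bern n) _; rewrite lerBlDr lerDl.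
- exact: cvg_cst.
- rewrite -[X in _ --> X](mulr0 (1 - s)^-1); apply: cvgM; first exact: cvg_cst.
  by apply: cvg_expr; rewrite ger0_norm.
Qed.

Lemma bernoulli_ge (y : R) n : 0 <= y <= 1 -> 1 - n%:R * y <= (1 - y) ^+ n.
Proof.
move=> /andP[y0 y1]; elim: n => [|n IH]; first by rewrite mul0r subr0 expr0.
have h : 0 <= n%:R * y by rewrite mulr_ge0.
rewrite exprS -(natr1 n); move: ((1 - y) ^+ n) (n%:R : R) IH h => x k IH h; nra.
Qed.

Lemma bernoulli_le (y : R) n : 0 <= y <= 1 -> (1 - y) ^+ n * (1 + n%:R * y) <= 1.
Proof.
move=> /andP[y0 y1]; elim: n => [|n IH]; first by rewrite mul0r addr0 expr0 mulr1.
have h : 0 <= n%:R * y by rewrite mulr_ge0.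
have h2 : 0 <= (1 - y) ^+ n by rewrite exprn_ge0// subr_ge0.
apply: le_trans IH; rewrite exprS -(natr1 n).
move: ((1 - y) ^+ n) (n%:R : R) h h2 => x k h x0.
have : (1 - y) * (1 + (k + 1) * y) <= 1 + k * y by nra.
by move=> /(ler_wpM2l x0); rewrite (mulrC (1 - y) x) -(mulrA x).
Qed.

(* Polynomials in [x] converging pointwise on [0, 1] to the indicator of
   [0, 1/k[; the extra factor [n] in the exponent gives the limit 0 at 1/k. *)
Definition bump (k n : nat) (x : R) : R := (1 - x ^+ n) ^+ (n * k ^ n).

Lemma bump_le1 k n x : 0 <= x <= 1 -> 0 <= bump k n x <= 1.
Proof.
move=> /andP[x0 x1]; have h : 0 <= 1 - x ^+ n by rewrite subr_ge0 exprn_ile1.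
by rewrite exprn_ge0//= exprn_ile1// lerBlDr lerDl exprn_ge0.
Qed.

(** For x < 1/k, [bernoulli_ge] bounds the value below by 1 - n (kx)^n, which tends to 1. For x >=
    1/k, [bernoulli_le] bounds it above by 1/(1 + n (kx)^n) <= 1/(n+1). *)
Lemma cvg_bump k (x : R) : (0 < k)%N -> 0 <= x <= 1 ->
  (fun n => bump k n x) @ \oo --> ((x < k%:R^-1)%R%:R : R).
Proof.
move=> k0 x01; have [x0 x1] := andP x01.
have k0' : 0 < k%:R :> R by rewrite ltr0n.
have xn n : 0 <= x ^+ n <= 1 by rewrite exprn_ge0// exprn_ile1.
have [xk|xk] := ltP x k%:R^-1.
  have kx : 0 <= k%:R * x < 1.
    apply/andP; split; first exact: mulr_ge0 (ltW k0') x0.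
    by rewrite mulrC -ltr_pdivlMr// mul1r.
  apply: (@squeeze_cvgr _ _ _ _ (fun n => 1 - n%:R * (k%:R * x) ^+ n) (fun=> 1)).
  - apply: nearW => n; have [_ ->] := andP (bump_le1 k n x01); rewrite andbT.
    apply: le_trans (bernoulli_ge _ (xn n)).
    by rewrite natrM natrX exprMn mulrA.
  - rewrite -[X in _ --> X]subr0; apply: cvgB; first exact: cvg_cst.
    exact: cvg_expr_mulrn.
  - exact: cvg_cst.
apply: (@squeeze_cvgr _ _ _ _ (fun=> 0) (fun n => n.+1%:R^-1)).
- apply: nearW => n; have [-> _] := andP (bump_le1 k n x01); rewrite /=.
  have := bernoulli_le (n * k ^ n) (xn n); rewrite -/(bump k n x).
  have : n.+1%:R <= 1 + (n * k ^ n)%:R * x ^+ n.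
    rewrite -natr1 addrC lerD2l natrM -mulrA ler_peMr// natrX -exprMn.
    by rewrite exprn_ege1// mulrC -ler_pdivrMr// mul1r.
  have [b0 _] := andP (bump_le1 k n x01).
  move=> h1 h2; rewrite -[leRHS]mul1r ler_pdivlMr//.
  by apply: le_trans h2; rewrite ler_wpM2l.
- exact: cvg_cst.
- exact: cvg_harmonic.
Qed.

Lemma fmult_ball w k : (0 < k)%N -> fmult (fun z => (chord2 w z < k%:R^-1)%R%:R).
Proof.
move=> k0; apply: (@fmult_lim (fun n z => bump k n (chord2 w z))).
- by move=> n; apply: fmultX; apply: fmult_1B; apply: fmultX; exact: fmult_chord2.
- move=> n z; have /(bump_le1 k n)/andP[h0 h1] : 0 <= chord2 w z <= 1.
    by rewrite chord2_ge0 chord2_le1.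
  by rewrite ger0_norm.
- by move=> z; apply: cvg_bump => //; rewrite chord2_ge0 chord2_le1.
Qed.

Lemma fmult_bigcup (A : nat -> set T) : (forall n, fmult (\1_(A n))) ->
  fmult (\1_(\bigcup_n A n)).
Proof.
(* [h n] is the indicator of the union of the first n sets, a polynomial in their indicators. *)
move=> hA; pose h n z := 1 - \prod_(i < n) (1 - \1_(A i) z) : R.
have hz n z : h n z = (z \in \bigcup_(i in [set i | (i < n)%N]) A i)%:R.
  rewrite /h; have [/set_mem[i /= ni Aiz]|/negP zA] := boolP (z \in _).
    by rewrite (bigD1 (Ordinal ni))//= indicE mem_set// subrr mul0r subr0.
  rewrite big1 ?subrr// => i _; rewrite indicE memNset ?subr0// => Aiz.
  by apply: zA; apply: mem_set; exists i => //=.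
apply: (@fmult_lim h).
- elim=> [|n [mh hf]]; first by rewrite /h; under eq_fun do rewrite big_ord0; exact: fmult_cst.
  rewrite /h; under eq_fun do rewrite big_ord_recr /=.
  apply: fmult_1B; apply: fmultM; last exact: fmult_1B.
  by apply: fmult_eq (fmult_1B (conj mh hf)) _ => z; rewrite /h subKr.
- by move=> n z; rewrite hz; case: (_ \in _); rewrite ?normr1 ?normr0.
- move=> z; rewrite indicE.
  have [/set_mem[i _ Aiz]|/negP zA] := boolP (z \in _).
    apply: cvg_near_cst; exists i.+1 => // n /= ni.
    by rewrite hz mem_set//; exists i.
  apply: cvg_near_cst; apply: nearW => n; rewrite hz memNset// => -[i _ Aiz].
  by apply: zA; apply: mem_set; exists i.
Qed.

Lemma Re_norm_dist (a b c : R[i]) :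
  complex.Re `|a - b| <= complex.Re `|a - c| + complex.Re `|b - c|.
Proof.
have := ler_distD c a b; rewrite (distrC c).
by rewrite -(normC_Re (a - b)) -(normC_Re (a - c)) -(normC_Re (b - c)) -rmorphD lecR.
Qed.

(** Points of a rational grid need not lie on the circle; each is replaced by a point of the circle
    within 2/(n+1) of it, if there is one. The 2 adds the rounding errors of the two coordinates. *)
Lemma circle_dense_seq : exists w : nat -> T, forall z (e : R), 0 < e ->
  exists j, complex.Re `|zval z - zval (w j)| < e.
Proof.
pose d (a b : int) n : R[i] := (a%:~R / n.+1%:R) +i* (b%:~R / n.+1%:R).
pose P a b n := [set w : T | complex.Re `|zval w - d a b n| <= 2 / n.+1%:R].
exists (fun j => if unpickle j is Some (a, b, n) then xget point (P a b n) else point).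
move=> z e e0; have e4 : 0 < e / 4 by rewrite divr_gt0.
have [n hn] := ex_invS_lt e4.
have fl (x : R) : `|x - (Num.floor (x * n.+1%:R))%:~R / n.+1%:R| <= n.+1%:R^-1.
  have n0 : 0 < n.+1%:R :> R by [].
  have h := floor_itv (x * n.+1%:R).
  rewrite -[x in `|x - _|](mulfK (lt0r_neq0 n0)) -mulrBl normrM.
  rewrite [`|_^-1|]gtr0_norm ?invr_gt0// ler_piMl ?invr_ge0//.
  have /andP[h1 h2] := h; rewrite ger0_norm ?subr_ge0// lerBlDl.
  by rewrite intrD in h2; exact: ltW.
pose a := Num.floor (complex.Re (zval z) * n.+1%:R).
pose b := Num.floor (complex.Im (zval z) * n.+1%:R).
have Pz : P a b n z.
  rewrite /P /=; apply: le_trans (Re_norm_le _) _.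
  have := lerD (fl (complex.Re (zval z))) (fl (complex.Im (zval z))).
  rewrite !raddfB /= -/a -/b; move/le_trans; apply.
  by rewrite mulrDl mul1r.
exists (pickle (a, b, n)); rewrite pickleK; case: xgetP => [w _ Pw|/(_ z)//].
apply: le_lt_trans (Re_norm_dist _ _ (d a b n)) _; apply: le_lt_trans (lerD Pz Pw) _.
by move: (n.+1%:R^-1) hn => q hn; lra.
Qed.

Lemma fmult_open (A : set T) : open A -> fmult (\1_A).
Proof.
move=> oA; have [w hw] := circle_dense_seq.
(* [D j k] is the ball of radius 2/(k+1) about [w j], because [chord2] is a quarter of the squared
   distance; squaring k+1 gives a threshold of the form required by [fmult_ball]. *)
pose D j k := [set z | chord2 (w j) z < (k.+1 ^ 2)%:R^-1].
pose U m := if unpickle m is Some (j, k) then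
  (if `[< D j k `<=` A >] then D j k else set0) else set0.
have -> : A = \bigcup_m U m.
  apply/seteqP; split=> [z Az|z [m _]]; last first.
    by rewrite /U; case: unpickle => [[j k]|//]; case: asboolP => // h /h.
  have [e e0 he] : exists2 e : R, 0 < e &
      forall y, complex.Re `|zval z - zval y| < e -> A y.
    case: oA Az => B oB <- Bz.
    have : nbhs (zval z : R[i]^o) B by exact: open_nbhs_nbhs.
    rewrite -nbhs_ballE => -[e /= /ltc_real[r r0 ->] he]; exists r => // y zy.
    by apply: he; rewrite -ball_normE /= -normC_Re ltcR.
  have e4 : 0 < e / 4 by rewrite divr_gt0.
  have [k hk] := ex_invS_lt e4.
  have k0 : 0 < k.+1%:R^-1 :> R by rewrite invr_gt0.
  have [j hj] := hw z _ k0.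
  have DE y : D j k y <-> complex.Re `|zval y - zval (w j)| < 2 * k.+1%:R^-1.
    rewrite /D /= /chord2 ltr_pdivrMr// natrX -exprVn.
    have -> : k.+1%:R^-1 ^+ 2 * 4 = (2 * k.+1%:R^-1) ^+ 2 :> R by ring.
    by rewrite ltr_pXn2r ?nnegrE ?Re_norm_ge0// mulr_ge0// ltW.
  exists (pickle (j, k)) => //; rewrite /U pickleK; case: asboolP => [_|[]].
    by apply/DE; apply: lt_trans hj _; rewrite ltr_pMl// ltr1n.
  move=> y /DE hy; apply: he.
  apply: le_lt_trans (Re_norm_dist _ _ (zval (w j))) _.
  by move: (k.+1%:R^-1) hk hj hy k0 => q *; lra.
apply: fmult_bigcup => m; rewrite /U.
have F0 : fmult (\1_(set0 : set T)).
  by rewrite indic0; exact: fmult_cst.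
case: unpickle => [[j k]|//]; case: asboolP => // _.
apply: fmult_eq (fmult_ball (w j) (k := k.+1 ^ 2) _) _; first by rewrite expn_gt0.
by move=> z; rewrite indicE /D; case: ltP => h; [rewrite mem_set|rewrite memNset//= ltNge h].
Qed.

(** The sets whose indicator is a multiplier form a sigma-algebra that contains the open sets. *)
Lemma fmult_measurable (A : set T) : measurable A -> fmult (\1_A).
Proof.
move: A; apply: (@smallest_sub _ _ _ [set A | fmult (\1_A)]); last exact: fmult_open.
split=> /=.
- by rewrite indic0; exact: fmult_cst.
- move=> A hA; apply: fmult_eq (fmult_1B hA) _ => z; rewrite !indicE in_setD in_setT /=.
  by case: (z \in A); rewrite ?subrr ?subr0.
- exact: fmult_bigcup.
Qed.

(** Multiplied by the indicator of a Borel set A, f still has mean 0; so f integrates to 0 over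
    every such A. *)
Lemma fourier0_ae (f : T -> R[i]) : fourier0 f -> \forall z \ae m, f z = 0.
Proof.
move=> fZ; have [f1 f2] : ccint f by case: fZ.
have key (g : T -> R) : cint g -> (forall A, measurable A ->
    \int[m]_z (\1_A z * g z) = 0) -> \forall z \ae m, g z = 0.
  move=> gi hg; have : ae_eq m setT (EFin \o g) (cst 0%E).
    apply: integral_ae_eq => //.
    move=> A _ mA; rewrite integral0.
    have gA : m.-integrable A (EFin \o g) by exact: integrableS gi.
    rewrite -[LHS]fineK; last exact: integrable_fin_num gA.
    rewrite -[fine _]/(Rintegral m A g) Rintegral_mkcond; congr (_%:E); rewrite -(hg A mA).
    by apply: eq_Rintegral => z _; rewrite patchE indicE; case: (z \in A); rewrite ?mul1r ?mul0r.
  by apply: filterS => z /(_ I)[].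
have hA A : measurable A -> forall c, \int[m]_z complex.Re (c * ((\1_A z)%:C * f z)) = 0.
  move=> mA c; have [_ /(_ 0%N c)[<- _]] := (fmult_measurable mA).2 _ fZ.
  by apply: eq_Rintegral => z _; rewrite expr0 mul1r.
have h1 : \forall z \ae m, complex.Re (f z) = 0.
  apply: key f1 _ => A mA; rewrite -(hA A mA 1); apply: eq_Rintegral => z _.
  by rewrite mul1r; case: (f z) => a b /=; rewrite mul0r subr0.
have h2 : \forall z \ae m, complex.Im (f z) = 0.
  apply: key f2 _ => A mA; rewrite -(hA A mA (- 'i)%C); apply: eq_Rintegral => z _.
  by case: (f z) => a b /=; ring.
apply: filterS2 h1 h2 => z; case: (f z) => a b /= -> ->; reflexivity.
Qed.

End FourierUniqueness.

(** * The space L2 *)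

Section L2.
Context {R : realType} {G : hilbertType R}.
Local Notation T := (circle R).
Local Notation m := (circle_measure R).
Implicit Types (f g h : T -> G).
Hypothesis sepG : dense_sequence G.

Lemma wmeasD f g : wmeas f -> wmeas g -> wmeas (f + g).
Proof.
move=> mf mg x; rewrite (_ : (fun _ => _) = fun z => rip (f z) x + rip (g z) x).
  by apply: measurable_funD; [exact: mf|exact: mg].
by apply/funext => z; rewrite ripDl.
Qed.

Lemma wmeasM (a : T -> R[i]) f : cmeas a -> wmeas f -> wmeas (fun z => a z *: f z).
Proof.
move=> [a1 a2] mf x.
rewrite (_ : (fun _ => _) = fun z => complex.Re (a z) * rip (f z) x -
  complex.Im (a z) * rip (f z) ('i%C *: x)).
  by apply: measurable_funB; apply: measurable_funM => //; exact: mf.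
by apply/funext => z; rewrite rip_scalel.
Qed.

Lemma wmeas_cst (x : G) : wmeas (fun=> x).
Proof. by move=> y; exact: measurable_cst. Qed.

Lemma wmeas_lim (u : nat -> T -> G) f : (forall n, wmeas (u n)) ->
  (forall z x, (fun n => rip (u n z) x) @ \oo --> rip (f z) x) -> wmeas f.
Proof. by move=> mu uf x; apply: measurable_fun_cvg => [n|z _]; [exact: mu|exact: uf]. Qed.

Lemma measurable_nrm f : wmeas f -> measurable_fun [set: T] (fun z => nrm (f z)).
Proof.
move=> mf; apply: (measurability _ (RGenOInfty.measurableE R)).
move=> _ [_ [a ->] <-]; rewrite setTI.
have [a0|a0] := leP 0 a.
  rewrite (_ : _ @^-1` _ = [set z | a < nrm (f z)]); first exact: measurable_nrm_gt.
  by apply/seteqP; split => z /=; rewrite in_itv/= andbT.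
rewrite (_ : _ @^-1` _ = setT) //; apply/seteqP; split => z //= _.
by rewrite in_itv/= andbT (lt_le_trans a0)// nrm_ge0.
Qed.

Lemma measurable_sqn f : wmeas f -> measurable_fun [set: T] (fun z => rip (f z) (f z)).
Proof.
move=> mf; rewrite (_ : (fun _ => _) = fun z => nrm (f z) ^+ 2).
  by apply: measurable_funX; exact: measurable_nrm.
by apply/funext => z; rewrite ripxx.
Qed.

Lemma measurable_rip f g : wmeas f -> wmeas g ->
  measurable_fun [set: T] (fun z => rip (f z) (g z)).
Proof.
move=> mf mg; rewrite (_ : (fun _ => _) = fun z => 2^-1 * (rip ((f + g) z) ((f + g) z) -
  rip (f z) (f z) - rip (g z) (g z))).
  apply: measurable_funM; first exact: measurable_cst.
  by apply: measurable_funB; [apply: measurable_funB|]; apply: measurable_sqn => //; exact: wmeasD.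
apply/funext => z; rewrite /= !(ripDl, ripDr) (rip_sym (g z)); lra.
Qed.

Lemma sqnormL2E f : sqnormL2 f = (\int[m]_z (rip (f z) (f z))%:E)%E.
Proof. by apply: eq_integral => z _; rewrite ripxx. Qed.

Lemma L2P f : L2 f <-> wmeas f /\ cint (fun z => rip (f z) (f z)).
Proof.
split=> [[mf fi]|[mf /integrableP[_ fi]]].
  have wf := borel_wmeas mf; split=> //; apply/integrableP; split.
    by apply/measurable_EFinP; exact: measurable_sqn.
  rewrite sqnormL2E in fi; apply: le_lt_trans fi; rewrite le_eqVlt; apply/orP; left.
  by apply/eqP; apply: eq_integral => z _ /=; rewrite ger0_norm ?rip_ge0.
split; first exact: wmeas_borel.
rewrite sqnormL2E; apply: le_lt_trans fi; rewrite le_eqVlt; apply/orP; left.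
by apply/eqP; apply: eq_integral => z _ /=; rewrite ger0_norm ?rip_ge0.
Qed.

Lemma L2_wmeas f : L2 f -> wmeas f. Proof. by move=> /L2P[]. Qed.

Lemma L2_le f (g : T -> R) : wmeas f -> cint g ->
  (forall z, rip (f z) (f z) <= g z) -> L2 f.
Proof.
move=> mf gi fg; apply/L2P; split=> //; apply: cint_le gi _; first exact: measurable_sqn.
by move=> z; rewrite ger0_norm ?rip_ge0.
Qed.

Lemma L2D f g : L2 f -> L2 g -> L2 (f + g).
Proof.
move=> /L2P[mf fi] /L2P[mg gi].
apply: (@L2_le _ (fun z => 2 * rip (f z) (f z) + 2 * rip (g z) (g z))).
- exact: wmeasD.
- by apply: cintD; exact: cintZ.
- by move=> z; exact: ripD2.
Qed.

Lemma L2M (a : T -> R[i]) (C : R) f : cmeas a -> (forall z, complex.Re `|a z| <= C) ->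
  L2 f -> L2 (fun z => a z *: f z).
Proof.
move=> ma aC /L2P[mf fi].
apply: (@L2_le _ (fun z => C ^+ 2 * rip (f z) (f z))); [exact: wmeasM|exact: cintZ|].
move=> z; rewrite !ripxx nrmZ exprMn ler_wpM2r ?sqr_ge0//.
by rewrite ler_pXn2r ?nnegrE ?Re_norm_ge0// (le_trans (Re_norm_ge0 (a z))).
Qed.

Lemma L2Z (c : R[i]) f : L2 f -> L2 (c *: f).
Proof. by apply: (L2M (C := complex.Re `|c|)) => //; exact: cmeas_cst. Qed.

Lemma L2N f : L2 f -> L2 (- f).
Proof. by rewrite -scaleN1r; exact: L2Z. Qed.

Lemma L2B f g : L2 f -> L2 g -> L2 (f - g).
Proof. by move=> Lf Lg; apply: L2D => //; exact: L2N. Qed.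

Lemma L2_cst (x : G) : L2 (fun=> x).
Proof. by apply/L2P; split; [exact: wmeas_cst|exact: cint_cst]. Qed.

Lemma L20 : L2 (0 : T -> G). Proof. exact: L2_cst. Qed.

Lemma L2_zX n f : L2 f -> L2 (fun z => zval z ^+ n *: f z).
Proof.
apply: (L2M (C := 1)); first exact/cmeasX/cmeas_zval.
by move=> z; rewrite norm_zvalX.
Qed.

Lemma L2_zJX n f : L2 f -> L2 (fun z => (zval z)^* ^+ n *: f z).
Proof.
apply: (L2M (C := 1)); first exact/cmeasX/cmeasJ/cmeas_zval.
by move=> z; rewrite norm_zvalJX.
Qed.

End L2.

Ltac L2solve := lazymatch goal with
  | |- @L2 _ _ (_ + _)%R => apply: L2D; L2solve
  | |- @L2 _ _ (- _)%R => apply: L2N; L2solve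
  | |- @L2 _ _ (_ *: _)%R => apply: L2Z; L2solve
  | |- @L2 _ _ 0%R => exact: L20
  | |- @L2 _ _ (fun z => zval z ^+ _ *: _)%R => apply: L2_zX; L2solve
  | |- @L2 _ _ (fun z => (zval z)^* ^+ _ *: _)%R => apply: L2_zJX; L2solve
  | |- _ => try first [assumption |
      match goal with H : forall n : nat, @L2 _ _ _ |- _ => solve [apply: H] end]
  end.

Section L2Inner.
Context {R : realType} {G : hilbertType R}.
Local Notation T := (circle R).
Local Notation m := (circle_measure R).
Implicit Types (f g h : T -> G).
Hypothesis sepG : dense_sequence G.

(** Real part of the L2 inner product, only semi-definite because elements are functions; [iprodL2E]
    recovers the complex product. *)
Definition rho f g : R := \int[m]_z rip (f z) (g z).

Lemma cint_rip f g : L2 f -> L2 g -> cint (fun z => rip (f z) (g z)).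
Proof.
move=> /(L2P sepG)[mf fi] /(L2P sepG)[mg gi]; apply: cint_le (cintD fi gi) _.
  exact: measurable_rip.
by move=> z; exact: rip_abs.
Qed.

Lemma rho_sym f g : rho f g = rho g f.
Proof. by apply: eq_Rintegral => z _; rewrite rip_sym. Qed.

Lemma rhoDl f g h : L2 f -> L2 g -> L2 h -> rho (f + g) h = rho f h + rho g h.
Proof.
move=> Lf Lg Lh; rewrite /rho -RintegralD //; try exact: cint_rip.
by apply: eq_Rintegral => z _; rewrite ripDl.
Qed.

Lemma rhoBl f g h : L2 f -> L2 g -> L2 h -> rho (f - g) h = rho f h - rho g h.
Proof.
move=> Lf Lg Lh; rewrite /rho -RintegralB //; try exact: cint_rip.
by apply: eq_Rintegral => z _; rewrite ripBl.
Qed.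

Lemma rhoDr f g h : L2 f -> L2 g -> L2 h -> rho h (f + g) = rho h f + rho h g.
Proof. by move=> *; rewrite ![rho h _]rho_sym rhoDl. Qed.

Lemma rhoBr f g h : L2 f -> L2 g -> L2 h -> rho h (f - g) = rho h f - rho h g.
Proof. by move=> *; rewrite ![rho h _]rho_sym rhoBl. Qed.

Lemma rhoZl (r : R) f g : L2 f -> L2 g -> rho (r%:C *: f) g = r * rho f g.
Proof.
move=> Lf Lg; rewrite /rho -RintegralZl //; last exact: cint_rip.
by apply: eq_Rintegral => z _; rewrite ripZl.
Qed.

Lemma rhoZr (r : R) f g : L2 f -> L2 g -> rho f (r%:C *: g) = r * rho f g.
Proof. by move=> *; rewrite rho_sym rhoZl// rho_sym. Qed.

Lemma rho0l f : rho 0 f = 0.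
Proof.
rewrite /rho (eq_Rintegral _ (g := fun=> 0)); first by rewrite Rintegral_cst// mul0r.
by move=> z _; rewrite rip0l.
Qed.

Lemma rho0r f : rho f 0 = 0. Proof. by rewrite rho_sym rho0l. Qed.

Lemma rho_mul (a : T -> R[i]) f g :
  rho (fun z => a z *: f z) g = rho f (fun z => (a z)^* *: g z).
Proof. by apply: eq_Rintegral => z _; rewrite rip_scale. Qed.

Lemma rho_ge0 f : 0 <= rho f f.
Proof. by apply: Rintegral_ge0 => z _; exact: rip_ge0. Qed.

Lemma sqnormL2_rho f : L2 f -> sqnormL2 f = (rho f f)%:E.
Proof.
move=> Lf; rewrite sqnormL2E /rho /Rintegral fineK//.
exact: integrable_fin_num (cint_rip Lf Lf).
Qed.

Lemma rho_ae0 f : L2 f -> (\forall z \ae m, f z = 0) <-> rho f f = 0.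
Proof.
move=> Lf; have mE := cint_meas (cint_rip Lf Lf).
have H := ae_eq_integral_abs m measurableT ((measurable_EFinP _ _).2 mE).
have E : (\int[m]_z `|(EFin \o fun z => rip (f z) (f z)) z|)%E = (rho f f)%:E.
  rewrite -sqnormL2_rho// sqnormL2E; apply: eq_integral => z _ /=.
  by rewrite ger0_norm ?rip_ge0.
rewrite E in H; split=> [f0|f0].
  suff : ((rho f f)%:E = 0)%E by case.
  by apply/H; apply: filterS f0 => z fz _ /=; rewrite fz rip0l.
have /H : ((rho f f)%:E = 0)%E by rewrite f0.
by apply: filterS => z /(_ I)[] /ripxx_eq0.
Qed.

Lemma cint_ae (f g : T -> R) : measurable_fun [set: T] f -> cint g ->
  (\forall z \ae m, f z = g z) -> cint f /\ \int[m]_z f z = \int[m]_z g z.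
Proof.
move=> mf gi fg; have mg := cint_meas gi.
split.
  apply/integrableP; split; first exact/measurable_EFinP.
  have /integrableP[_] := gi; apply: le_lt_trans; rewrite le_eqVlt; apply/orP; left.
  apply/eqP; apply: ae_eq_integral => //.
  - by apply: measurableT_comp => //; exact/measurable_EFinP.
  - by apply: measurableT_comp => //; exact/measurable_EFinP.
  - by apply: filterS fg => z fz _ /=; rewrite fz.
congr fine; apply: ae_eq_integral => //; try exact/measurable_EFinP.
by apply: filterS fg => z fz _ /=; rewrite fz.
Qed.

Lemma L2_ae f g : L2 f -> wmeas g -> (\forall z \ae m, f z = g z) -> L2 g.
Proof.
move=> /(L2P sepG)[mf fi] mg fg; apply/(L2P sepG); split=> //.
apply: (proj1 (cint_ae _ fi _)); first exact: measurable_sqn.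
by apply: filterS fg => z fz; rewrite fz.
Qed.

Lemma cauchy_schwarz_rho f g : L2 f -> L2 g -> rho f g ^+ 2 <= rho f f * rho g g.
Proof.
move=> Lf Lg; have := rho_ge0 ((rho g g)%:C *: f - (rho f g)%:C *: g).
rewrite rhoBl ?rhoBr ?rhoZl ?rhoZr //; try L2solve.
rewrite (rho_sym g f); have := rho_ge0 f; have := rho_ge0 g.
(* A null g needs its own argument, [rho] being only semi-definite: if <f, g> were nonzero,
   subtracting (1 + |f|^2) / <f, g> times g from f would give the negative square |f|^2 - 2 (1 +
   |f|^2). *)
have [g0|g0] := eqVneq (rho g g) 0.
  have [->|b0] := eqVneq (rho f g) 0; first by move=> *; rewrite expr0n/= mulr_ge0 ?rho_ge0.
  have := rho_ge0 (f - ((1 + rho f f) / rho f g)%:C *: g).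
  rewrite rhoBl ?rhoBr ?rhoZl ?rhoZr //; try L2solve.
  by rewrite (rho_sym g f) g0 mulr0 divfK//; move=> *; lra.
move=> g1 f1 h.
have {}g0 : 0 < rho g g by rewrite lt_neqAle eq_sym g0.
have : 0 <= rho g g * (rho f f * rho g g - rho f g ^+ 2).
  by apply: le_trans h _; rewrite le_eqVlt; apply/orP; left; apply/eqP; ring.
by rewrite pmulr_rge0// subr_ge0.
Qed.

Lemma rho_null f g : L2 f -> L2 g -> rho g g = 0 -> rho f g = 0.
Proof.
move=> Lf Lg g0; have := cauchy_schwarz_rho Lf Lg; rewrite g0 mulr0 => h.
by apply/eqP; rewrite -sqrf_eq0 eq_le h sqr_ge0.
Qed.

(** <f, g> = <f - q, g> is small by Cauchy-Schwarz. Orthogonal complements are seen to be closed in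
    this way. *)
Lemma rho_cvg0l f g : L2 f -> L2 g ->
  (forall e : R, 0 < e -> exists q, [/\ L2 q, rho q g = 0 & rho (f - q) (f - q) < e]) ->
  rho f g = 0.
Proof.
move=> Lf Lg h; apply/eqP; rewrite -sqrf_eq0 eq_le sqr_ge0 andbT leNgt; apply/negP => fg.
have g0 : 0 < 1 + rho g g by rewrite ltr_pwDl ?rho_ge0.
have [q [Lq qg fq]] := h _ (divr_gt0 fg g0).
have : rho f g ^+ 2 <= rho (f - q) (f - q) * rho g g.
  have := cauchy_schwarz_rho (L2B sepG Lf Lq) Lg.
  by rewrite {1}rhoBl// qg subr0.
move: fq; rewrite ltr_pdivlMr// => fq; have := rho_ge0 (f - q); have := rho_ge0 g.
move: (rho (f - q) (f - q)) (rho g g) (rho f g ^+ 2) fq => a b c *; nra.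
Qed.

Lemma parallelogram f g : L2 f -> L2 g ->
  rho (f + g) (f + g) + rho (f - g) (f - g) = 2 * rho f f + 2 * rho g g.
Proof.
move=> Lf Lg; rewrite rhoBl ?rhoBr ?rhoDl ?rhoDr //; try L2solve.
rewrite (rho_sym g f); ring.
Qed.

Lemma rhoD2 f g : L2 f -> L2 g -> rho (f + g) (f + g) <= 2 * rho f f + 2 * rho g g.
Proof.
by move=> Lf Lg; rewrite -parallelogram// lerDl rho_ge0.
Qed.

(** * Completeness of L2 *)

Section Completeness.
Variable u : nat -> T -> G.
Hypothesis Lu : forall n, L2 (u n).
Hypothesis cu : forall n, rho (u n.+1 - u n) (u n.+1 - u n) <= 16^-1 ^+ n.

(** The weight 4^n balances two needs: the integrals, at most 4^n 16^-n, are summable, so the sum S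
    of the [D n] is integrable; and D n <= S gives steps of length at most sqrt(S) 2^-n at almost
    every point, again summable. *)
Let D n z : R := 4 ^+ n * rip (u n.+1 z - u n z) (u n.+1 z - u n z).

Let D0 n z : 0 <= D n z. Proof. by rewrite mulr_ge0 ?exprn_ge0 ?rip_ge0. Qed.

Let S z : \bar R := (\sum_(n <oo) (D n z)%:E)%E.

Let cD n : cint (D n).
Proof. apply: cintZ; apply: (cint_rip (f := u n.+1 - u n) (g := u n.+1 - u n)); L2solve. Qed.

Let S_int : (\int[m]_z S z <= 2%:E)%E.
Proof.
rewrite integral_nneseries//; last 2 first.
- by move=> n; apply/measurable_EFinP; exact: cint_meas (cD n).
- by move=> n z _; rewrite lee_fin.
have DE n : (\int[m]_z (D n z)%:E = (4 ^+ n * rho (u n.+1 - u n) (u n.+1 - u n))%:E)%E.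
  rewrite -[LHS]fineK; last exact: integrable_fin_num (cD n).
  congr (_%:E); rewrite -[LHS]/(Rintegral m setT (D n)) /D RintegralZl//.
  by apply: (cint_rip (f := u n.+1 - u n) (g := u n.+1 - u n)); L2solve.
under eq_eseriesr do rewrite DE.
have := @cvg_geometric_eseries_half R 2 0; rewrite expr0 divr1.
move/cvg_lim => <-//; apply: lee_nneseries => n _.
  by rewrite lee_fin ?mulr_ge0 ?exprn_ge0 ?rho_ge0.
rewrite lee_fin addn1 natrX.
apply: le_trans (ler_wpM2l _ (cu n)) _; first by rewrite exprn_ge0.
rewrite -exprMn exprS invfM mulrA divff// mul1r -exprVn; apply: lerXn2r; rewrite ?nnegrE; lra.
Qed.

Let S0 z : (0 <= S z)%E.
Proof. by apply: nneseries_ge0 => n _ _; rewrite lee_fin. Qed.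

Let mS : measurable_fun [set: T] S.
Proof.
apply: ge0_emeasurable_sum => [n z _ _|n _]; first by rewrite lee_fin.
by apply/measurable_EFinP; exact: cint_meas (cD n).
Qed.

Let S_int' : m.-integrable setT S.
Proof.
apply/integrableP; split=> //.
rewrite (_ : (\int[m]_z `|S z|)%E = (\int[m]_z S z)%E).
  by apply: le_lt_trans S_int _; rewrite ltry.
by apply: eq_integral => z _; rewrite gee0_abs.
Qed.

Let s z : R := fine (S z).

Let s0 z : 0 <= s z. Proof. exact: fine_ge0. Qed.

Let cs : cint s.
Proof.
apply: le_integrable S_int' => //.
  by apply/measurable_EFinP; apply: measurableT_comp mS; exact: fine_measurable.
move=> z _ /=; rewrite ger0_norm// gee0_abs// /s.
by have := S0 z; case: (S z) => //= _; exact: leey.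
Qed.

Let good : set T := [set z | (S z < +oo)%E].

Let m_good : measurable good.
Proof. by rewrite -[good]setTI; exact: emeasurable_fun_infty_o. Qed.

Let ae_good : \forall z \ae m, good z.
Proof.
have := integrable_ae measurableT S_int'; apply: filterS => z /(_ I).
by rewrite ge0_fin_numE.
Qed.

Let step z : good z -> forall n, nrm (u n.+1 z - u n z) <= Num.sqrt (s z) * 2^-1 ^+ n.
Proof.
move=> gz n; have Ds : D n z <= s z.
  rewrite -lee_fin /s fineK; last by rewrite ge0_fin_numE.
  apply: le_trans (nneseries_lim_ge n.+1 _); last by move=> k _; rewrite lee_fin.
  by rewrite big_nat_recr//= leeDr// sume_ge0// => k _; rewrite lee_fin.
rewrite -(@ler_pXn2r _ 2)// ?nnegrE ?nrm_ge0// ?mulr_ge0 ?sqrtr_ge0 ?exprn_ge0//.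
rewrite exprMn sqr_sqrtr// -ripxx -exprM mulnC exprM.
have -> : 2^-1 ^+ 2 = 4^-1 :> R by field.
by rewrite -ler_pdivrMr ?exprn_gt0 ?invr_gt0// exprVn invrK mulrC.
Qed.

Let far z : good z -> forall n k,
  nrm (u (n + k)%N z - u n z) <= 2 * Num.sqrt (s z) * (2^-1 ^+ n - 2^-1 ^+ (n + k)%N).
Proof.
move=> gz n; elim=> [|k IH]; first by rewrite addn0 !subrr mulr0 nrm0.
rewrite addnS; have -> : u (n + k).+1 z - u n z =
    (u (n + k).+1 z - u (n + k)%N z) + (u (n + k)%N z - u n z) by rewrite addrA subrK.
apply: le_trans (nrmD _ _) _; apply: le_trans (lerD (step gz _) IH) _.
rewrite exprS; move: (Num.sqrt _) (2^-1 ^+ (n + k)) (2^-1 ^+ n) => a b c; lra.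
Qed.

Let far' z : good z -> forall n k, (n <= k)%N ->
  nrm (u k z - u n z) <= 2 * Num.sqrt (s z) * 2^-1 ^+ n.
Proof.
move=> gz n k nk; have := far gz n (k - n); rewrite subnKC// => /le_trans; apply.
by rewrite ler_wpM2l ?mulr_ge0 ?sqrtr_ge0// lerBlDr lerDl exprn_ge0.
Qed.

Let half_cvg (c e : R) : 0 <= c -> 0 < e -> exists N, c * 2^-1 ^+ N < e.
Proof.
move=> c0 e0; have : (fun n => c * 2^-1 ^+ n) @ \oo --> c * (0 : R).
  by apply: cvgM; [exact: cvg_cst|apply: cvg_expr; rewrite ger0_norm; lra].
rewrite mulr0 => /cvgrPdist_lt /(_ _ e0)[N _ /(_ N (leqnn N))].
rewrite sub0r normrN ger0_norm ?mulr_ge0 ?exprn_ge0// => h; by exists N.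
Qed.

Let lim_ex z : good z -> exists l, forall n,
  nrm (u n z - l) <= 2 * Num.sqrt (s z) * 2^-1 ^+ n.
Proof.
move=> gz; have c0 : 0 <= 2 * Num.sqrt (s z) by rewrite mulr_ge0 ?sqrtr_ge0.
have [e e0|l hl] := @hilbert_complete _ _ (u ^~ z).
  have [N hN] := half_cvg c0 e0; exists N.
  have half n k : (N <= n)%N -> (n <= k)%N -> nrm (u k z - u n z) < e.
    move=> Nn nk; apply: le_lt_trans (far' gz nk) _; apply: le_lt_trans hN.
    rewrite ler_wpM2l// -(subnKC Nn) exprD ler_piMr ?exprn_ge0// exprn_ile1//; lra.
  move=> n k Nn Nk; case/orP: (leq_total n k) => nk; last exact: half.
  by rewrite nrmB; exact: half.
exists l => n; apply/ler_addgt0Pr => e e0; have [N hN] := hl _ e0.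
have -> : u n z - l = (u n z - u (maxn n N) z) + (u (maxn n N) z - l).
  by rewrite addrA subrK.
apply: le_trans (nrmD _ _) _; apply: lerD.
  by rewrite nrmB; apply: far' => //; rewrite leq_maxl.
by apply/ltW/hN; rewrite leq_maxr.
Qed.

(** The value 0 off the conull set [good] makes [l] the weak limit, at every point, of the
    truncations of [u n] to [good]; hence it is measurable. *)
Let l z : G := if `[< good z >] then
  xget 0 [set x | forall n, nrm (u n z - x) <= 2 * Num.sqrt (s z) * 2^-1 ^+ n] else 0.

Let lP z : good z -> forall n, nrm (u n z - l z) <= 2 * Num.sqrt (s z) * 2^-1 ^+ n.
Proof.
move=> gz; rewrite /l asboolT//; case: xgetP => [x _ hx|]; first exact: hx.
by have [x hx] := lim_ex gz => /(_ x).
Qed.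

Let ml : wmeas l.
Proof.
move=> x; apply: (@measurable_fun_cvg _ _ _ _ (fun n z => \1_good z * rip (u n z) x)).
  move=> n; apply: measurable_funM; last exact: (L2_wmeas sepG (Lu n)).
  exact: measurable_indic.
move=> z _; have [gz|gz] := pselect (good z); last first.
  rewrite /l asboolF// rip0l indicE memNset//; apply: cvg_near_cst; apply: nearW => n.
  by rewrite mul0r.
rewrite indicE mem_set//; apply/cvgrPdist_lt => e e0.
have c0 : 0 <= 2 * Num.sqrt (s z) * nrm x by rewrite !mulr_ge0 ?sqrtr_ge0 ?nrm_ge0.
have [N hN] := half_cvg c0 e0; exists N => // n /= Nn.
rewrite mul1r distrC -ripBl; apply: le_lt_trans (abs_rip _ _) _; apply: le_lt_trans hN.
rewrite mulrAC; apply: ler_wpM2r; first exact: nrm_ge0.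
apply: le_trans (lP gz n) _; rewrite ler_wpM2l ?mulr_ge0 ?sqrtr_ge0//.
rewrite -(subnKC Nn) exprD ler_piMr ?exprn_ge0// exprn_ile1//; lra.
Qed.

Let l_sqn z n : good z -> rip (u n z - l z) (u n z - l z) <= 4 * s z * 4^-1 ^+ n.
Proof.
move=> gz; rewrite ripxx.
apply: le_trans (_ : (2 * Num.sqrt (s z) * 2^-1 ^+ n) ^+ 2 <= _).
  by rewrite ler_pXn2r ?nnegrE ?nrm_ge0 ?mulr_ge0 ?sqrtr_ge0 ?exprn_ge0// lP.
rewrite !exprMn sqr_sqrtr// -exprM mulnC exprM.
have -> : 2^-1 ^+ 2 = 4^-1 :> R by field.
have -> : 2 ^+ 2 = 4 :> R by ring.
by [].
Qed.

Let Ll : L2 l.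
Proof.
apply: (@L2_le _ _ sepG _ (fun z => 2 * (4 * s z) + 2 * rip (u 0%N z) (u 0%N z))) => //.
  by apply: cintD; [do 2 apply: cintZ|apply: cintZ; exact: cint_rip].
move=> z; have [gz|gz] := pselect (good z); last first.
  by rewrite /l asboolF// rip0l addr_ge0// !mulr_ge0 ?rip_ge0.
have -> : l z = - (u 0%N z - l z) + u 0%N z by rewrite opprB subrK.
apply: le_trans (ripD2 _ _) _; rewrite lerD2r ler_wpM2l// ripNl ripNr opprK.
by have := l_sqn 0 gz; rewrite expr0 mulr1.
Qed.

Lemma L2_complete : exists2 l, L2 l &
  forall e : R, 0 < e -> exists N, forall n, (N <= n)%N -> rho (u n - l) (u n - l) < e.
Proof.
exists l => // e e0; pose I := \int[m]_z (4 * s z).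
have I0 : 0 <= I by apply: Rintegral_ge0 => z _; rewrite mulr_ge0.
have [N hN] := half_cvg I0 e0; exists N => n Nn.
have Lul : L2 (u n - l) by L2solve.
pose h z := \1_good z * rip ((u n - l) z) ((u n - l) z).
have mh : measurable_fun [set: T] h.
  apply: measurable_funM; first exact: measurable_indic.
  by apply: (measurable_sqn sepG); exact: (L2_wmeas sepG Lul).
have [hi hI] := cint_ae mh (cint_rip Lul Lul) (filterS (fun z (gz : good z) =>
  (etrans (congr1 (fun b : bool => b%:R * _) (mem_set gz)) (mul1r _)) : h z = _) ae_good).
rewrite /rho -hI; apply: le_lt_trans hN.
have cI : cint (fun z => 4 * s z * 4^-1 ^+ n).
  by rewrite (_ : (fun _ => _) = fun z => 4^-1 ^+ n * (4 * s z));
    [do 2 apply: cintZ|apply/funext => z; rewrite mulrC].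
apply: le_trans (le_Rintegral measurableT hi cI _) _.
  move=> z _; rewrite /h indicE; have [/set_mem gz|gz] := boolP (z \in good).
    by rewrite mul1r; exact: l_sqn.
  by rewrite mul0r !mulr_ge0 ?exprn_ge0.
rewrite RintegralZr//; last exact: cintZ.
apply: ler_wpM2l => //; apply: le_trans (_ : 2^-1 ^+ n <= _).
  by apply: lerXn2r; rewrite ?nnegrE; lra.
rewrite -(subnKC Nn) exprD ler_piMr ?exprn_ge0// exprn_ile1//; lra.
Qed.

End Completeness.
End L2Inner.

(** * The Hardy space *)

Section Hardy.
Context {R : realType} {G : hilbertType R}.
Local Notation T := (circle R).
Local Notation m := (circle_measure R).
Implicit Types (f g h : T -> G) (K : set (T -> G)).
Hypothesis sepG : dense_sequence G.

Lemma rhoNN f : rho (- f) (- f) = rho f f.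
Proof. by apply: eq_Rintegral => z _ /=; rewrite ripNl ripNr opprK. Qed.

Lemma rhoBC f g : rho (f - g) (f - g) = rho (g - f) (g - f).
Proof. by rewrite -rhoNN opprB. Qed.

Lemma rho_subZ f g (t : R) : L2 f -> L2 g ->
  rho (f - t%:C *: g) (f - t%:C *: g) = rho f f - 2 * t * rho f g + t ^+ 2 * rho g g.
Proof.
move=> Lf Lg; rewrite rhoBl ?rhoBr ?rhoZl ?rhoZr //; try L2solve.
rewrite (rho_sym g f); ring.
Qed.

Lemma rhoZ c f g : rho (c *: f) g = rho f (c^* *: g).
Proof. exact: (rho_mul (fun=> c)). Qed.

Lemma rho_mulr (a : T -> R[i]) f g :
  rho f (fun z => a z *: g z) = rho (fun z => (a z)^* *: f z) g.
Proof. by rewrite rho_sym rho_mul rho_sym. Qed.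

(** Closedness is by approximation in the seminorm, so such a set contains, with a function, every
    L2 function at distance 0 from it ([closedL2_eq]). *)
Definition closedL2 K : Prop :=
  [/\ K `<=` @L2 R G, K 0, forall (a : R[i]) p q, K p -> K q -> K (a *: p + q)
    & forall p, L2 p -> (forall e : R, 0 < e ->
        exists2 q, K q & rho (p - q) (p - q) < e) -> K p].

(** * Orthogonal projection onto closed subspaces *)

Section ClosedSubspace.
Variable K : set (T -> G).
Hypothesis clK : closedL2 K.

Lemma closedL2_L2 p : K p -> L2 p. Proof. by case: clK => h _ _ _ /h. Qed.

Lemma closedL2Z (c : R[i]) p : K p -> K (c *: p).
Proof. by case: clK => _ K0 Kl _ Kp; rewrite -[_ *: _]addr0; exact: Kl. Qed.

Lemma closedL2D p q : K p -> K q -> K (p + q).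
Proof. by case: clK => _ _ Kl _ Kp Kq; rewrite -[p]scale1r; exact: Kl. Qed.

Lemma closedL2N p : K p -> K (- p).
Proof. by rewrite -scaleN1r; exact: closedL2Z. Qed.

Lemma closedL2B p q : K p -> K q -> K (p - q).
Proof. by move=> Kp Kq; apply: closedL2D => //; exact: closedL2N. Qed.

Lemma closedL2_eq p q : K p -> L2 q -> rho (q - p) (q - p) = 0 -> K q.
Proof. by case: clK => _ _ _ h Kp Lq E; apply: h => // e e0; exists p => //; rewrite E. Qed.

Lemma projection v : L2 v -> exists2 p, K p & forall k, K k -> rho (v - p) k = 0.
Proof.
move=> Lv; have [KL K0 Kl Kc] := clK.
pose A := [set r : R | exists2 k, K k & r = rho (v - k) (v - k)].
have hA : has_inf A.
  split; first by exists (rho (v - 0) (v - 0)); exists 0.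
  by exists 0 => _ [k _ ->]; exact: rho_ge0.
pose d := inf A.
have dle k : K k -> d <= rho (v - k) (v - k) by move=> Kk; apply: ge_inf; [case: hA|exists k].
(* By the parallelogram law |k_(n+1) - k_n|^2 <= 2 eps_(n+1) + 2 eps_n <= 4 eps_n = 16^-n, the rate
   required by [L2_complete]. *)
pose eps n : R := 16^-1 ^+ n / 4.
have eps0 n : 0 < eps n by rewrite divr_gt0 ?exprn_gt0.
have /choice[k hk] : forall n, exists k, K k /\ rho (v - k) (v - k) < d + eps n.
  by move=> n; have [_ [k Kk ->] h] := inf_adherent (eps0 n) hA; exists k.
have Lk n : L2 (k n) by apply: KL; case: (hk n).
have [n|p Lp hp] := @L2_complete _ _ sepG k Lk.
  have := parallelogram sepG (L2B sepG Lv (Lk n.+1)) (L2B sepG Lv (Lk n)).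
  rewrite (_ : v - k n.+1 - (v - k n) = - (k n.+1 - k n)); last first.
    by rewrite !opprB addrC addrA subrK.
  rewrite (_ : v - k n.+1 + (v - k n) =
    (2 : R)%:C *: (v - (2^-1 : R)%:C *: (k n.+1 + k n))); last first.
    rewrite scalerBr scalerA -rmorphM mulfV// scale1r rmorph_nat scaler_nat mulr2n.
    by rewrite opprD addrACA.
  have Kmid : K ((2^-1 : R)%:C *: (k n.+1 + k n)).
    by apply/closedL2Z/closedL2D; [case: (hk n.+1)|case: (hk n)].
  have Lm := KL _ Kmid.
  rewrite rhoZl ?rhoZr //; try L2solve.
  rewrite rhoNN.
  have := dle _ Kmid; have [_ h1] := hk n.+1; have [_ h2] := hk n.
  have : eps n.+1 <= eps n.
    by rewrite /eps exprS ler_pM2r ?invr_gt0// ler_piMl ?exprn_ge0//; lra.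
  rewrite -/(eps n); have -> : 16^-1 ^+ n = 4 * eps n :> R by rewrite /eps; field.
  move: h1 h2; move: (rho (v - k n.+1) _) (rho (v - k n) _) (rho (k n.+1 - k n) _) => a b c.
  move: (rho _ _) (eps n.+1) (eps n) => x e1 e2; lra.
have Kp : K p.
  apply: Kc => // e e0; have [N hN] := hp _ e0; exists (k N); first by case: (hk N).
  by rewrite rhoBC hN.
exists p => // h Kh; have Lh := KL _ Kh.
(* Orthogonality is read off the near-minimisers: moving [k n] by r/c times h, with r = <v - k n,
   h>, lowers the squared distance by at least r^2 / c, so this is at most [eps n] by minimality.
   The 1 keeps c positive when h is null. *)
pose c := 1 + rho h h; have c0 : 0 < c by rewrite ltr_pwDl ?rho_ge0.
have bound n : rho (v - k n) h ^+ 2 <= eps n * c.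
  have [Kn hn] := hk n; have Ln := Lk n.
  have Kt : K (k n + (rho (v - k n) h / c)%:C *: h) by apply: closedL2D => //; exact: closedL2Z.
  have := dle _ Kt; rewrite opprD addrA.
  rewrite rho_subZ //; last L2solve.
  set r := rho (v - k n) h; set q := rho (v - k n) (v - k n).
  have -> : rho h h = c - 1 by rewrite /c; lra.
  move=> hd; have : r ^+ 2 / c <= eps n.
    have : (r / c) ^+ 2 * (c - 1) <= r ^+ 2 / c.
      have -> : (r / c) ^+ 2 * (c - 1) = r ^+ 2 / c - (r / c) ^+ 2.
        by field; rewrite gt_eqF.
      by rewrite lerBlDr lerDl sqr_ge0.
    have E : 2 * (r / c) * r = 2 * (r ^+ 2 / c) by ring.
    move: hd hn; rewrite -/q E; lra.
  by rewrite ler_pdivrMr.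
apply/eqP; rewrite -sqrf_eq0 eq_le sqr_ge0 andbT; apply/ler_addgt0Pr => e e0.
(* From (x + y)^2 <= 2 x^2 + 2 y^2, with both squares at most e' c. *)
rewrite add0r; pose e' := e / (4 * c).
have e'0 : 0 < e' by rewrite divr_gt0// mulr_gt0.
have [N1 hN1] := hp _ e'0.
have [N2 hN2] : exists N2, forall n, (N2 <= n)%N -> eps n < e'.
  have : eps @ \oo --> (0 * 4^-1 : R).
    by apply: cvgM; [apply: cvg_expr; rewrite ger0_norm; lra|exact: cvg_cst].
  rewrite mul0r => /cvgrPdist_lt /(_ _ e'0)[N _ hN]; exists N => n Nn.
  by have := hN n Nn; rewrite sub0r normrN gtr0_norm.
pose n := maxn N1 N2; have h2 := hN1 n (leq_maxl _ _); have h1 := hN2 n (leq_maxr _ _).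
have -> : v - p = (v - k n) + (k n - p) by rewrite addrA subrK.
have Ln := Lk n; rewrite rhoDl //; try L2solve.
have b1 := bound n; have b2 := cauchy_schwarz_rho sepG (L2B sepG (Lk n) Lp) Lh.
have e4 : e = 4 * (e' * c) by rewrite /e'; field; rewrite gt_eqF.
have h3 : rho (k n - p) (k n - p) * rho h h <= e' * c.
  by apply: ler_pM; rewrite ?rho_ge0 ?(ltW h2)// /c addrC lerDl.
have h4 : eps n * c <= e' * c by rewrite ler_wpM2r ?ltW.
move: (rho (v - k n) h) (rho (k n - p) h) b1 b2 => x y b1 b2; rewrite e4.
have := sqr_ge0 (x - y); nra.
Qed.

End ClosedSubspace.

(** * Monomials and the projection onto the Hardy space *)

Lemma iprodL2E f g : iprodL2 f g = rho f g +i* rho f ('i%C *: g).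
Proof.
congr (_ +i* _).
by apply: eq_Rintegral => z _; rewrite Im_iprod.
Qed.

Lemma iprodL2_eq0 f g : iprodL2 f g = 0 <-> rho f g = 0 /\ rho f ('i%C *: g) = 0.
Proof. by rewrite iprodL2E; split=> [[-> ->]|[-> ->]]. Qed.

Lemma scaler_swap (c d : R[i]) (x : G) : c *: (d *: x) = d *: (c *: x).
Proof. by rewrite !scalerA mulrC. Qed.

Definition mono (n : nat) (x : G) : T -> G := fun z => zval z ^+ n *: x.
Definition monoJ (n : nat) (x : G) : T -> G := fun z => (zval z)^* ^+ n *: x.

Lemma L2_mono n x : L2 (mono n x).
Proof. by apply: (L2_zX sepG n (f := fun=> x)); exact: L2_cst. Qed.

Lemma L2_monoJ n x : L2 (monoJ n x).
Proof. by apply: (L2_zJX sepG n (f := fun=> x)); exact: L2_cst. Qed.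

Lemma monoJZ n c x : c *: monoJ n x = monoJ n (c *: x).
Proof. by apply/funext => z; rewrite /monoJ -scaler_swap. Qed.

(** As x ranges over a complex space, the factor i is absorbed in x and real parts carry the whole
    condition. *)
Lemma H2P f : H2 f <-> L2 f /\ forall n x, rho f (monoJ n.+1 x) = 0.
Proof.
have E n x : cintegral (fun z : T => zval z ^+ n.+1 * iprod (f z) x) =
    iprodL2 f (monoJ n.+1 x).
  congr cintegral; apply/funext => z.
  by rewrite iprodZr rmorphXn /= conjCK.
split=> -[Lf hf]; split=> // n x.
  by have := hf n x; rewrite E => /iprodL2_eq0[].
by rewrite E; apply/iprodL2_eq0; split; rewrite ?monoJZ; exact: hf.
Qed.

Lemma H2_L2 f : H2 f -> L2 f. Proof. by case. Qed.

Lemma rho_monoJr n x f : rho f (monoJ n x) = rho (fun z => zval z ^+ n *: f z) (fun=> x).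
Proof. by apply: eq_Rintegral => z _; rewrite rip_scale rmorphXn. Qed.

Lemma rho_mono_cst n x y : (0 < n)%N -> rho (mono n x) (fun=> y) = 0.
Proof.
move=> n0; rewrite -(Rintegral_zvalX n0 (iprod x y)); apply: eq_Rintegral => z _.
by rewrite /rip iprodZl mulrC.
Qed.

Lemma rho_mono_monoJ n k x y : (0 < k)%N -> rho (mono n x) (monoJ k y) = 0.
Proof.
move=> k0; rewrite rho_monoJr -[RHS](@rho_mono_cst (k + n) x y) ?addn_gt0 ?k0//.
by congr rho; apply/funext => z; rewrite /mono scalerA exprD.
Qed.

Lemma closedL2_H2 : closedL2 (@H2 R G).
Proof.
split.
- by move=> f [].
- by apply/H2P; split=> [|n x]; [exact: L20|rewrite rho0l].
- move=> a p q /H2P[Lp hp] /H2P[Lq hq]; apply/H2P; split=> [|n x]; first by L2solve.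
  rewrite rhoDl //; try L2solve; last exact: L2_monoJ.
  by rewrite rhoZ hq addr0 monoJZ hp.
- move=> p Lp h; apply/H2P; split=> // n x.
  apply: (rho_cvg0l sepG Lp (L2_monoJ _ _)) => e /h[q /H2P[Lq hq] ?].
  by exists q.
Qed.

Lemma H2_mono n x : H2 (mono n x).
Proof.
by apply/H2P; split=> [|k y]; [exact: L2_mono|exact: rho_mono_monoJ].
Qed.

Lemma Re_mul_iprod (a b : R[i]) (u v : G) :
  complex.Re (a * (b * iprod u v)) = rip u (b^* *: (a^* *: v)).
Proof. by rewrite /rip !iprodZr !conjCK mulrCA. Qed.

Lemma fourier0_iprod f (x : G) : L2 f -> (forall n y, rho f (mono n y) = 0) ->
  (forall n y, rho f (monoJ n y) = 0) -> fourier0 (fun z => iprod (f z) x).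
Proof.
move=> Lf h1 h2; split.
  split; first by apply: (cint_rip sepG Lf); exact: L2_cst.
  rewrite (_ : (fun _ => _) = fun z => rip (f z) ('i%C *: x)).
    by apply: (cint_rip sepG Lf); exact: L2_cst.
  by apply/funext => z; rewrite Im_iprod.
move=> n c; split.
  rewrite -(h2 n (c^* *: x)); apply: eq_Rintegral => z _.
  by rewrite Re_mul_iprod rmorphXn.
rewrite -(h1 n (c^* *: x)); apply: eq_Rintegral => z _.
by rewrite Re_mul_iprod rmorphXn /= conjCK.
Qed.

Lemma ae_eq_weak f g : (forall x, \forall z \ae m, iprod (f z) x = iprod (g z) x) ->
  \forall z \ae m, f z = g z.
Proof.
move=> h; have [d hd] := sepG.
have /ae_foralln : forall n, \forall z \ae m, iprod (f z) (d n) = iprod (g z) (d n).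
  by move=> n; exact: h.
by apply: filterS => z hz; exact: (iprod_dense_inj hd).
Qed.

(** Each scalar function <f, x> has vanishing coefficients, hence vanishes almost everywhere; a
    dense sequence of x gives f = 0 almost everywhere. *)
Lemma L2_total f : L2 f -> (forall n y, rho f (mono n y) = 0) ->
  (forall n y, rho f (monoJ n y) = 0) -> rho f f = 0.
Proof.
move=> Lf h1 h2; apply/(rho_ae0 sepG Lf); apply: ae_eq_weak => x.
have := fourier0_ae (fourier0_iprod x Lf h1 h2).
by apply: filterS => z ->; rewrite iprod0l.
Qed.

Lemma projH2_spec f : L2 f ->
  H2 (projH2 f) /\ forall h, H2 h -> rho (f - projH2 f) h = 0.
Proof.
move=> Lf; rewrite /projH2; case: xgetP => [g _ [Hg hg]|]; first last.
  have [p Hp hp] := projection closedL2_H2 Lf.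
  move=> /(_ p)[]; split=> // h Hh; apply/iprodL2_eq0; rewrite !hp//.
  exact: (closedL2Z closedL2_H2).
by split=> // h /hg/iprodL2_eq0[].
Qed.

Lemma H2_projH2 f : L2 f -> H2 (projH2 f).
Proof. by move=> /projH2_spec[]. Qed.

Lemma rho_eq0D f g : L2 f -> L2 g -> rho f f = 0 -> rho g g = 0 -> rho (f + g) (f + g) = 0.
Proof.
move=> Lf Lg f0 g0; apply/eqP; rewrite eq_le rho_ge0 andbT.
by have := rhoD2 sepG Lf Lg; rewrite f0 g0 mulr0 addr0.
Qed.

Lemma projH2_uniq f g : L2 f -> H2 g -> (forall h, H2 h -> rho (f - g) h = 0) ->
  rho (projH2 f - g) (projH2 f - g) = 0.
Proof.
move=> Lf Hg hg; have [Hp hp] := projH2_spec Lf.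
have Lp := H2_L2 Hp; have Lg := H2_L2 Hg.
have Hd : H2 (projH2 f - g) by exact: (closedL2B closedL2_H2).
have Ld := H2_L2 Hd.
rewrite {1}(_ : projH2 f - g = (f - g) - (f - projH2 f)).
  by rewrite rhoBl //; try L2solve; rewrite hg// hp// subrr.
by rewrite opprB [RHS]addrC addrA subrK.
Qed.

Lemma projH2_id f : H2 f -> rho (projH2 f - f) (projH2 f - f) = 0.
Proof.
by move=> Hf; apply: projH2_uniq (H2_L2 Hf) Hf _ => h _; rewrite subrr rho0l.
Qed.

Lemma projH2_rho f h : L2 f -> H2 h -> rho (projH2 f) h = rho f h.
Proof.
move=> Lf Hh; have [Hp hp] := projH2_spec Lf; have Lp := H2_L2 Hp; have Lh := H2_L2 Hh.
by have := hp _ Hh; rewrite rhoBl // => /subr0_eq.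
Qed.

Lemma projH2_lin a f g : L2 f -> L2 g ->
  rho (projH2 (a *: f + g) - (a *: projH2 f + projH2 g))
      (projH2 (a *: f + g) - (a *: projH2 f + projH2 g)) = 0.
Proof.
move=> Lf Lg; have [Hp hp] := projH2_spec Lf; have [Hq hq] := projH2_spec Lg.
have Lp := H2_L2 Hp; have Lq := H2_L2 Hq.
apply: projH2_uniq; [L2solve|by case: closedL2_H2 => _ _ h _; exact: h|].
move=> h Hh; have Lh := H2_L2 Hh.
rewrite (_ : _ - _ = a *: (f - projH2 f) + (g - projH2 g)); last first.
  by rewrite scalerBr opprD addrACA.
rewrite rhoDl ?rhoZ; [|L2solve..]; rewrite hq// addr0 hp//.
exact: (closedL2Z closedL2_H2).
Qed.

Lemma projH2_le f : L2 f -> rho (projH2 f) (projH2 f) <= rho f f.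
Proof.
move=> Lf; have [Hp hp] := projH2_spec Lf; have Lp := H2_L2 Hp.
have := rho_ge0 (f - projH2 f).
rewrite {2}(_ : f - projH2 f = f - (1 : R)%:C *: projH2 f); last by rewrite scale1r.
have h0 := hp _ Hp; rewrite rhoBl// in h0.
rewrite {1}(_ : f - projH2 f = f - (1 : R)%:C *: projH2 f); last by rewrite scale1r.
rewrite rho_subZ// expr1n; move: h0; move: (rho f f) (rho f _) (rho _ _) => a b c; lra.
Qed.

(** The projection of f to H2 has no negative coefficients, and its others are those of f, so it is
    null. *)
Lemma H2_perp f : L2 f -> (forall n x, rho f (mono n x) = 0) ->
  forall h, H2 h -> rho f h = 0.
Proof.
move=> Lf hf h Hh; have [Hp hp] := projH2_spec Lf; have Lp := H2_L2 Hp.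
have Lh := H2_L2 Hh; rewrite -projH2_rho//.
have h1 n x : rho (projH2 f) (mono n x) = 0.
  by rewrite projH2_rho// ?hf//; exact: H2_mono.
have : rho (projH2 f) (projH2 f) = 0.
  apply: (L2_total Lp h1) => -[|n] y; last by have /H2P[_ ->] := Hp.
  by rewrite -(h1 0%N y); congr rho; apply/funext => z; rewrite /monoJ /mono !expr0.
by move=> p0; rewrite rho_sym rho_null.
Qed.

(** The remainder of h after projection onto K is orthogonal to all monomials, hence to H2 and to h
    itself. This induction principle stands in for Fourier expansions. *)
Lemma H2_min K : closedL2 K -> (forall n x, K (mono n x)) -> @H2 R G `<=` K.
Proof.
move=> clK Km h Hh; have Lh := H2_L2 Hh.
have [p Kp hp] := projection clK Lh; have Lp := closedL2_L2 clK Kp.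
apply: (closedL2_eq clK Kp Lh); rewrite rhoBr //; try L2solve.
rewrite (hp p Kp) subr0; apply: (H2_perp _ _ Hh); first by L2solve.
by move=> n x; exact: hp.
Qed.

Lemma H2_shift f : H2 f -> H2 (shiftH f).
Proof.
move=> /H2P[Lf hf]; have Lz : L2 (shiftH f).
  by have := L2_zX sepG 1 Lf; under eq_fun do rewrite expr1.
apply/H2P; split=> // n x; rewrite /shiftH rho_mul.
transitivity (rho f (monoJ n.+2 x)); last exact: hf.
by congr rho; apply/funext => z; rewrite /monoJ scalerA -exprS.
Qed.

(** * The flip and the backward shift *)

Lemma flipJK f : flipJ (flipJ f) = f.
Proof.
by apply/funext => z; rewrite /flipJ zval_conjT conjTK conjCK scalerA conj_zval scale1r.
Qed.

Lemma flipJ_lin a f g : flipJ (a *: f + g) = a *: flipJ f + flipJ g.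
Proof. by apply/funext => z; rewrite /flipJ /= scalerDr scaler_swap. Qed.

Lemma wmeas_conjT f : wmeas f -> wmeas (f \o @conjT R).
Proof. by move=> mf x; exact: (measurableT_comp (mf x) measurable_conjT). Qed.

Lemma L2_conjT f : L2 f -> L2 (f \o @conjT R).
Proof.
move=> /(L2P sepG)[mf fi]; apply/(L2P sepG); split; first exact: wmeas_conjT.
exact: (cintJ fi).
Qed.

Lemma L2_flipJ f : L2 f -> L2 (flipJ f).
Proof.
move=> /L2_conjT Lf; have := L2_zJX sepG 1 Lf.
by under eq_fun do rewrite expr1.
Qed.

Lemma rho_flipJ f g : L2 f -> L2 g -> rho (flipJ f) (flipJ g) = rho f g.
Proof.
move=> Lf Lg; rewrite -[RHS](RintegralJ (cint_rip sepG Lf Lg)).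
apply: eq_Rintegral => z _.
by rewrite /flipJ rip_scale scalerA conjCK zval_conj scale1r.
Qed.

Lemma rho_flipJl f g : L2 f -> L2 g -> rho (flipJ f) g = rho f (flipJ g).
Proof. by move=> Lf Lg; rewrite -{1}(flipJK g) rho_flipJ//; exact: L2_flipJ. Qed.

Lemma flipJ_mono n x : flipJ (mono n x) = monoJ n.+1 x.
Proof. by apply/funext => z; rewrite /flipJ /mono /monoJ zval_conjT scalerA exprS. Qed.

Lemma rho_flipJ_H2 f h : H2 f -> H2 h -> rho (flipJ f) h = 0.
Proof.
move=> /H2P[Lf hf] Hh; apply: (H2_perp _ _ Hh); first exact: L2_flipJ.
by move=> n x; rewrite rho_flipJl// ?flipJ_mono//; exact: L2_mono.
Qed.

Lemma flipJ_shift f : flipJ (shiftH f) = fun z => (zval z)^* *: flipJ f z.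
Proof. by apply/funext => z; rewrite /flipJ /shiftH zval_conjT. Qed.

Lemma adjointH2_spec g : H2 g -> H2 (adjointH2 (@shiftH R G) g) /\
  forall h, H2 h -> rho (shiftH h) g = rho h (adjointH2 (@shiftH R G) g).
Proof.
move=> Hg; have Lg := H2_L2 Hg; rewrite /adjointH2; case: xgetP => [k _ [Hk hk]|].
  split=> // h Hh; have := hk _ Hh; rewrite !iprodL2E => /eqP.
  by rewrite eq_complex /= => /andP[/eqP].
(* The projection of z^-1 g to H2 is a valid value of the adjoint, so [xget] does not fall back on
   0. *)
pose q := fun z => (zval z)^* *: g z.
have Lq : L2 q by have := L2_zJX sepG 1 Lg; under eq_fun do rewrite expr1.
move=> /(_ (projH2 q))[]; have Hq := H2_projH2 Lq; split=> // h Hh.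
rewrite !iprodL2E.
have key h' : H2 h' -> rho (shiftH h') g = rho h' (projH2 q).
  by move=> Hh'; rewrite rho_mul (rho_sym h' (projH2 q)) projH2_rho// rho_sym.
congr (_ +i* _); first exact: key.
have E (u v : T -> G) : rho u ('i%C *: v) = rho (('i%C : R[i])^* *: u) v.
  exact: (rho_mulr (fun=> 'i%C)).
rewrite !E -key; last exact: (closedL2Z closedL2_H2).
by congr rho; apply/funext => z; rewrite /shiftH /= scaler_swap.
Qed.

End Hardy.

(** * Transfer between orthonormal families *)

Section Limits.
Context {R : realType} {G : hilbertType R}.
Implicit Types (u : nat -> G) (l x y : G).

Definition ncvg u l : Prop := forall e : R, 0 < e -> exists N, forall n, (N <= n)%N ->
  nrm (u n - l) < e.

Lemma nrm_small x : (forall e : R, 0 < e -> nrm x < e) -> x = 0.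
Proof.
move=> h; apply: nrm_eq0; apply/eqP; rewrite eq_le nrm_ge0 andbT.
by rewrite leNgt; apply/negP => /h; rewrite ltxx.
Qed.

Lemma ncvg_uniq u l l' : ncvg u l -> ncvg u l' -> l = l'.
Proof.
move=> h h'; apply/eqP; rewrite -subr_eq0; apply/eqP/nrm_small => e e0.
have e2 : 0 < e / 2 by rewrite divr_gt0.
have [N hN] := h _ e2; have [N' hN'] := h' _ e2.
have := hN (maxn N N') (leq_maxl _ _); have := hN' (maxn N N') (leq_maxr _ _).
set v := u _ => h1 h2; rewrite (_ : l - l' = - (v - l) + (v - l')); last first.
  by rewrite opprB addrA subrK.
apply: le_lt_trans (nrmD _ _) _; rewrite nrmN; lra.
Qed.

Lemma ncvg_lin (a : R[i]) u v l l' : ncvg u l -> ncvg v l' ->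
  ncvg (fun n => a *: u n + v n) (a *: l + l').
Proof.
move=> h h' e e0; set c := complex.Re `|a| + 1.
have c0 : 0 < c by rewrite ltr_wpDl// Re_norm_ge0.
have [N hN] := h _ (divr_gt0 e0 (mulr_gt0 (ltr0Sn R 1) c0)).
have [N' hN'] := h' _ (divr_gt0 e0 (ltr0Sn R 1)).
exists (maxn N N') => n; rewrite geq_max => /andP[/hN h1 /hN' h2].
rewrite opprD addrACA -scalerBr; apply: le_lt_trans (nrmD _ _) _; rewrite nrmZ.
have : complex.Re `|a| * nrm (u n - l) <= c * nrm (u n - l).
  by rewrite ler_wpM2r ?nrm_ge0// lerDl.
move: h1; rewrite ltr_pdivlMr ?mulr_gt0// => h1 h3.
move: (complex.Re _ * _) h3 => q h3; have := h2; lra.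
Qed.

Lemma ncvg_near u l l' : ncvg u l -> (exists N, forall n, (N <= n)%N -> u n = l') -> l = l'.
Proof.
move=> h [N hN]; apply: ncvg_uniq h _ => e e0; exists N => n /hN ->.
by rewrite subrr nrm0.
Qed.

Lemma ncvg_rip u v l l' : ncvg u l -> ncvg v l' -> (fun n => rip (u n) (v n)) @ \oo --> rip l l'.
Proof.
move=> h h'; apply/cvgrPdist_lt => e e0.
set c := nrm l + nrm l' + 1.
have c0 : 0 < c by rewrite ltr_wpDl// addr_ge0 ?nrm_ge0.
pose e' := Num.min 1 (e / (2 * c)).
have e'0 : 0 < e' by rewrite lt_min ltr01 divr_gt0// mulr_gt0.
have [N hN] := h _ e'0; have [N' hN'] := h' _ e'0.
exists (maxn N N') => // n /=; rewrite geq_max => /andP[/hN + /hN' +].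
rewrite !lt_min => /andP[h1 h2] /andP[h3 h4].
rewrite (_ : rip l l' - _ = - (rip (u n - l) (v n) + rip l (v n - l'))); last first.
  by rewrite ripBl ripBr; ring.
rewrite normrN; apply: le_lt_trans (ler_normD _ _) _.
apply: le_lt_trans (lerD (abs_rip _ _) (abs_rip _ _)) _.
have h5 : nrm (v n) <= nrm l' + 1.
  rewrite -(subrK l' (v n)); apply: le_trans (nrmD _ _) _; lra.
have h6 : nrm (u n - l) * nrm (v n) <= nrm (u n - l) * c.
  by rewrite ler_wpM2l ?nrm_ge0// (le_trans h5)// /c -addrA lerDr nrm_ge0.
have h7 : nrm l * nrm (v n - l') <= c * nrm (v n - l').
  by rewrite ler_wpM2r ?nrm_ge0// /c -addrA lerDl addr_ge0 ?nrm_ge0.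
move: h2 h4; rewrite !ltr_pdivlMr ?mulr_gt0// => h2 h4.
apply: le_lt_trans (lerD h6 h7) _; lra.
Qed.

Lemma ncvg_cst l : ncvg (fun=> l) l.
Proof. by move=> e e0; exists 0%N => n _; rewrite subrr nrm0. Qed.

End Limits.

Lemma linear_ex (R : realType) (E F : hilbertType R) (f : E -> F) :
  (forall (a : R[i]) x y, f (a *: x + y) = a *: f x + f y) ->
  exists L : {linear E -> F}, forall x, L x = f x.
Proof.
move=> H; pose mix := GRing.isLinear.Build R[i] E F *:%R f H.
pose L : {linear E -> F} := HB.pack f mix; by exists L.
Qed.

Lemma bop_ex (R : realType) (E F : hilbertType R) (f : E -> F) (C : R) :
  (forall (a : R[i]) x y, f (a *: x + y) = a *: f x + f y) ->
  (forall x, nrm (f x) <= C * nrm x) -> exists L : bop E F, forall x, L x = f x.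
Proof.
move=> /linear_ex[L hL] hC.
have hb : exists M : R, forall x, `|L x| <= M%:C * `|x|.
  by exists C => x; rewrite hL !normr_nrm -rmorphM lecR.
by exists (Bop hb).
Qed.

Section Transfer.
Context {R : realType} {G : hilbertType R}.
Implicit Types (e w : nat -> G) (u v x : G).

(* The mask [b] turns finite orthonormal families into sequences. *)
Definition ortho (b : nat -> bool) e : Prop :=
  forall i j, iprod (e i) (e j) = ((i == j) && b i)%:R.

Definition psum e w n u : G := \sum_(i < n) iprod u (e i) *: w i.

Lemma psumS e w n u : psum e w n.+1 u = psum e w n u + iprod u (e n) *: w n.
Proof. by rewrite /psum big_ord_recr. Qed.

Lemma psum_lin e w n a u v : psum e w n (a *: u + v) = a *: psum e w n u + psum e w n v.
Proof.
rewrite /psum scaler_sumr -big_split; apply: eq_bigr => i _ /=.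
by rewrite iprod_linear scalerDl scalerA.
Qed.

Lemma iprod_suml I (r : seq I) (f : I -> G) u :
  iprod (\sum_(i <- r) f i) u = \sum_(i <- r) iprod (f i) u.
Proof.
elim: r => [|i r IH]; first by rewrite !big_nil iprod0l.
by rewrite !big_cons iprodDl IH.
Qed.

Variables (b : nat -> bool) (e : nat -> G).
Hypothesis oe : ortho b e.

Lemma ortho0 w i : ortho b w -> ~~ b i -> w i = 0.
Proof.
move=> ow /negbTE bi; apply: ripxx_eq0; rewrite /rip ow bi andbF.
by [].
Qed.

Lemma iprod_psum w n u j : ortho b w -> iprod (psum e w n u) (w j) =
  if (j < n)%N then iprod u (e j) else 0.
Proof.
move=> ow; elim: n => [|n IH]; first by rewrite /psum big_ord0 iprod0l.
rewrite psumS iprodDl IH iprodZl ow ltnS.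
case: (ltngtP j n) => [jn|nj|->] /=; try by rewrite mulr0 addr0.
rewrite add0r; case: (boolP (b n)) => bn; first by rewrite mulr1.
by rewrite mulr0 (ortho0 oe bn) iprod0r.
Qed.

Lemma iprod_sumr I (r : seq I) (f : I -> G) u :
  iprod u (\sum_(i <- r) f i) = \sum_(i <- r) iprod u (f i).
Proof.
elim: r => [|i r IH]; first by rewrite !big_nil iprod0r.
by rewrite !big_cons iprodDr IH.
Qed.

(** The right side does not involve w: convergence and norm estimates for any target family reduce
    to the source family e. *)
Lemma psum_iprod w n u v : ortho b w ->
  iprod (psum e w n u) (psum e w n v) = iprod (psum e e n u) v.
Proof.
move=> ow; rewrite {2}/psum iprod_sumr [in RHS]/psum iprod_suml.
apply: eq_bigr => i _; rewrite iprodZr iprod_psum// ltn_ord iprodZl mulrC.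
by rewrite -iprodC.
Qed.

Lemma psum_diff w n k u : ortho b w ->
  rip (psum e w (n + k)%N u - psum e w n u) (psum e w (n + k)%N u - psum e w n u) =
  rip (psum e e (n + k)%N u) u - rip (psum e e n u) u.
Proof.
move=> ow; rewrite !(ripBl, ripBr).
have E n1 n2 : (n1 <= n2)%N -> rip (psum e w n2 u) (psum e w n1 u) = rip (psum e e n1 u) u.
  move=> n12; rewrite /rip -(psum_iprod n1 u u ow); congr complex.Re.
  rewrite [in LHS](_ : psum e w n1 u = \sum_(i < n1) iprod u (e i) *: w i)//.
  rewrite [in X in _ = iprod _ X](_ : psum e w n1 u = \sum_(i < n1) iprod u (e i) *: w i)//.
  rewrite !iprod_sumr; apply: eq_bigr => i _.
  rewrite !iprodZr !iprod_psum// ltn_ord; congr (_ * _).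
  by rewrite (leq_trans (ltn_ord i) n12).
have h : (n <= n + k)%N by rewrite leq_addr.
by rewrite (rip_sym (psum e w n u) (psum e w _ u)) !E//; ring.
Qed.

Lemma psum_mono n u : 0 <= rip (psum e e n.+1 u) u - rip (psum e e n u) u.
Proof. by have := psum_diff n 1 u oe; rewrite addn1 => <-; exact: rip_ge0. Qed.

Lemma bessel n u : rip (psum e e n u) u <= rip u u.
Proof.
have E : rip (psum e e n u) (psum e e n u) = rip (psum e e n u) u.
  by rewrite /rip psum_iprod.
have := rip_ge0 (u - psum e e n u); rewrite !(ripBl, ripBr) E (rip_sym u); lra.
Qed.

(** The numbers <psum e e n u, u> increase and are bounded by Bessel; by [psum_diff] their
    differences are the squared distances between partial sums. *)
Lemma psum_cauchy w u : ortho b w -> exists l, ncvg (fun n => psum e w n u) l.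
Proof.
move=> ow; pose a n := rip (psum e e n u) u.
have a_nd : {homo a : n k / (n <= k)%N >-> n <= k}.
  by apply: homo_leq => [x//|x y z|n]; [exact: le_trans|rewrite -subr_ge0 psum_mono].
have ca : cvgn a.
  apply: nondecreasing_is_cvgn => //; exists (rip u u) => _ [n _ <-]; exact: bessel.
apply: hilbert_complete => d d0; have d2 : 0 < d ^+ 2 / 2 by rewrite divr_gt0 ?exprn_gt0.
have [N _ hN] := (cvgrPdist_lt _ _).1 ca _ d2; exists N.
have half n k : (N <= n)%N -> (n <= k)%N -> nrm (psum e w k u - psum e w n u) < d.
  move=> Nn nk; rewrite -(@ltr_pXn2r _ 2)// ?nnegrE ?nrm_ge0 ?(ltW d0)// -ripxx.
  rewrite -(subnKC nk) psum_diff// subnKC// -/(a k) -/(a n).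
  have := hN _ Nn; have := hN _ (leq_trans Nn nk) => /=.
  move: (limn a) => L; rewrite !ltr_norml => /andP[? ?] /andP[? ?]; lra.
move=> n k Nn Nk; case/orP: (leq_total n k) => nk; last exact: half.
by rewrite nrmB; exact: half.
Qed.

(** For orthonormal families, the partial isometry that takes each [e i] to [w i] and kills the
    orthogonal complement of the [e i]. *)
Definition transfer w u : G := xget 0 [set l | ncvg (fun n => psum e w n u) l].

Section OneTarget.
Variable w : nat -> G.
Hypothesis ow : ortho b w.

Lemma transferP u : ncvg (fun n => psum e w n u) (transfer w u).
Proof.
rewrite /transfer; case: xgetP => [//|].
by have [l hl] := psum_cauchy u ow => /(_ l).
Qed.

Lemma transfer_lin (a : R[i]) u v : transfer w (a *: u + v) = a *: transfer w u + transfer w v.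
Proof.
apply: ncvg_uniq (transferP _) _.
have := ncvg_lin a (transferP u) (transferP v); congr ncvg; apply/funext => n.
by rewrite psum_lin.
Qed.

Lemma transfer_basis i : transfer w (e i) = w i.
Proof.
apply: (ncvg_near (transferP (e i))); exists i.+1 => n ni.
rewrite /psum (bigD1 (Ordinal ni))//= big1 ?addr0.
  rewrite oe eqxx /=; case: (boolP (b i)) => bi; first by rewrite scale1r.
  by rewrite (ortho0 ow bi) scaler0.
move=> j; rewrite -val_eqE /= => ji; rewrite oe eq_sym (negbTE ji) /=.
by rewrite scale0r.
Qed.

Lemma transferB u v : transfer w (u - v) = transfer w u - transfer w v.
Proof.
have -> : u - v = (- 1) *: v + u by rewrite scaleN1r addrC.
by rewrite transfer_lin scaleN1r addrC.
Qed.

Lemma transfer_psum n u : transfer w (psum e e n u) = psum e w n u.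
Proof.
elim: n => [|n IH].
  by rewrite /psum !big_ord0; have := transferB 0 0; rewrite !subrr.
by rewrite !psumS addrC transfer_lin IH transfer_basis addrC.
Qed.

End OneTarget.

(** With target e, [transfer] is the orthogonal projection onto the closed span of e; so the initial
    projection is the same for all targets w. *)
Lemma transfer_rip w u v : ortho b w ->
  rip (transfer w u) (transfer w v) = rip (transfer e u) v.
Proof.
move=> ow; have h1 := ncvg_rip (transferP ow u) (transferP ow v).
have h2 := ncvg_rip (transferP oe u) (ncvg_cst v).
rewrite -(cvg_lim _ h1)// -(cvg_lim _ h2)//; congr (lim (_ @ \oo)).
by apply/funext => n; rewrite /rip psum_iprod.
Qed.

Lemma transfer_iprod w u v : ortho b w ->
  iprod (transfer w u) (transfer w v) = iprod (transfer e u) v.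
Proof.
move=> ow; rewrite [LHS]iprodE [RHS]iprodE; congr (_ +i* _); first exact: transfer_rip.
rewrite -(transfer_rip _ _ ow); congr rip.
have h := transfer_lin ow 'i%C v 0; rewrite !addr0 in h.
have h0 : transfer w 0 = 0 by have := transferB ow 0 0; rewrite !subrr.
by rewrite h h0 addr0.
Qed.

Lemma transfer_iprod_basis u j : iprod (transfer e u) (e j) = iprod u (e j).
Proof.
have E v : (exists N, forall n, (N <= n)%N -> rip (psum e e n u) v = rip u v) ->
    rip (transfer e u) v = rip u v.
  move=> [N hN]; have h := ncvg_rip (transferP oe u) (ncvg_cst v).
  rewrite -(cvg_lim _ h)//; apply: lim_near_cst => //; by exists N.
rewrite [LHS]iprodE [RHS]iprodE; congr (_ +i* _); apply: E; exists j.+1 => n nj.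
  by rewrite /rip iprod_psum// nj.
by rewrite -!Im_iprod iprod_psum// nj.
Qed.

Lemma transfer_le w u : ortho b w -> nrm (transfer w u) <= nrm u.
Proof.
move=> ow; have h : nrm (transfer e u) <= nrm u.
  have := cauchy_schwarz (transfer e u) u; rewrite -(transfer_rip _ _ oe) ripxx expr2.
  have := nrm_ge0 (transfer e u); case: ltgtP => // [n0 _|<- _ _]; last exact: nrm_ge0.
  by rewrite ler_pM2l.
rewrite -(@ler_pXn2r _ 2)// ?nnegrE ?nrm_ge0// -!ripxx transfer_rip//.
apply: le_trans (cauchy_schwarz _ _) _; rewrite ripxx expr2.
by rewrite ler_wpM2r ?nrm_ge0.
Qed.

(** The speed of convergence does not depend on w, so for a family w(z) the series converges
    uniformly in z, hence in L2. *)
Lemma transfer_tail w n u : ortho b w ->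
  nrm (transfer w u - psum e w n u) = nrm (transfer e u - psum e e n u).
Proof.
move=> ow; apply/eqP; rewrite -(@eqrXn2 _ 2) ?nrm_ge0// -!ripxx.
have E w' : ortho b w' -> transfer w' u - psum e w' n u = transfer w' (u - psum e e n u).
  by move=> ow'; rewrite transferB// transfer_psum.
by rewrite !E// (transfer_rip _ _ ow) (transfer_rip _ _ oe).
Qed.

(** The closed span as a double orthogonal complement, which makes linearity immediate. *)
Definition basis_span : set G := [set x | forall y, (forall i, iprod y (e i) = 0) -> iprod x y = 0].

Lemma basis_span0 : basis_span 0. Proof. by move=> y _; rewrite iprod0l. Qed.

Lemma basis_spanP (a : R[i]) x y : basis_span x -> basis_span y -> basis_span (a *: x + y).
Proof. by move=> hx hy z hz; rewrite iprod_linear hx// hy// mulr0 addr0. Qed.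

Lemma basis_span_closed : closed basis_span.
Proof.
apply: closed_nrmP => x h y hy.
have E v : (forall z, basis_span z -> rip z v = 0) -> rip x v = 0.
  move=> hv; have [->|v0] := eqVneq v 0; first exact: rip0r.
  have nv : 0 < nrm v.
    by rewrite lt_neqAle nrm_ge0 andbT eq_sym; apply/eqP => /nrm_eq0/eqP; apply/negP.
  apply/eqP; rewrite -normr_eq0 eq_le normr_ge0 andbT; apply/ler_addgt0Pr => d d0.
  have [z hz xz] := h _ (divr_gt0 d0 nv); rewrite add0r.
  rewrite -(subr0 (rip x v)) -(hv z hz) -ripBl; apply: le_trans (abs_rip _ _) _.
  by rewrite -ler_pdivlMr// ltW.
rewrite iprodE; apply/eqP; rewrite eq_complex /=; apply/andP; split; apply/eqP; apply: E => z hz.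
  by rewrite /rip hz.
by rewrite -Im_iprod hz.
Qed.

Definition basis_subspace : subspace_of G :=
  Subspace basis_span0 basis_spanP basis_span_closed.

Lemma basis_span_transfer u : basis_span (transfer e u).
Proof.
move=> y hy; rewrite -(transfer_iprod _ _ oe).
have -> : transfer e y = 0.
  apply: (ncvg_near (transferP oe y)); exists 0%N => n _.
  by rewrite /psum big1// => i _; rewrite hy scale0r.
exact: iprod0r.
Qed.

Lemma orthoproj_transfer u : orthoproj basis_subspace u = transfer e u.
Proof.
have spec : basis_span (transfer e u) /\
    forall x, basis_span x -> iprod (u - transfer e u) x = 0.
  split; first exact: basis_span_transfer.
  move=> x hx; rewrite iprodC hx ?rmorph0// => i.
  by rewrite iprodBl transfer_iprod_basis subrr.
rewrite /orthoproj; case: xgetP => [y _ [/= hy h]|/(_ (transfer e u))[]]; last by [].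
have [h1 h2] := spec.
apply/eqP; rewrite -subr_eq0; apply/eqP/ripxx_eq0.
have hd : basis_span (y - transfer e u).
  by rewrite addrC -scaleN1r; exact: basis_spanP.
have -> : rip (y - transfer e u) (y - transfer e u) =
  rip (u - transfer e u) (y - transfer e u) - rip (u - y) (y - transfer e u).
  by rewrite -ripBl; congr rip; rewrite opprB [RHS]addrC addrA subrK.
by rewrite /rip h2// h// subr0.
Qed.

End Transfer.

(** * Shift-invariant subspaces of L2 *)

Section OrthogonalComplement.
Context {R : realType} {G : hilbertType R}.
Local Notation T := (circle R).
Local Notation m := (circle_measure R).
Implicit Types (f g h : T -> G) (K S : set (T -> G)).
Hypothesis sepG : dense_sequence G.

Lemma rhoZi f g : rho f ('i%C *: g) = rho ((- 'i)%C *: f) g.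
Proof.
rewrite rhoZ; congr (rho f (_ *: g)); apply/eqP; rewrite eq_complex /=.
by rewrite oppr0 opprK !eqxx.
Qed.

Lemma rho_scalel c f g : L2 f -> L2 g ->
  rho (c *: f) g = complex.Re c * rho f g - complex.Im c * rho f ('i%C *: g).
Proof.
move=> Lf Lg; have Lig : L2 ('i%C *: g) by L2solve.
rewrite /rho -!RintegralZl//; try exact: (cint_rip sepG).
rewrite -RintegralB//; try by apply: cintZ; exact: (cint_rip sepG).
by apply: eq_Rintegral => z _; rewrite rip_scalel.
Qed.

Lemma rho_i f : rho f ('i%C *: f) = 0.
Proof.
rewrite /rho (eq_Rintegral _ (g := fun=> 0)); first by rewrite Rintegral_cst// mul0r.
move=> z _; rewrite -Im_iprod iprod_norm normr_nrm -rmorphXn /=; by [].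
Qed.

(** Complex orthogonality, that is [iprodL2 f g = 0] by [iprodL2_eq0], in terms of [rho]. *)
Definition corth f g : Prop := rho f g = 0 /\ rho f ('i%C *: g) = 0.

Lemma corthZ c f g : L2 f -> L2 g -> corth f g -> corth (c *: f) g.
Proof.
move=> Lf Lg [h1 h2]; have Lig : L2 ('i%C *: g) by L2solve.
split; first by rewrite rho_scalel// h1 h2 !mulr0 subrr.
rewrite rhoZi scalerA -[_ *: f]/(_ *: f) rho_scalel// h1 h2 !mulr0 subrr//.
Qed.

Lemma corthC f g : L2 f -> L2 g -> corth f g -> corth g f.
Proof.
move=> Lf Lg h; split; first by rewrite rho_sym; case: h.
by rewrite rho_sym; case: (corthZ 'i%C Lf Lg h).
Qed.

Lemma corthZr c f g : L2 f -> L2 g -> corth f g -> corth f (c *: g).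
Proof.
move=> Lf Lg h; apply: corthC => //; first by L2solve.
by apply: corthZ => //; exact: corthC.
Qed.

Lemma corthDl f g h : L2 f -> L2 g -> L2 h -> corth f h -> corth g h -> corth (f + g) h.
Proof.
move=> Lf Lg Lh [h1 h2] [h3 h4]; have Lih : L2 ('i%C *: h) by L2solve.
by split; rewrite rhoDl// ?h1 ?h2 ?h3 ?h4 addr0.
Qed.

Lemma corthDr f g h : L2 f -> L2 g -> L2 h -> corth h f -> corth h g -> corth h (f + g).
Proof.
move=> Lf Lg Lh h1 h2; apply: corthC; [L2solve|by []|].
by apply: corthDl => //; exact: corthC.
Qed.

Lemma corth_subspace K f : closedL2 K -> (forall k, K k -> rho f k = 0) ->
  forall k, K k -> corth f k.
Proof. by move=> clK h k Kk; split; apply: h => //; exact: (closedL2Z clK). Qed.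

Definition orth S : set (T -> G) := [set f | L2 f /\ forall s, S s -> corth f s].

Lemma closedL2_orth S : S `<=` @L2 R G -> closedL2 (orth S).
Proof.
move=> SL; split.
- by move=> f [].
- by split=> [|s _]; [exact: L20|split; rewrite rho0l].
- move=> a p q [Lp hp] [Lq hq]; split=> [|s Ss]; first by L2solve.
  have Ls := SL _ Ss; have Lap : L2 (a *: p) by L2solve.
  by apply: corthDl => //; [apply: corthZ => //; exact: hp|exact: hq].
- move=> p Lp h; split=> // s Ss; have Ls := SL _ Ss; have Lis : L2 ('i%C *: s) by L2solve.
  split; apply: (rho_cvg0l sepG) => // e /h[q [Lq /(_ s Ss)[q1 q2]] pq]; by exists q.
Qed.

Lemma closedL2I K K' : closedL2 K -> closedL2 K' -> closedL2 (K `&` K').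
Proof.
move=> [a1 a2 a3 a4] [b1 b2 b3 b4]; split.
- by move=> f [/a1].
- by split.
- by move=> a p q [p1 p2] [q1 q2]; split; [exact: a3|exact: b3].
- by move=> p Lp h; split; [apply: a4 => // e /h[q []]|apply: b4 => // e /h[q []]]; exists q.
Qed.

Definition shiftJ f : T -> G := fun z => (zval z)^* *: f z.

Lemma shiftJK f : shiftH (shiftJ f) = f.
Proof. by apply/funext => z; rewrite /shiftH /shiftJ scalerA zval_conj scale1r. Qed.

Lemma shiftHK f : shiftJ (shiftH f) = f.
Proof. by apply/funext => z; rewrite /shiftH /shiftJ scalerA conj_zval scale1r. Qed.

Lemma L2_shiftJ f : L2 f -> L2 (shiftJ f).
Proof. by move=> Lf; have := L2_zJX sepG 1 Lf; under eq_fun do rewrite expr1. Qed.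

Lemma L2_shiftH f : L2 f -> L2 (shiftH f).
Proof. by move=> Lf; have := L2_zX sepG 1 Lf; under eq_fun do rewrite expr1. Qed.

Lemma shiftJ_lin a f g : shiftJ (a *: f + g) = a *: shiftJ f + shiftJ g.
Proof. by apply/funext => z; rewrite /shiftJ /= scalerDr scaler_swap. Qed.

Lemma shiftH_lin a f g : shiftH (a *: f + g) = a *: shiftH f + shiftH g.
Proof. by apply/funext => z; rewrite /shiftH /= scalerDr scaler_swap. Qed.

Lemma shiftJB f g : shiftJ (f - g) = shiftJ f - shiftJ g.
Proof. by apply/funext => z; rewrite /shiftJ /= scalerBr. Qed.

Lemma rho_shift f g : rho (shiftH f) (shiftH g) = rho f g.
Proof.
by apply: eq_Rintegral => z _; rewrite /shiftH rip_scale scalerA conj_zval scale1r.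
Qed.

Lemma rho_shiftHl f g : rho (shiftH f) g = rho f (shiftJ g).
Proof. by rewrite -{1}(shiftJK g) rho_shift. Qed.

Definition zX n f : T -> G := fun z => zval z ^+ n *: f z.
Definition zJX n f : T -> G := fun z => (zval z)^* ^+ n *: f z.

Lemma zXS n f : zX n.+1 f = shiftH (zX n f).
Proof. by apply/funext => z; rewrite /zX /shiftH scalerA exprS. Qed.

Lemma zJXS n f : zJX n.+1 f = shiftJ (zJX n f).
Proof. by apply/funext => z; rewrite /zJX /shiftJ scalerA exprS. Qed.

Lemma zX0 f : zX 0 f = f.
Proof. by apply/funext => z; rewrite /zX expr0 scale1r. Qed.

Lemma zJX0 f : zJX 0 f = f.
Proof. by apply/funext => z; rewrite /zJX expr0 scale1r. Qed.

Lemma zXZ n c f : zX n (c *: f) = c *: zX n f.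
Proof. by apply/funext => z; rewrite /zX /= scaler_swap. Qed.

Lemma rho_zJX n f g : rho (zJX n f) g = rho f (zX n g).
Proof.
by apply: eq_Rintegral => z _; rewrite rip_scale rmorphXn /= conjCK.
Qed.

Lemma ccint_iprod f g : L2 f -> L2 g -> ccint (fun z => iprod (f z) (g z)).
Proof.
move=> Lf Lg; split; first exact: (cint_rip sepG).
rewrite (_ : (fun _ => _) = fun z => rip (f z) (('i%C *: g) z)).
  by apply: (cint_rip sepG) => //; L2solve.
by apply/funext => z; rewrite Im_iprod.
Qed.

Lemma Rintegral_circle_cst (r : R) : \int[m]__ r = r.
Proof.
rewrite Rintegral_cst//; transitivity (r * fine (circle_measure R setT)) => //.
by rewrite circle_measureT mulr1.
Qed.

Lemma ae_ex (P : T -> Prop) : (\forall z \ae m, P z) -> exists z, P z.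
Proof.
move=> [B [mB B0 hB]]; apply: contrapT => /forallNP H.
have BT : B = setT by apply/seteqP; split=> // z _; apply: hB; exact: H.
have : circle_measure R B = 0%E by exact: B0.
by rewrite BT circle_measureT => /eqP; rewrite onee_eq0.
Qed.

(** Only the mean k of h survives among its coefficients, so h - k has none left; with [fourier0_ae]
    this shows a function to be constant almost everywhere. *)
Lemma fourier0_sub_cst (h : T -> R[i]) (k : R[i]) : ccint h ->
  (forall n c, \int[m]_z complex.Re (c * (zval z ^+ n.+1 * h z)) = 0) ->
  (forall n c, \int[m]_z complex.Re (c * ((zval z)^* ^+ n.+1 * h z)) = 0) ->
  (forall c, \int[m]_z complex.Re (c * h z) = complex.Re (c * k)) ->
  fourier0 (fun z => h z - k).
Proof.
move=> hi h1 h2 h3.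
have ki : ccint (fun=> - k) by split; exact: cint_cst.
split; first exact: ccintD.
have E (a : T -> R[i]) : ccint (fun z => a z * h z) -> ccint (fun z => a z * - k) ->
    \int[m]_z complex.Re (a z * (h z - k)) =
    \int[m]_z complex.Re (a z * h z) + \int[m]_z complex.Re (a z * - k).
  move=> [a1 _] [a2 _]; rewrite -RintegralD//.
  by apply: eq_Rintegral => z _; rewrite mulrDr raddfD.
have h3' c : \int[m]_z complex.Re (c * (h z - k)) = 0.
  rewrite (E (fun=> c)); [|exact: ccintZ|exact: ccintZ].
  by rewrite h3 Rintegral_circle_cst mulrN raddfN subrr.
move=> [|n] c; split.
- by rewrite -[RHS](h3' c); apply: eq_Rintegral => z _; rewrite expr0 mul1r.
- by rewrite -[RHS](h3' c); apply: eq_Rintegral => z _; rewrite expr0 mul1r.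
- under eq_Rintegral do rewrite mulrA.
  have := E (fun z => c * zval z ^+ n.+1); move=> ->.
  + under eq_Rintegral do rewrite -mulrA; rewrite h1 add0r.
    rewrite -[RHS](@Rintegral_zvalX _ n.+1 isT (c * - k)); apply: eq_Rintegral => z _.
    by rewrite mulrAC.
  + by have := ccintZ c (ccint_zX n.+1 hi); under eq_fun do rewrite mulrA.
  + by have := ccintZ c (ccint_zX n.+1 ki); under eq_fun do rewrite mulrA.
- under eq_Rintegral do rewrite mulrA.
  have := E (fun z => c * (zval z)^* ^+ n.+1); move=> ->.
  + under eq_Rintegral do rewrite -mulrA; rewrite h2 add0r.
    rewrite -[RHS](@Rintegral_zvalX _ n.+1 isT (c * - k)^*); apply: eq_Rintegral => z _.
    (* Conjugation keeps the real part and turns negative powers into positive ones. *)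
    have ReJ (a : R[i]) : complex.Re a^* = complex.Re a by case: a.
    by rewrite mulrAC -ReJ rmorphM rmorphXn /= conjCK.
  + by have := ccintZ c (ccint_zJX n.+1 hi); under eq_fun do rewrite mulrA.
  + by have := ccintZ c (ccint_zJX n.+1 ki); under eq_fun do rewrite mulrA.
Qed.

End OrthogonalComplement.

(** * The Wold decomposition *)

Section Wold.
Context {R : realType} {G : hilbertType R}.
Local Notation T := (circle R).
Local Notation m := (circle_measure R).
Implicit Types (f g h : T -> G) (K : set (T -> G)).
Hypothesis sepG : dense_sequence G.
Variable M : set (T -> G).
Hypothesis clM : closedL2 M.
Hypothesis shM : forall f, M f -> M (shiftH f).

Let ML f : M f -> L2 f. Proof. exact: closedL2_L2. Qed.

(** The subspace zM, as a preimage under the inverse of multiplication by z; its closedness then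
    comes from that of M. *)
Definition shifted : set (T -> G) := [set f | M (shiftJ f)].

Lemma shifted_shiftH f : M f -> shifted (shiftH f).
Proof. by move=> Mf; rewrite /shifted /= shiftHK. Qed.

Lemma shifted_sub : shifted `<=` M.
Proof. by move=> f /shM; rewrite shiftJK. Qed.

Lemma closedL2_shifted : closedL2 shifted.
Proof.
have [_ M0 Ml Mc] := clM; split.
- by move=> f /shifted_sub/ML.
- by rewrite /shifted /= (_ : shiftJ 0 = 0)//; apply/funext => z; rewrite /shiftJ scaler0.
- by move=> a p q; rewrite /shifted /= shiftJ_lin; exact: Ml.
- move=> p Lp h; apply: Mc => [|e /h[q Mq pq]]; first exact: L2_shiftJ.
  by exists (shiftJ q) => //; rewrite -shiftJB -rho_shift shiftJK.
Qed.

Definition wandering : set (T -> G) := M `&` orth shifted.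

Lemma closedL2_wandering : closedL2 wandering.
Proof.
apply: closedL2I => //; apply: closedL2_orth => // f.
exact: (closedL2_L2 closedL2_shifted).
Qed.

Lemma wandering_M f : wandering f -> M f. Proof. by case. Qed.

Lemma wandering_shift f g : wandering f -> M g -> corth f (shiftH g).
Proof. by move=> [_ [_ h]] Mg; apply: h; exact: shifted_shiftH. Qed.

Lemma M_zX n f : M f -> M (zX n f).
Proof. by move=> Mf; elim: n => [|n IH]; rewrite ?zX0 ?zXS //; exact: shM. Qed.

(** The functions z^n y and z^-n y, with y in a dense sequence, form a countable total family,
    because both depend isometrically on y. *)
Let dense_total : exists v : nat -> T -> G, (forall k, L2 (v k)) /\
  forall x, L2 x -> (forall k, rho x (v k) = 0) -> rho x x = 0.
Proof.
have [d hd] := sepG.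
exists (fun k => if unpickle k is Some (b, n, j) then
  (if b : bool then mono n (d j) else monoJ n (d j)) else 0); split.
  move=> k; case: unpickle => [[[b n] j]|]; last exact: L20.
  by case: b; [exact: L2_mono|exact: L2_monoJ].
move=> x Lx hx.
have key (E : G -> T -> G) : (forall y, L2 (E y)) ->
    (forall y y', rho (E y - E y') (E y - E y') = nrm (y - y') ^+ 2) ->
    (forall j, rho x (E (d j)) = 0) -> forall y, rho x (E y) = 0.
  move=> LE dE h y; rewrite rho_sym; apply: (rho_cvg0l sepG) => // e e0.
  have se : 0 < Num.sqrt e by rewrite sqrtr_gt0.
  have [j hj] := hd y _ se; exists (E (d j)); split=> //; first by rewrite rho_sym h.
  rewrite dE -(sqr_sqrtr (ltW e0)) ltr_pXn2r ?nnegrE ?nrm_ge0//; exact: ltW.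
apply: (L2_total sepG Lx) => n y.
  apply: (key (mono n)) => [y'|y1 y2|j]; first exact: L2_mono.
    rewrite -[RHS]Rintegral_circle_cst; apply: eq_Rintegral => z _.
    have -> : (mono n y1 - mono n y2) z = zval z ^+ n *: (y1 - y2) by rewrite scalerBr.
    by rewrite ripxx nrmZ norm_zvalX mul1r.
  by have := hx (pickle (true, n, j)); rewrite pickleK.
apply: (key (monoJ n)) => [y'|y1 y2|j]; first exact: L2_monoJ.
  rewrite -[RHS]Rintegral_circle_cst; apply: eq_Rintegral => z _.
  have -> : (monoJ n y1 - monoJ n y2) z = (zval z)^* ^+ n *: (y1 - y2) by rewrite scalerBr.
  by rewrite ripxx nrmZ norm_zvalJX mul1r.
by have := hx (pickle (false, n, j)); rewrite pickleK.
Qed.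

Lemma gram_schmidt : exists (b : nat -> bool) (w : nat -> T -> G),
  [/\ forall k, wandering (w k),
      forall i j, iprodL2 (w i) (w j) = ((i == j) && b i)%:R
    & forall x, wandering x -> (forall k, corth x (w k)) -> rho x x = 0].
Proof.
have clW := closedL2_wandering.
have [v [Lv vtot]] := dense_total.
have /choice[p hp] : forall k, exists p,
    wandering p /\ forall x, wandering x -> rho (v k - p) x = 0.
  by move=> k; have [p Wp h] := projection sepG clW (Lv k); exists p.
have Wp k : wandering (p k) by case: (hp k).
have Lp k : L2 (p k) by exact/ML/wandering_M.
(* Each [p k] is projected onto the wandering functions orthogonal to p 0, ..., p (k-1), which
   avoids finite linear combinations. *)
pose A k := wandering `&` orth [set p j | j in [set j | (j < k)%N]].
have clA k : closedL2 (A k).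
  by apply: closedL2I => //; apply: closedL2_orth => // _ [j _ <-].
have /choice[q hq] : forall k, exists q, A k q /\ forall x, A k x -> rho (p k - q) x = 0.
  by move=> k; have [q Aq h] := projection sepG (clA k) (Lp k); exists q.
have Aq k : A k (q k) by case: (hq k).
have Wq k : wandering (q k) by case: (Aq k).
have Lq k : L2 (q k) by exact/ML/wandering_M.
have cpq k x : A k x -> corth (p k - q k) x.
  by move=> Ax; apply: (corth_subspace (clA k)) => //; case: (hq k).
have Amono j k : (j <= k)%N -> A k `<=` A j.
  move=> jk x [Wx [Lx h]]; split=> //; split=> // _ [i ij <-]; apply: h.
  by exists i => //; exact: leq_trans ij jk.
have Lpq k : L2 (p k - q k) by L2solve.
have qE k : q k = p k + (- 1) *: (p k - q k).
  by rewrite scaleN1r opprB addrC subrK.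
(* [q k] is orthogonal to [p j] by the definition of [A k], and to [p j - q j] because it lies in
   [A j]. *)
have orthq j k : (j < k)%N -> corth (q k) (q j).
  move=> jk; rewrite (qE j); apply: corthDr => //; first by L2solve.
    by case: (Aq k) => _ [_]; apply; exists j.
  apply: corthZr => //; apply: corthC => //; apply: cpq.
  exact: (Amono _ _ (ltnW jk)).
have qtot x : wandering x -> (forall k, corth x (q k)) -> rho x x = 0.
  move=> Wx hx; have Lx := ML (wandering_M Wx).
  (* By strong induction x lies in [A k], hence is orthogonal to [p k - q k]; it is orthogonal to
     [q k] by assumption. *)
  have xp k : corth x (p k).
    elim/ltn_ind: k => k IH.
    have Ax : A k x by split=> //; split=> // _ [j jk <-]; exact: IH.
    have -> : p k = q k + (p k - q k) by rewrite addrC subrK.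
    by apply: corthDr => //; apply: corthC => //; exact: cpq.
  apply: vtot => // k; have [_ /(_ x Wx)] := hp k.
  rewrite rhoBl// => /subr0_eq; rewrite rho_sym => ->; rewrite rho_sym.
  by case: (xp k).
pose r k := rho (q k) (q k).
(* Normalising factor; a null [q k] gets the factor 0 and a false mask. *)
pose s k : R := if r k == 0 then 0 else (Num.sqrt (r k))^-1.
exists (fun k => r k != 0), (fun k => (s k)%:C *: q k); split.
- by move=> k; exact: (closedL2Z clW).
- move=> i j; have [->|ij] := eqVneq i j; last first.
    have h : corth (q i) (q j).
      case: (ltngtP i j) ij => // ij _; last exact: orthq.
      by apply: corthC => //; exact: orthq.
    apply/iprodL2_eq0; apply: corthZ => //; first by L2solve.
    exact: corthZr.
  rewrite iprodL2E rhoZl ?rhoZr ?rho_i//; try L2solve.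
  rewrite -/(r j) /s; have [->|rj] := eqVneq (r j) 0; first by rewrite !mulr0.
  have r0 : 0 <= r j by exact: rho_ge0.
  rewrite /= mulrA -expr2 exprVn sqr_sqrtr// mulVf//.
- move=> x Wx hx; apply: qtot => // k; have Lx := ML (wandering_M Wx).
  have [rk|rk] := eqVneq (r k) 0.
    by split; rewrite ?rhoZi rho_null//; L2solve.
  have -> : q k = (Num.sqrt (r k))%:C *: ((s k)%:C *: q k).
    rewrite scalerA -rmorphM /s (negbTE rk) mulfV ?scale1r//.
    by rewrite sqrtr_eq0 -ltNge lt_neqAle eq_sym rk rho_ge0.
  by apply: corthZr => //; L2solve.
Qed.

Lemma pointwise_ortho : exists (b : nat -> bool) (w : nat -> T -> G),
  [/\ forall k, wandering (w k), forall z, ortho b (w ^~ z)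
    & forall x, wandering x -> (forall k, corth x (w k)) -> rho x x = 0].
Proof.
have [b [w [Ww wE wtot]]] := gram_schmidt.
have Mw k := wandering_M (Ww k); have Lw k := ML (Mw k).
(* Wandering functions are each orthogonal to z^(n+1) times the other, so the coefficients of <w i,
   w j> of both signs vanish and only its mean is left. *)
have four i j : fourier0 (fun z => iprod (w i z) (w j z) - ((i == j) && b i)%:R).
  apply: fourier0_sub_cst => //.
  - exact: ccint_iprod.
  - move=> n c; have Mz : M (c *: zX n (w i)) by apply/(closedL2Z clM)/M_zX.
    have [h _] := wandering_shift (Ww j) Mz; rewrite -[RHS]h rho_sym.
    apply: eq_Rintegral => z _.
    rewrite /rip /shiftH /zX -!iprodZl; congr (complex.Re (iprod _ _)).
    by rewrite [(c *: _) z]/(c *: (_ *: _)) !scalerA exprS; congr (_ *: _); ring.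
  - move=> n c; have Mz : M (c^* *: zX n (w j)) by apply/(closedL2Z clM)/M_zX.
    have [h _] := wandering_shift (Ww i) Mz; rewrite -[RHS]h.
    apply: eq_Rintegral => z _; rewrite /rip /shiftH /zX.
    rewrite [(c^* *: _) z]/(c^* *: (_ *: _)) !iprodZr conjCK rmorphXn /=.
    by congr complex.Re; rewrite exprS; ring.
  - move=> c; rewrite -wE iprodL2E; transitivity (rho (c *: w i) (w j)).
      by apply: eq_Rintegral => z _; rewrite -iprodZl.
    by rewrite rho_scalel//; case: c.
have /ae_foralln : forall i, \forall z \ae m, forall j,
    iprod (w i z) (w j z) = ((i == j) && b i)%:R.
  move=> i; apply/ae_foralln => j; have := fourier0_ae (four i j).
  by apply: filterS => z /subr0_eq.
move=> [B [mB B0 hB]].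
have good z : ~ B z -> ortho b (w ^~ z).
  by move=> Bz i j; apply: contrapT => h; apply: Bz; apply: hB => /= /(_ i j).
have [z0 Bz0] : exists z0, ~ B z0.
  by apply: ae_ex; exists B; split=> // z /= /contrapT.
(* On the exceptional null set all functions take their values at one good point z0, so
   orthonormality holds at every point. *)
pose o i z := if z \in B then w i z0 else w i z.
have mo i : wmeas (o i).
  move=> x; rewrite (_ : (fun _ => _) =
    fun z => \1_B z * rip (w i z0) x + (1 - \1_B z) * rip (w i z) x).
    apply: measurable_funD; apply: measurable_funM.
    - exact: measurable_indic.
    - exact: measurable_cst.
    - by apply: measurable_funB; [exact: measurable_cst|exact: measurable_indic].
    - exact: (L2_wmeas sepG).
  apply/funext => z; rewrite /o indicE.
  by case: (z \in B); rewrite /= ?mul1r ?subrr ?mul0r ?addr0 ?subr0 ?add0r ?mul1r.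
have ow i : \forall z \ae m, w i z = o i z.
  exists B; split=> // z /= h; apply: contrapT => Bz; apply: h.
  by rewrite /o memNset.
have Lo i : L2 (o i) by exact: (L2_ae sepG (Lw i) (mo i) (ow i)).
have oweq i : rho (o i - w i) (o i - w i) = 0.
  apply/(rho_ae0 sepG); first by L2solve.
  apply: filterS (ow i) => z /= wz; have -> : (o i - w i) z = o i z - w i z by [].
  by rewrite wz subrr.
exists b, o; split.
- by move=> k; exact: (closedL2_eq closedL2_wandering (Ww k)).
- move=> z i j; rewrite /o; have [_|/negP zB] := boolP (z \in B); first exact: (good _ Bz0).
  by apply: (good z) => /mem_set.
- move=> x Wx hx; apply: wtot => // k; have Lx := ML (wandering_M Wx).
  have -> : w k = o k + (- 1) *: (o k - w k) by rewrite scaleN1r opprB addrC subrK.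
  have Low : L2 (o k - w k) by L2solve.
  apply: corthDr => //; first by L2solve.
  by apply: corthZr => //; split; rewrite ?rhoZi rho_null//; L2solve.
Qed.

(** The last clause replaces a direct sum decomposition: M lies in every closed subspace that
    contains the functions z^n Phi u and the reducing part of M. The first clause says that Phi(z)
    is a partial isometry with initial projection [orthoproj E0], the second that this is the
    genuine projection and not a default of [xget]. *)
Theorem wold : exists (E0 : subspace_of G) (Phi : T -> bop G G),
  [/\ forall z u v, iprod (Phi z u) (Phi z v) = iprod (orthoproj E0 u) v,
      forall u, subspace_set E0 (orthoproj E0 u) /\
        forall x, subspace_set E0 x -> iprod (u - orthoproj E0 u) x = 0,
      forall z u, nrm (Phi z u) <= nrm u,
      forall u, M (fun z => Phi z u)
    & forall K, closedL2 K -> (forall n u, K (zX n (fun z => Phi z u))) ->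
        (forall g, (forall n, M (zJX n g)) -> K g) -> M `<=` K].
Proof.
have [b [w [Ww ow wtot]]] := pointwise_ortho.
have Mw k := wandering_M (Ww k); have Lw k := ML (Mw k).
pose z0 : T := point; pose e k := w k z0.
have oe : ortho b e := ow z0.
have /choice[Phi PhiE] : forall z, exists L : bop G G, forall u, L u = transfer e (w ^~ z) u.
  move=> z; apply: (@bop_ex _ _ _ _ 1) => [a x y|x]; first exact: (transfer_lin oe (ow z)).
  by rewrite mul1r; exact: (transfer_le oe _ (ow z)).
have Lsum n u : M (fun z => psum e (w ^~ z) n u).
  elim: n => [|n IH].
    have [_ M0 _ _] := clM; rewrite (_ : (fun _ => _) = 0)//.
    by apply/funext => z; rewrite /psum big_ord0.
  rewrite (_ : (fun _ => _) = (fun z => psum e (w ^~ z) n u) + iprod u (e n) *: w n).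
    by apply: (closedL2D clM) => //; exact: (closedL2Z clM).
  by apply/funext => z; rewrite psumS.
have MPhi u : M (fun z => Phi z u).
  have L2Phi : L2 (fun z => Phi z u).
    apply: (L2_le sepG (g := fun=> nrm u ^+ 2)).
    - apply: (wmeas_lim (u := fun n z => psum e (w ^~ z) n u)) => [n|z x].
        exact: (L2_wmeas sepG (ML (Lsum n u))).
      by rewrite PhiE; apply: ncvg_rip (ncvg_cst x); exact: (transferP oe (ow z)).
    - exact: cint_cst.
    - move=> z; rewrite ripxx ler_pXn2r ?nnegrE ?nrm_ge0// PhiE.
      exact: (transfer_le oe _ (ow z)).
  have [_ _ _ h] := clM; apply: h => // d d0.
  have sd : 0 < Num.sqrt d by rewrite sqrtr_gt0.
  have [N hN] := transferP oe oe u sd; exists (fun z => psum e (w ^~ z) N u) => //.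
  (* By [transfer_tail] the error has the same norm at every z, and the circle has measure 1. *)
  rewrite (_ : rho _ _ = nrm (transfer e e u - psum e e N u) ^+ 2).
    rewrite -[ltRHS](sqr_sqrtr (ltW d0)) ltr_pXn2r ?nnegrE ?nrm_ge0 ?(ltW sd)//.
    by rewrite nrmB hN.
  rewrite -[RHS]Rintegral_circle_cst; apply: eq_Rintegral => z _ /=.
  have -> : ((fun z => Phi z u) - (fun z => psum e (w ^~ z) N u)) z =
      transfer e (w ^~ z) u - psum e (w ^~ z) N u by rewrite -PhiE.
  by rewrite ripxx (transfer_tail oe _ _ (ow z)).
exists (basis_subspace e), Phi; split.
- by move=> z u v; rewrite !PhiE (transfer_iprod oe _ _ (ow z)) (orthoproj_transfer oe).
- move=> u; rewrite (orthoproj_transfer oe); split; first exact: (basis_span_transfer oe).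
  move=> x hx; rewrite iprodC hx ?rmorph0// => i.
  by rewrite iprodBl (transfer_iprod_basis oe) subrr.
- by move=> z u; rewrite PhiE; exact: (transfer_le oe _ (ow z)).
- exact: MPhi.
- move=> K clK Kz Kinf f Mf; have Lf := ML Mf.
  have Phie i : (fun z => Phi z (e i)) = w i.
    by apply/funext => z; rewrite PhiE (transfer_basis oe (ow z)).
  have clMK := closedL2I clM clK.
  have [p [Mp Kp] hp] := projection sepG clMK Lf; have Lp := ML Mp.
  (* g is orthogonal to the intersection of M and K. It is shown to lie in the reducing part, hence
     in K; then it is orthogonal to itself. *)
  set g := f - p; have Mg : M g by exact: (closedL2B clM).
  have Lg := ML Mg.
  suff gK : K g.
    have gg : rho g g = 0 by apply: hp.
    exact: (closedL2_eq clK Kp Lf).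
  (* Let z^-n g lie in M and let a be its remainder after projection onto zM. Then a is wandering,
     and <z^-n g, w k> = <g, z^n w k> = 0 since z^n w k lies in M and K. So a is null and z^-n g
     lies in zM, that is, z^-(n+1) g lies in M. *)
  apply: Kinf; elim=> [|n IH]; first by rewrite zJX0.
  have Ln := ML IH.
  have [q Sq hq] := projection sepG closedL2_shifted Ln.
  have Mq := shifted_sub Sq; have Lq := ML Mq.
  set a := zJX n g - q; have Ma : M a by exact: (closedL2B clM).
  have La := ML Ma.
  have Wa : wandering a by split=> //; split=> //; exact: (corth_subspace closedL2_shifted).
  have aw k : corth a (w k).
    have key c : rho a (c *: w k) = 0.
      have Lcw : L2 (c *: w k) by L2solve.
      rewrite rhoBl// rho_zJX hp; last first.
        split; first by apply: M_zX; exact: (closedL2Z clM).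
        by rewrite zXZ; apply: (closedL2Z clK); rewrite -Phie; exact: Kz.
      rewrite sub0r -(shiftJK q) rho_sym.
      have [h _] : corth (c *: w k) (shiftH (shiftJ q)).
        apply: corthZ => //; first by rewrite shiftJK.
        by apply: wandering_shift.
      by rewrite h oppr0.
    by split; [rewrite -[w k]scale1r|]; exact: key.
  have a0 := wtot a Wa aw.
  have : shifted (zJX n g) by exact: (closedL2_eq closedL2_shifted Sq).
  by rewrite /shifted /= zJXS.
Qed.

End Wold.

(** * Operators on L2 up to null functions *)

Section L2Equality.
Context {R : realType} {G : hilbertType R}.
Local Notation T := (circle R).
Local Notation m := (circle_measure R).
Implicit Types (f g h : T -> G) (K : set (T -> G)).
Hypothesis sepG : dense_sequence G.

Definition eqL2 f g : Prop := rho (f - g) (f - g) = 0.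

Lemma eqL2_refl f : eqL2 f f. Proof. by rewrite /eqL2 subrr rho0l. Qed.

Lemma eqL2_sym f g : eqL2 f g -> eqL2 g f.
Proof. by rewrite /eqL2 rhoBC. Qed.

Lemma eqL2_trans f g h : L2 f -> L2 g -> L2 h -> eqL2 f g -> eqL2 g h -> eqL2 f h.
Proof.
move=> Lf Lg Lh fg gh; rewrite /eqL2 (_ : f - h = (f - g) + (g - h)).
  by apply: rho_eq0D => //; L2solve.
by rewrite addrA subrK.
Qed.

Lemma eqL2_rhol f g h : L2 f -> L2 g -> L2 h -> eqL2 f g -> rho f h = rho g h.
Proof.
move=> Lf Lg Lh fg; apply/eqP; rewrite -subr_eq0 -rhoBl// rho_sym.
by rewrite rho_null//; L2solve.
Qed.

Lemma eqL2_rhor f g h : L2 f -> L2 g -> L2 h -> eqL2 f g -> rho h f = rho h g.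
Proof. by move=> Lf Lg Lh fg; rewrite ![rho h _]rho_sym; exact: eqL2_rhol. Qed.

Lemma ae_eqL2 f g : L2 f -> wmeas g -> (\forall z \ae m, f z = g z) -> L2 g /\ eqL2 f g.
Proof.
move=> Lf mg fg; have Lg := L2_ae sepG Lf mg fg; split=> //.
apply/(rho_ae0 sepG); first by L2solve.
apply: filterS fg => z /= fz; have -> : (f - g) z = f z - g z by [].
by rewrite fz subrr.
Qed.

Lemma eqL2_lin a f g f' g' : L2 f -> L2 g -> L2 f' -> L2 g' ->
  eqL2 f f' -> eqL2 g g' -> eqL2 (a *: f + g) (a *: f' + g').
Proof.
move=> Lf Lg Lf' Lg' ff gg; rewrite /eqL2 opprD addrACA -scalerBr.
apply: rho_eq0D => //; try L2solve.
rewrite rhoZ rho_sym; apply: rho_null (ff); L2solve.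
Qed.

Lemma L2_min K : closedL2 K -> (forall n x, K (mono n x)) -> (forall n x, K (monoJ n x)) ->
  @L2 R G `<=` K.
Proof.
move=> clK h1 h2 f Lf; have [p Kp hp] := projection sepG clK Lf.
have Lp := closedL2_L2 clK Kp; apply: (closedL2_eq clK Kp Lf).
by apply: (L2_total sepG); [L2solve|move=> n y; exact: hp|move=> n y; exact: hp].
Qed.

Lemma L2_le_ae f (g : T -> R) : wmeas f -> cint g -> (forall z, 0 <= g z) ->
  (\forall z \ae m, rip (f z) (f z) <= g z) -> L2 f /\ rho f f <= \int[m]_z g z.
Proof.
move=> mf gi g0 [B [mB B0 hB]].
pose f' z := if z \in B then 0 else f z.
have mf' : wmeas f'.
  move=> x; rewrite (_ : (fun _ => _) = fun z => (1 - \1_B z) * rip (f z) x).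
    apply: measurable_funM; last exact: mf.
    by apply: measurable_funB; [exact: measurable_cst|exact: measurable_indic].
  apply/funext => z; rewrite /f' indicE.
  by case: (z \in B); rewrite /= ?subrr ?subr0 ?mul0r ?mul1r ?rip0l.
have f'g z : rip (f' z) (f' z) <= g z.
  rewrite /f'; have [_|/negP zB] := boolP (z \in B); first by rewrite rip0l.
  by apply: contrapT => h; apply: zB; apply/mem_set/hB.
have Lf' := L2_le sepG mf' gi f'g.
have ff' : \forall z \ae m, f' z = f z.
  exists B; split=> // z /= h; apply: contrapT => Bz; apply: h.
  by rewrite /f' memNset.
have Lf := L2_ae sepG Lf' mf ff'; split=> //.
have [_ E] := cint_ae (measurable_sqn sepG mf) (cint_rip sepG Lf' Lf')
  (filterS (fun z (E : f' z = f z) => congr1 (fun u => rip u u) (esym E)) ff').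
rewrite /rho E; apply: le_Rintegral => //; exact: (cint_rip sepG).
Qed.

End L2Equality.

Section Operators.
Context {R : realType} {E F : hilbertType R}.
Local Notation T := (circle R).
Local Notation m := (circle_measure R).
Hypothesis sepE : dense_sequence E.
Hypothesis sepF : dense_sequence F.

(* Linearity holds only up to null functions: [projH2] returns an arbitrary
   representative. *)
Definition L2op (A : (T -> E) -> (T -> F)) : Prop :=
  [/\ forall u, L2 u -> L2 (A u),
      exists2 C : R, 0 <= C & forall u v, L2 u -> L2 v ->
        rho (A u - A v) (A u - A v) <= C * rho (u - v) (u - v)
    & forall a u v, L2 u -> L2 v -> eqL2 (A (a *: u + v)) (a *: A u + A v)].

Lemma L2op_linear (A : (T -> E) -> (T -> F)) (C : R) : 0 <= C ->
  (forall a u v, A (a *: u + v) = a *: A u + A v) ->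
  (forall u, L2 u -> L2 (A u) /\ rho (A u) (A u) <= C * rho u u) -> L2op A.
Proof.
move=> C0 Al Ab; split.
- by move=> u /Ab[].
- exists C => // u v Lu Lv.
  have -> : A u - A v = A (u - v).
    have -> : u - v = (- 1) *: v + u by rewrite scaleN1r addrC.
    by rewrite Al scaleN1r addrC.
  by apply: (proj2 (Ab _ _)); L2solve.
- by move=> a u v Lu Lv; rewrite Al; exact: eqL2_refl.
Qed.

(** Together with [H2_min] this reduces membership of A h in a closed subspace, for all h in H2, to
    monomials h. *)
Lemma closedL2_preimage (A : (T -> E) -> (T -> F)) K : L2op A -> closedL2 K ->
  closedL2 [set u | L2 u /\ K (A u)].
Proof.
move=> [AL [C C0 AC] Alin] clK; have [KL K0 Kl Kc] := clK.
have A0 : K (A 0).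
  have L0 : L2 (0 : T -> E) by exact: L20.
  have LA0 := AL _ L0.
  have := Alin (- 1) 0 0 L0 L0; rewrite scaler0 addr0 scaleN1r addNr => h.
  exact: (closedL2_eq clK K0 LA0).
split.
- by move=> u [].
- by split=> //; exact: L20.
- move=> a p q [Lp Kp] [Lq Kq]; split; first by L2solve.
  apply: (closedL2_eq clK (Kl a _ _ Kp Kq)); first by apply: AL; L2solve.
  exact: Alin.
- move=> p Lp h; split=> //; apply: Kc; first exact: AL.
  move=> e e0; have C1 : 0 < C + 1 by rewrite ltr_wpDl.
  have [q [Lq Kq] pq] := h _ (divr_gt0 e0 C1); exists (A q) => //.
  apply: le_lt_trans (AC _ _ Lp Lq) _.
  apply: le_lt_trans (_ : _ <= (C + 1) * rho (p - q) (p - q)) _.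
    by rewrite ler_wpM2r ?rho_ge0// lerDl.
  by rewrite mulrC -ltr_pdivlMr.
Qed.

Lemma L2op_eq (A : (T -> E) -> (T -> F)) u v : L2op A -> L2 u -> L2 v -> eqL2 u v ->
  eqL2 (A u) (A v).
Proof.
move=> [_ [C _ AC] _] Lu Lv uv; apply/eqP; rewrite eq_le rho_ge0 andbT.
by apply: le_trans (AC _ _ Lu Lv) _; rewrite uv mulr0.
Qed.

(** The least admissible index is a measurable function of z, so it may be substituted in a sequence
    of measurable functions. *)
Lemma measurable_select (A : nat -> set T) : (forall k, measurable (A k)) ->
  (forall z, exists k, A k z) -> exists2 s : T -> nat, (forall z, A (s z) z) &
    forall f : nat -> T -> R, (forall k, measurable_fun [set: T] (f k)) ->
      measurable_fun [set: T] (fun z => f (s z) z).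
Proof.
move=> mA cA.
have ex z : exists k, (z \in A k) by have [k Ak] := cA z; exists k; rewrite inE.
pose s z := ex_minn (ex z).
have sE k : [set z | s z = k] = A k `\` \bigcup_(j in [set j | (j < k)%N]) A j.
  apply/seteqP; split=> z /=; rewrite /s; case: ex_minnP => n; rewrite inE => An nmin.
    move=> <-; split=> // -[j /= jn Aj]; have := nmin j; rewrite inE => /(_ Aj).
    by rewrite leqNgt jn.
  move=> [Ak hk]; apply/eqP; rewrite eqn_leq nmin ?inE//= leqNgt; apply/negP => nk.
  by apply: hk; exists n.
have ms k : measurable [set z | s z = k].
  by rewrite sE; apply: measurableD => //; apply: bigcup_measurable.
exists s => [z|f mf]; first by rewrite /s; case: ex_minnP => n; rewrite inE.
move=> _ B mB; rewrite setTI.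
rewrite (_ : _ @^-1` _ = \bigcup_k ([set z | s z = k] `&` f k @^-1` B)).
  apply: bigcupT_measurable => k; apply: measurableI => //.
  by rewrite -[X in measurable X]setTI; exact: mf.
apply/seteqP; split=> z /=; first by move=> h; exists (s z).
by move=> [k _ [/= <-]].
Qed.

Lemma bop0 (L : bop E F) : L 0 = 0. Proof. exact: linear0. Qed.

Lemma bop_bound (L : bop E F) : exists2 C : R, 0 <= C & forall x, nrm (L x) <= C * nrm x.
Proof.
have [M hM] := bop_bounded L; exists `|M| => // x.
have := hM x; rewrite !normr_nrm -rmorphM lecR => /le_trans; apply.
by rewrite ler_wpM2r ?nrm_ge0// ler_norm.
Qed.

Lemma bop_cvg (L : bop E F) u l : ncvg u l -> ncvg (fun n => L (u n)) (L l).
Proof.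
move=> h e e0; have [C C0 hC] := bop_bound L.
have C1 : 0 < C + 1 by rewrite ltr_wpDl.
have [N hN] := h _ (divr_gt0 e0 C1); exists N => n /hN.
rewrite ltr_pdivlMr// => {}hN; rewrite -linearB; apply: le_lt_trans (hC _) _.
apply: le_lt_trans hN; rewrite mulrC ler_wpM2l ?nrm_ge0//; by rewrite lerDl.
Qed.

(** Phi is measurable only on constant vectors; h is therefore approximated within 1/(n+1) by
    functions with values in the dense sequence, chosen by [measurable_select], and each Phi(z) is
    continuous. *)
Lemma wmeas_mulop (Phi : T -> bop E F) h : (forall x, wmeas (fun z => Phi z x)) ->
  wmeas h -> wmeas (mulop Phi h).
Proof.
move=> mPhi mh; have [d hd] := sepE.
have /choice[k hk] : forall n : nat, exists s : T -> nat,
    (forall z, nrm (h z - d (s z)) < n.+1%:R^-1) /\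
    forall f : nat -> T -> R, (forall k, measurable_fun [set: T] (f k)) ->
      measurable_fun [set: T] (fun z => f (s z) z).
  move=> n; have n0 : 0 < n.+1%:R^-1 :> R by rewrite invr_gt0.
  have [k|z|s s1 s2] := @measurable_select (fun k => [set z | nrm (h z - d k) < n.+1%:R^-1]).
  - exact: measurable_ball_preimage.
  - exact: hd.
  - by exists s.
apply: (wmeas_lim (u := fun n z => Phi z (d (k n z)))).
  move=> n x; have [_ H] := hk n.
  by apply: (H (fun j z => rip (Phi z (d j)) x)) => j; exact: mPhi.
move=> z x; apply: ncvg_rip (ncvg_cst x); apply: bop_cvg => e e0.
have [N hN] := ex_invS_lt e0; exists N => n Nn; rewrite nrmB.
have [/(_ z) + _] := hk n; move/lt_le_trans; apply; apply: ltW; apply: le_lt_trans hN.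
by rewrite lef_pV2 ?posrE// ler_nat.
Qed.

Lemma Linf_bound (Phi : T -> bop E F) : Linf Phi -> exists2 C : R, 0 <= C &
  \forall z \ae m, forall x, nrm (Phi z x) <= C * nrm x.
Proof.
move=> [_ [M hM]]; exists `|M| => //; apply: filterS hM => z h x.
have := h x; rewrite !normr_nrm -rmorphM lecR => /le_trans; apply.
by rewrite ler_wpM2r ?nrm_ge0// ler_norm.
Qed.

Lemma Linf_wmeas (Phi : T -> bop E F) x : Linf Phi -> wmeas (fun z => Phi z x).
Proof. by move=> [h _]; apply: borel_wmeas; exact: h. Qed.

Lemma L2op_mulop (Phi : T -> bop E F) : Linf Phi -> L2op (mulop Phi).
Proof.
move=> LPhi; have [C C0 hC] := Linf_bound LPhi.
apply: (@L2op_linear _ (C ^+ 2)); first exact: sqr_ge0.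
  by move=> a u v; apply/funext => z; rewrite /mulop /= linearP.
move=> u Lu; rewrite /rho -RintegralZl//; last exact: (cint_rip sepE).
apply: (L2_le_ae sepF).
- apply: wmeas_mulop; last exact: (L2_wmeas sepE).
  by move=> x; exact: Linf_wmeas.
- by apply: cintZ; exact: (cint_rip sepE).
- by move=> z; rewrite mulr_ge0 ?sqr_ge0 ?rip_ge0.
- apply: filterS hC => z /(_ (u z)) h; rewrite !ripxx -exprMn.
  by rewrite ler_pXn2r ?nnegrE ?nrm_ge0 ?mulr_ge0 ?nrm_ge0.
Qed.

Lemma mulop_mono (Phi : T -> bop E F) n x : mulop Phi (mono n x) = zX n (fun z => Phi z x).
Proof. by apply/funext => z; rewrite /mulop /mono linearZ. Qed.

Lemma mulop_monoJ (Phi : T -> bop E F) n x : mulop Phi (monoJ n x) = zJX n (fun z => Phi z x).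
Proof. by apply/funext => z; rewrite /mulop /monoJ linearZ. Qed.

Lemma Hinf_H2 (Phi : T -> bop E F) x : Hinf Phi -> H2 (fun z => Phi z x).
Proof.
move=> [LPhi hPhi]; split=> [|n y]; last exact: hPhi.
have [h _ _] := L2op_mulop LPhi; have := h _ (L2_cst sepE x); apply.
Qed.

Lemma H2_zX n (f : T -> F) : H2 f -> H2 (zX n f).
Proof.
by move=> Hf; elim: n => [|n IH]; rewrite ?zX0 ?zXS//; exact: (H2_shift sepF).
Qed.

Lemma mulop_min (Phi : T -> bop E F) K : Linf Phi -> closedL2 K ->
  (forall n x, K (zX n (fun z => Phi z x))) -> forall h, H2 h -> K (mulop Phi h).
Proof.
move=> LPhi clK hK h Hh.
have H := H2_min sepE (closedL2_preimage (L2op_mulop LPhi) clK).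
have [n x|_ //] := H _ h Hh; split; [exact: L2_mono|by rewrite mulop_mono; exact: hK].
Qed.

Lemma H2_mulop (Phi : T -> bop E F) h : Hinf Phi -> H2 h -> H2 (mulop Phi h).
Proof.
move=> HPhi; apply: mulop_min; [by case: HPhi|exact: (closedL2_H2 sepF)|].
by move=> n x; apply: H2_zX; exact: Hinf_H2.
Qed.

Lemma Linf_intro (Phi : T -> bop E F) : (forall x, wmeas (fun z => Phi z x)) ->
  (forall z x, nrm (Phi z x) <= nrm x) -> Linf Phi.
Proof.
move=> mPhi hPhi; split=> [x|]; first exact: wmeas_borel.
by exists 1; apply: nearW => z x; rewrite mul1r !normr_nrm lecR.
Qed.

Lemma adjoint_uniq (A : E -> F) y x : (forall v, iprod (A v) y = iprod v x) -> adjoint A y = x.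
Proof.
move=> h; apply: rip_inj => v; rewrite /rip; congr complex.Re.
by rewrite /adjoint; case: xgetP => [x' _ <-|/(_ x)//]; rewrite h.
Qed.

(** If no vector represents the functional, [adjoint] is 0 by default; the hypothesis then forces x
    = 0 and both sides vanish. *)
Lemma adjoint_spec (A : bop E F) x : adjoint A (A x) = x ->
  forall v, iprod (A v) (A x) = iprod v x.
Proof.
rewrite /adjoint; case: xgetP => [x' _ /= h xx v|_ xx v]; first by rewrite h xx.
by rewrite -xx bop0 !iprod0r.
Qed.

End Operators.

Section BasicOperators.
Context {R : realType} {G : hilbertType R}.
Local Notation T := (circle R).
Hypothesis sepG : dense_sequence G.

Lemma L2op_flipJ : L2op (@flipJ R G).
Proof.
apply: (@L2op_linear _ _ _ sepG _ 1) => // [a u v|u Lu]; first exact: flipJ_lin.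
by rewrite mul1r rho_flipJ//; split=> //; exact: L2_flipJ.
Qed.

Lemma L2op_shiftH : L2op (@shiftH R G).
Proof.
apply: (@L2op_linear _ _ _ sepG _ 1) => // [a u v|u Lu]; first exact: shiftH_lin.
by rewrite mul1r rho_shift; split=> //; exact: L2_shiftH.
Qed.

Lemma L2op_shiftJ : L2op (@shiftJ R G).
Proof.
apply: (@L2op_linear _ _ _ sepG _ 1) => // [a u v|u Lu]; first exact: shiftJ_lin.
by rewrite mul1r -rho_shift shiftJK; split=> //; exact: L2_shiftJ.
Qed.

Lemma L2op_projH2 : L2op (@projH2 R G).
Proof.
have LP (u : T -> G) : L2 u -> L2 (projH2 u) by move=> Lu; exact: (H2_L2 (H2_projH2 sepG Lu)).
split=> //; last by move=> a u v Lu Lv; exact: projH2_lin.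
exists 1 => // u v Lu Lv; rewrite mul1r.
have -> : u - v = (- 1) *: v + u by rewrite scaleN1r addrC.
have -> : projH2 u - projH2 v = (- 1) *: projH2 v + projH2 u by rewrite scaleN1r addrC.
have Luv : L2 ((- 1) *: v + u) by L2solve.
have Lp := LP _ Luv; have Lpu := LP _ Lu; have Lpv := LP _ Lv.
have Lw : L2 ((- 1) *: projH2 v + projH2 u) by L2solve.
apply: le_trans (projH2_le sepG Luv).
have e := eqL2_sym (projH2_lin sepG (- 1) Lv Lu).
by rewrite (eqL2_rhol sepG Lw Lp Lw e) (eqL2_rhor sepG Lw Lp Lp e).
Qed.

End BasicOperators.

Section Composition.
Context {R : realType} {E F H : hilbertType R}.
Local Notation T := (circle R).
Hypotheses (sepE : dense_sequence E) (sepF : dense_sequence F) (sepH : dense_sequence H).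

Lemma L2op_comp (A : (T -> F) -> (T -> H)) (B : (T -> E) -> (T -> F)) :
  L2op A -> L2op B -> L2op (A \o B).
Proof.
move=> oA oB; have [AL [C C0 AC] Alin] := oA; have [BL [D D0 BD] Blin] := oB.
split.
- by move=> u /BL/AL.
- exists (C * D) => [|u v Lu Lv /=]; first exact: mulr_ge0.
  have LBu := BL _ Lu; have LBv := BL _ Lv.
  by apply: le_trans (AC _ _ LBu LBv) _; rewrite -mulrA ler_wpM2l// BD.
- move=> a u v Lu Lv /=.
  have Luv : L2 (a *: u + v) by L2solve.
  have LBuv := BL _ Luv; have LBu := BL _ Lu; have LBv := BL _ Lv.
  have Ll : L2 (a *: B u + B v) by L2solve.
  have L1 := AL _ LBuv; have L3 := AL _ Ll.
  have LAu := AL _ LBu; have LAv := AL _ LBv.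
  have L4 : L2 (a *: A (B u) + A (B v)) by L2solve.
  apply: (eqL2_trans sepH L1 L3 L4); last exact: Alin.
  by apply: (L2op_eq oA) => //; exact: Blin.
Qed.

End Composition.

(** * Direct sums *)

Section Pairs.
Context {R : realType} {E F : hilbertType R}.
Local Notation T := (circle R).
Local Notation m := (circle_measure R).
Local Notation G := (dsum E F).
Hypotheses (sepE : dense_sequence E) (sepF : dense_sequence F).

Let sepG : dense_sequence G. Proof. exact: dense_sequence_dsum. Qed.

Definition fstf (u : T -> G) : T -> E := fun z => (u z).1.
Definition sndf (u : T -> G) : T -> F := fun z => (u z).2.
Definition pairf (p : T -> E) (q : T -> F) : T -> G := fun z => (p z, q z).

Lemma fstf_pairf p q : fstf (pairf p q) = p. Proof. by []. Qed.
Lemma sndf_pairf p q : sndf (pairf p q) = q. Proof. by []. Qed.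
Lemma pairfK u : pairf (fstf u) (sndf u) = u.
Proof. by apply/funext => z; rewrite /pairf /fstf /sndf; case: (u z). Qed.

Lemma wmeas_dsum u : wmeas u <-> wmeas (fstf u) /\ wmeas (sndf u).
Proof.
split=> [mu|[m1 m2] x].
  split=> x.
    rewrite (_ : (fun _ => _) = fun z => rip (u z) ((x, 0) : G)); first exact: mu.
    by apply/funext => z; rewrite rip_dsum rip0r addr0.
  rewrite (_ : (fun _ => _) = fun z => rip (u z) ((0, x) : G)); first exact: mu.
  by apply/funext => z; rewrite rip_dsum rip0r add0r.
rewrite (_ : (fun _ => _) = fun z => rip (fstf u z) x.1 + rip (sndf u z) x.2).
  by apply: measurable_funD; [exact: m1|exact: m2].
by apply/funext => z; rewrite rip_dsum.
Qed.

Lemma L2_dsum u : L2 u <-> L2 (fstf u) /\ L2 (sndf u).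
Proof.
split=> [/(L2P sepG)[mu ui]|[/(L2P sepE)[m1 i1] /(L2P sepF)[m2 i2]]].
  have [m1 m2] := (wmeas_dsum u).1 mu; split.
    by apply: (L2_le sepE m1 ui) => z; rewrite rip_dsum lerDl rip_ge0.
  by apply: (L2_le sepF m2 ui) => z; rewrite rip_dsum lerDr rip_ge0.
apply: (L2_le sepG (g := fun z => rip (fstf u z) (fstf u z) + rip (sndf u z) (sndf u z))).
- exact/wmeas_dsum.
- exact: cintD.
- by move=> z; rewrite rip_dsum.
Qed.

Lemma L2_fstf u : L2 u -> L2 (fstf u). Proof. by move=> /L2_dsum[]. Qed.
Lemma L2_sndf u : L2 u -> L2 (sndf u). Proof. by move=> /L2_dsum[]. Qed.
Lemma L2_pairf p q : L2 p -> L2 q -> L2 (pairf p q).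
Proof. by move=> Lp Lq; apply/L2_dsum. Qed.

Lemma rho_dsum u v : L2 u -> L2 v -> rho u v = rho (fstf u) (fstf v) + rho (sndf u) (sndf v).
Proof.
move=> /L2_dsum[u1 u2] /L2_dsum[v1 v2]; rewrite /rho -RintegralD//.
- by apply: eq_Rintegral => z _; rewrite rip_dsum.
- exact: (cint_rip sepE).
- exact: (cint_rip sepF).
Qed.

Lemma H2_dsum u : H2 u <-> H2 (fstf u) /\ H2 (sndf u).
Proof.
have E1 n x : fstf (monoJ n x) = monoJ n x.1 by [].
have E2 n x : sndf (monoJ n x) = monoJ n x.2 by [].
split=> [/H2P[Lu hu]|[/H2P[L1 h1] /H2P[L2 h2]]].
  have [L1 L2] := (L2_dsum u).1 Lu; split; apply/H2P; split=> // n x.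
    have := hu n ((x, 0) : G); rewrite rho_dsum ?E1 ?E2 //; last exact: L2_monoJ.
    by rewrite (_ : monoJ n.+1 0 = 0) ?rho0r ?addr0//; apply/funext => z; exact: scaler0.
  have := hu n ((0, x) : G); rewrite rho_dsum ?E1 ?E2 //; last exact: L2_monoJ.
  by rewrite (_ : monoJ n.+1 0 = 0) ?rho0r ?add0r//; apply/funext => z; exact: scaler0.
have Lu : Defs.L2 u by exact/L2_dsum.
apply/H2P; split=> // n x; rewrite rho_dsum ?E1 ?E2 ?h1 ?h2 ?addr0//; exact: L2_monoJ.
Qed.

Lemma L2op_fstf : L2op fstf.
Proof.
apply: (@L2op_linear _ _ _ sepG _ 1) => // u Lu; have [L1 L2] := (L2_dsum u).1 Lu; split=> //.
by rewrite mul1r rho_dsum// lerDl rho_ge0.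
Qed.

Lemma L2op_sndf : L2op sndf.
Proof.
apply: (@L2op_linear _ _ _ sepG _ 1) => // u Lu; have [L1 L2] := (L2_dsum u).1 Lu; split=> //.
by rewrite mul1r rho_dsum// lerDr rho_ge0.
Qed.

Lemma eqL2_pairf p q p' q' : L2 p -> L2 q -> L2 p' -> L2 q' ->
  eqL2 p p' -> eqL2 q q' -> eqL2 (pairf p q) (pairf p' q').
Proof.
move=> Lp Lq Lp' Lq' e1 e2; rewrite /eqL2 rho_dsum.
- by rewrite -[RHS](addr0 0) -{1}e1 -e2.
- by apply: L2B => //; exact: L2_pairf.
- by apply: L2B => //; exact: L2_pairf.
Qed.

Lemma L2op_pairf (H : hilbertType R) (A : (T -> H) -> (T -> E)) (B : (T -> H) -> (T -> F)) :
  dense_sequence H -> L2op A -> L2op B -> L2op (fun u => pairf (A u) (B u)).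
Proof.
move=> sepH [AL [C C0 AC] Alin] [BL [D D0 BD] Blin]; split.
- by move=> u Lu; apply: L2_pairf; [exact: AL|exact: BL].
- exists (C + D) => [|u v Lu Lv]; first exact: addr_ge0.
  have LA : L2 (A u - A v) by apply: (L2B sepE); exact: AL.
  have LB : L2 (B u - B v) by apply: (L2B sepF); exact: BL.
  have -> : pairf (A u) (B u) - pairf (A v) (B v) = pairf (A u - A v) (B u - B v) by [].
  rewrite rho_dsum; try exact: L2_pairf.
  by rewrite !fstf_pairf !sndf_pairf mulrDl lerD// ?AC ?BD.
- move=> a u v Lu Lv; have Luv : L2 (a *: u + v) by L2solve.
  have LAu := AL _ Lu; have LAv := AL _ Lv; have LBu := BL _ Lu; have LBv := BL _ Lv.
  have -> : a *: pairf (A u) (B u) + pairf (A v) (B v) =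
    pairf (a *: A u + A v) (a *: B u + B v) by [].
  by apply: eqL2_pairf; [exact: AL|exact: BL|L2solve|L2solve|exact: Alin|exact: Blin].
Qed.

(** A pair of functions becomes one function with values in [dsum E F], so that the L2 theory of a
    single Hilbert space applies. *)
Definition lift_pairs (N : set ((T -> E) * (T -> F))) : set (T -> G) :=
  [set u | N (fstf u, sndf u)].

Lemma sqnorm_lt (p q : (T -> E) * (T -> F)) (e : R) :
  L2 p.1 -> L2 p.2 -> L2 q.1 -> L2 q.2 ->
  (sqnormL2 (p.1 - q.1)%R + sqnormL2 (p.2 - q.2)%R < e%:E)%E <->
  rho (pairf p.1 p.2 - pairf q.1 q.2) (pairf p.1 p.2 - pairf q.1 q.2) < e.
Proof.
move=> Lp1 Lp2 Lq1 Lq2; have L1 := L2B sepE Lp1 Lq1; have L2' := L2B sepF Lp2 Lq2.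
have -> : pairf p.1 p.2 - pairf q.1 q.2 = pairf (p.1 - q.1) (p.2 - q.2) by [].
rewrite rho_dsum; try exact: L2_pairf.
by rewrite (sqnormL2_rho sepE L1) (sqnormL2_rho sepF L2') -EFinD lte_fin.
Qed.

Lemma closedL2_lift N : closed_subspaceH2 N -> closedL2 (lift_pairs N).
Proof.
move=> [NH N0 Nl Nc]; split.
- by move=> u /NH[/= [L1 _] [L2 _]]; exact/L2_dsum.
- exact: N0.
- by move=> a p q Np Nq; exact: (Nl a _ _ Np Nq).
- move=> p Lp h; apply: Nc.
    have cl : closedL2 (@H2 R G) := closedL2_H2 sepG.
    have : H2 p.
      case: cl => _ _ _; apply=> // e /h[q /NH[/= q1 q2] pq].
      by exists q => //; exact/H2_dsum.
    by move=> /H2_dsum.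
  move=> e /h[q Nq pq]; exists (fstf q, sndf q) => //.
  have [/= [q1 _] [q2 _]] := NH _ Nq; have [p1 p2] := (L2_dsum p).1 Lp.
  rewrite -(pairfK p) -(pairfK q) in pq.
  exact: (@sqnorm_lt (fstf p, sndf p) (fstf q, sndf q) e p1 p2 q1 q2).2 pq.
Qed.

Lemma closed_subspaceH2_of_lift (N : set ((T -> E) * (T -> F))) :
  N `<=` @H2 R E `*` @H2 R F -> closedL2 (lift_pairs N) -> closed_subspaceH2 N.
Proof.
move=> NH [_ N0 Nl Nc]; split=> //.
- by move=> a [p1 p2] [q1 q2] Np Nq; exact: (Nl a (pairf p1 p2) (pairf q1 q2) Np Nq).
- move=> [p1 p2] [/= [L1 _] [L2 _]] h; apply: (Nc (pairf p1 p2)); first exact: L2_pairf.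
  move=> e /h[[q1 q2] Nq pq]; exists (pairf q1 q2) => //.
  have [/= [Lq1 _] [Lq2 _]] := NH _ Nq.
  exact: (@sqnorm_lt (p1, p2) (q1, q2) e L1 L2 Lq1 Lq2).1 pq.
Qed.

Lemma lift_eq (N : set ((T -> E) * (T -> F))) p q p' q' :
  closed_subspaceH2 N -> N (p, q) -> L2 p' -> L2 q' ->
  eqL2 p p' -> eqL2 q q' -> N (p', q').
Proof.
move=> clN Npq Lp' Lq' e1 e2; have [NH _ _ _] := clN.
have [/= [Lp _] [Lq _]] := NH _ Npq.
apply: (closedL2_eq (closedL2_lift clN) (p := pairf p q) (q := pairf p' q') Npq).
  exact: L2_pairf.
by rewrite rhoBC; exact: eqL2_pairf.
Qed.

(** [closed_span] is an intersection of closed subspaces; the given N makes the family non-empty and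
    places the result inside H2. *)
Lemma closed_span_closed N S : closed_subspaceH2 N -> S `<=` N ->
  closed_subspaceH2 (@closed_span R E F S).
Proof.
move=> clN SN; have sub : closed_span S `<=` N by apply: smallest_sub.
have [NH _ _ _] := clN; split.
- by move=> p /sub/NH.
- by move=> A [[_ A0 _ _] _].
- by move=> a p q hp hq A hA; have [[_ _ Al _] _] := hA; apply: Al; [exact: hp|exact: hq].
- move=> p Hp h A hA; have [[_ _ _ Ac] _] := hA; apply: Ac => // e /h[q hq pq].
  by exists q => //; exact: hq.
Qed.

Lemma adjointH2_proj (g : T -> F) : H2 g ->
  eqL2 (projH2 (shiftJ g)) (adjointH2 (@shiftH R F) g).
Proof.
move=> Hg; have [Ha ha] := adjointH2_spec sepF Hg; have Lg := H2_L2 Hg.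
have Lz := L2_shiftJ sepF Lg.
apply: projH2_uniq => // h Hh; have Lh := H2_L2 Hh; have La := H2_L2 Ha.
by rewrite rhoBl// (rho_sym _ h) -rho_shiftHl ha// rho_sym subrr.
Qed.

(** S^* P = P z^-1 on all of L2, because z h stays in H2 for h in H2. *)
Lemma adjointH2_projH2 (t : T -> F) : L2 t ->
  eqL2 (projH2 (shiftJ t)) (adjointH2 (@shiftH R F) (projH2 t)).
Proof.
move=> Lt; have Hp := H2_projH2 sepF Lt; have [Ha ha] := adjointH2_spec sepF Hp.
have Lz := L2_shiftJ sepF Lt; have La := H2_L2 Ha.
apply: projH2_uniq => // h Hh; have Lh := H2_L2 Hh.
rewrite rhoBl// (rho_sym _ h) -rho_shiftHl (rho_sym _ h) -ha// rho_sym.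
by rewrite (rho_sym _ (projH2 t)) projH2_rho ?subrr//; exact: H2_shift.
Qed.

End Pairs.

(** * Invariance of the spanned subspaces *)

Section Backward.
Context {R : realType} {E F : hilbertType R}.
Local Notation T := (circle R).
Local Notation G := (dsum E F).
Hypotheses (sepE : dense_sequence E) (sepF : dense_sequence F).

Let sepG : dense_sequence G. Proof. exact: dense_sequence_dsum. Qed.

Lemma L2opD (H K : hilbertType R) (A : (T -> H) -> (T -> K)) u v :
  L2op A -> L2 u -> L2 v -> eqL2 (A (u + v)) (A u + A v).
Proof. by move=> [_ _ lA] Lu Lv; have := lA 1 u v Lu Lv; rewrite !scale1r. Qed.

Lemma mulop_shift (H K : hilbertType R) (A : T -> bop H K) h :
  mulop A (shiftH h) = shiftH (mulop A h).
Proof. by apply/funext => z; rewrite /mulop /shiftH linearZ. Qed.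

Lemma toeplitz_eq (H K : hilbertType R) (A : T -> bop H K) h :
  dense_sequence H -> dense_sequence K -> Hinf A -> H2 h ->
  H2 (toeplitz A h) /\ eqL2 (toeplitz A h) (mulop A h).
Proof.
move=> sepH sepK hA Hh; have Hm := H2_mulop sepH sepK hA Hh.
split; first by apply: (H2_projH2 sepK); exact: H2_L2.
exact: projH2_id.
Qed.

Lemma toeplitz_shift (H K : hilbertType R) (A : T -> bop H K) h :
  dense_sequence H -> dense_sequence K -> Hinf A -> H2 h ->
  eqL2 (toeplitz A (shiftH h)) (shiftH (toeplitz A h)).
Proof.
move=> sepH sepK hA Hh; have [H1 e1] := toeplitz_eq sepH sepK hA Hh.
have Hs := H2_shift sepH Hh.
have [H3 e2] := toeplitz_eq sepH sepK hA Hs.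
have L1 := H2_L2 H1; have L3 := H2_L2 H3.
have Lm := H2_L2 (H2_mulop sepH sepK hA Hh).
rewrite mulop_shift in e2; apply: (eqL2_trans sepK _ _ _ e2) => //; try exact: L2_shiftH.
by apply: (L2op_eq (L2op_shiftH sepK)) => //; exact: eqL2_sym.
Qed.

Lemma hankel_shift (H K : hilbertType R) (A : T -> bop H K) h :
  hankel A (shiftH h) = projH2 (shiftJ (flipJ (mulop A h))).
Proof. by rewrite /hankel mulop_shift flipJ_shift. Qed.

Lemma H2_hankel (H K : hilbertType R) (A : T -> bop H K) h :
  dense_sequence H -> dense_sequence K -> Linf A -> H2 h -> H2 (hankel A h).
Proof.
move=> sepH sepK hA Hh; apply: H2_projH2 => //; apply: L2_flipJ => //.
by have [LA _ _] := L2op_mulop sepH sepK hA; apply/LA/H2_L2.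
Qed.

Lemma hankel_adjoint (H : hilbertType R) (A : T -> bop H F) h :
  dense_sequence H -> Linf A -> H2 h ->
  eqL2 (hankel A (shiftH h)) (projH2 (shiftJ (hankel A h))).
Proof.
move=> sepH hA Hh; have Hk := H2_hankel sepH sepF hA Hh; rewrite hankel_shift.
have Lt : L2 (flipJ (mulop A h)).
  apply: L2_flipJ => //.
  by have [LA _ _] := L2op_mulop sepH sepF hA; apply/LA/H2_L2.
have e1 := adjointH2_projH2 sepF Lt; have e2 := adjointH2_proj sepF Hk.
have [Ha _] := adjointH2_spec sepF Hk.
apply: (eqL2_trans sepF _ _ _ e1 (eqL2_sym e2)).
- by apply/H2_L2/(H2_projH2 sepF); exact: L2_shiftJ.
- exact: H2_L2.
- by apply/H2_L2/(H2_projH2 sepF)/L2_shiftJ => //; exact: H2_L2.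
Qed.

Definition shift_pair (u : T -> G) : T -> G :=
  pairf (shiftH (fstf u)) (projH2 (shiftJ (sndf u))).

Lemma L2op_adjoint : L2op (@projH2 R F \o @shiftJ R F).
Proof. by apply: L2op_comp => //; [exact: L2op_projH2|exact: L2op_shiftJ]. Qed.

Lemma L2op_shift_pair : L2op shift_pair.
Proof.
apply: L2op_pairf => //.
  have X := L2op_comp sepG sepE sepE (L2op_shiftH sepE) (L2op_fstf sepE sepF).
  exact: X.
exact: (L2op_comp sepG sepF sepF L2op_adjoint (L2op_sndf sepE sepF)).
Qed.

(** Elements whose image lies in the span form a closed subspace containing S. There the backward
    shift is written as P z^-1, an [L2op] on the whole of L2, and [adjointH2] comes back up to null
    functions. *)
Lemma closed_span_invariant (S : set ((T -> E) * (T -> F))) :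
  closed_subspaceH2 (closed_span S) ->
  (forall p, S p -> closed_span S (shiftH p.1, adjointH2 (@shiftH R F) p.2)) ->
  shift_invariant (closed_span S).
Proof.
move=> clS hS; have [SH _ _ _] := clS.
have HS : S `<=` closed_span S by exact: sub_smallest.
pose P := [set p | (@H2 R E `*` @H2 R F) p /\
  closed_span S (shiftH p.1, projH2 (shiftJ p.2))].
have clP : closed_subspaceH2 P.
  apply: (closed_subspaceH2_of_lift sepE sepF) => [p [] //|].
  rewrite (_ : lift_pairs P =
    @H2 R G `&` [set u | L2 u /\ lift_pairs (closed_span S) (shift_pair u)]).
    apply: closedL2I; first exact: closedL2_H2.
    apply: closedL2_preimage => //; first exact: L2op_shift_pair.
    exact: closedL2_lift.
  apply/seteqP; split=> u.
    move=> [[/= H1 H2'] h]; have Hu : H2 u by exact/H2_dsum.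
    by split=> //; split=> //; exact: H2_L2.
  by move=> [/(H2_dsum sepE sepF)[H1 H2'] [_ h]].
have adj (g : T -> F) : H2 g ->
    [/\ L2 (projH2 (shiftJ g)), L2 (adjointH2 (@shiftH R F) g) &
    eqL2 (projH2 (shiftJ g)) (adjointH2 (@shiftH R F) g)].
  move=> Hg; have [Ha _] := adjointH2_spec sepF Hg; split; last exact: adjointH2_proj.
    by apply/H2_L2/(H2_projH2 sepF)/L2_shiftJ => //; exact: H2_L2.
  exact: H2_L2.
have SP : closed_span S `<=` P.
  apply: smallest_sub => // p Sp; have [/= H1 H2'] := SH _ (HS _ Sp).
  have [L1 L2' e] := adj _ H2'.
  split=> //; apply: (lift_eq sepE sepF clS (hS _ Sp)) => //.
  - by apply: L2_shiftH => //; exact: H2_L2.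
  - exact: eqL2_refl.
  - exact: eqL2_sym.
move=> p Sp; have [[/= H1 H2'] h] := SP _ Sp; have [L1 L2' e] := adj _ H2'.
apply: (lift_eq sepE sepF clS h) => //.
- by apply: L2_shiftH => //; exact: H2_L2.
- exact: eqL2_refl.
Qed.

(** Analytic Toeplitz operators commute with the shift, and Hankel operators turn it into the
    backward shift. *)
Lemma Vop_shift (Phi : symbol E F) p : Gamma Phi -> (@H2 R E `*` @H2 R F) p ->
  (@H2 R E `*` @H2 R F) (Vop Phi p) /\
  eqL2 (Vop Phi (shiftH p.1, shiftH p.2)).1 (shiftH (Vop Phi p).1) /\
  eqL2 (Vop Phi (shiftH p.1, shiftH p.2)).2 (projH2 (shiftJ (Vop Phi p).2)).
Proof.
move=> [hA hB hC hD] [/= H1 H2'].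
have [tA _] := toeplitz_eq sepE sepE hA H1; have [tB _] := toeplitz_eq sepF sepE hB H2'.
have tC := H2_hankel sepE sepF hC H1; have tD := H2_hankel sepF sepF hD H2'.
have s1 := H2_shift sepE H1; have s2 := H2_shift sepF H2'.
have [tA' _] := toeplitz_eq sepE sepE hA s1; have [tB' _] := toeplitz_eq sepF sepE hB s2.
have tC' := H2_hankel sepE sepF hC s1; have tD' := H2_hankel sepF sepF hD s2.
have eA := toeplitz_shift sepE sepE hA H1; have eB := toeplitz_shift sepF sepE hB H2'.
have eC := hankel_adjoint sepE hC H1; have eD := hankel_adjoint sepF hD H2'.
split; [split=> /=|split=> /=].
- by apply: (closedL2D (closedL2_H2 sepE)).
- by apply: (closedL2D (closedL2_H2 sepF)).
- have -> : shiftH (toeplitz (symA Phi) p.1 + toeplitz (symB Phi) p.2) =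
    1 *: shiftH (toeplitz (symA Phi) p.1) + shiftH (toeplitz (symB Phi) p.2).
    by rewrite -shiftH_lin scale1r.
  rewrite -[X in eqL2 (X + _)]scale1r.
  apply: eqL2_lin => //; try exact: H2_L2; apply: L2_shiftH => //; exact: H2_L2.
- have o := L2op_adjoint; have [Lo _ _] := o.
  have LC := H2_L2 tC; have LD := H2_L2 tD.
  have LC' := Lo _ LC; have LD' := Lo _ LD.
  have e := L2opD o LC LD.
  have M1 := H2_L2 tC'; have M2 := H2_L2 tD'.
  have e' := eqL2_lin sepF 1 M1 M2 LC' LD' eC eD; rewrite !scale1r in e'.
  apply: (eqL2_trans sepF _ _ _ e' (eqL2_sym e)).
  + exact: (L2D sepF M1 M2).
  + exact: (L2D sepF LC' LD').
  + exact: (Lo _ (L2D sepF LC LD)).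
Qed.

(** Theta H2 is shift-invariant, so its complement is invariant under the adjoint. *)
Lemma Kspace_adjoint (F1 : subspace_of F) (Theta : T -> bop F1 F) g : Hinf Theta ->
  Kspace Theta g -> Kspace Theta (adjointH2 (@shiftH R F) g).
Proof.
move=> hT [Hg hg]; have [Ha ha] := adjointH2_spec sepF Hg; split=> // h Hh.
have sep1 : dense_sequence F1 := dense_sequence_subspace F1 sepF.
have Hm := H2_mulop sep1 sepF hT Hh; have Hs := H2_shift sep1 Hh.
have := hg _ Hs; rewrite !iprodL2_eq0 mulop_shift => -[e1 e2].
rewrite rho_sym -ha// rho_sym e1; split=> //.
have Hi : H2 ('i%C *: mulop Theta h) by exact: (closedL2Z (closedL2_H2 sepF)).
rewrite rho_sym -ha// rho_sym.
rewrite (_ : shiftH _ = 'i%C *: shiftH (mulop Theta h))//.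
by apply/funext => z; exact: scaler_swap.
Qed.

Theorem backward (Phi : symbol E F) (F1 : subspace_of F) (Theta : T -> bop F1 F) :
  Gamma Phi -> Hinf Theta ->
  let S := rangeV Phi `|` [set 0] `*` Kspace Theta in
  closed_subspaceH2 (closed_span S) -> shift_invariant (closed_span S).
Proof.
move=> hPhi hT S clS; apply: closed_span_invariant => // p Sp.
have HS : S `<=` closed_span S by exact: sub_smallest.
case: Sp => [[q Hq <-]|[/= p1 p2]].
  have [[/= v1 v2] [/= e1 e2]] := Vop_shift hPhi Hq.
  have [Ha _] := adjointH2_spec sepF v2.
  (* The image of V q under S + S^* is V (zq) up to a null function, and V (zq) is again a
     generator. *)
  have hq : closed_span S (Vop Phi (shiftH q.1, shiftH q.2)).
    apply: HS; left; exists (shiftH q.1, shiftH q.2) => //.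
    by case: Hq => /= ? ?; split=> /=; exact: H2_shift.
  have sq : (@H2 R E `*` @H2 R F) (shiftH q.1, shiftH q.2).
    by case: Hq => /= ? ?; split=> /=; exact: H2_shift.
  have [[/= w1 w2] _] := Vop_shift hPhi sq.
  apply: (lift_eq sepE sepF clS hq) => //.
  - by apply: L2_shiftH => //; exact: H2_L2.
  - exact: H2_L2.
  - apply: (eqL2_trans sepF _ _ _ e2); last exact: adjointH2_proj.
    + exact: H2_L2.
    + by apply/H2_L2/(H2_projH2 sepF)/L2_shiftJ => //; exact: H2_L2.
    + exact: H2_L2.
apply: HS; right; split=> /=; last exact: Kspace_adjoint.
by rewrite p1; apply/funext => z; exact: scaler0.
Qed.

End Backward.

(** * Beurling functions and right extremality *)

Section Dense.
Context {R : realType} {E F : hilbertType R} (d : nat -> E).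
Hypothesis hd : forall x (e : R), 0 < e -> exists k, nrm (x - d k) < e.

Lemma bop_dense_eq (A B : bop E F) : (forall k, A (d k) = B (d k)) -> forall x, A x = B x.
Proof.
move=> h x; have ex n : exists k, nrm (x - d k) < n.+1%:R^-1 by apply: hd; rewrite invr_gt0.
have [s hs] := boolp.choice ex.
have cv : ncvg (d \o s) x.
  move=> e e0; have [N hN] := ex_invS_lt e0; exists N => n Nn; rewrite nrmB.
  apply: lt_le_trans (hs n) _; apply: ltW; apply: le_lt_trans hN.
  by rewrite lef_pV2 ?posrE// ler_nat.
apply: ncvg_uniq (bop_cvg A cv) _.
by rewrite (_ : (fun n => A ((d \o s) n)) = fun n => B ((d \o s) n));
  [exact: bop_cvg|apply/funext => n; exact: h].
Qed.

End Dense.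

Section Beurling.
Context {R : realType} {F : hilbertType R}.
Local Notation T := (circle R).
Local Notation m := (circle_measure R).
Implicit Types f : T -> F.
Hypothesis sepF : dense_sequence F.

Lemma restrict_bop (V : subspace_of F) (Psi : T -> bop F F) :
  exists Theta : T -> bop V F, forall z x, Theta z x = Psi z (subspace_incl x).
Proof.
have ex : forall z, exists L : bop V F, forall x, L x = Psi z (subspace_incl x).
  move=> z; have [C C0 hC] := bop_bound (Psi z).
  apply: (@bop_ex _ _ _ (fun x : V => Psi z (subspace_incl x)) C) => [a x y|x].
    by rewrite -linearP.
  by rewrite nrm_subspace.
by have [Th h] := boolp.choice ex; exists Th.
Qed.

(** The coefficient of index n >= 0 of f is the coefficient of index -1 of z^-(n+1) f, which
    vanishes. *)
Lemma H2_analytic_tail f : H2 f -> (forall n, H2 (zJX n f)) -> rho f f = 0.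
Proof.
move=> Hf h; have [Lf hf] := (H2P f).1 Hf.
have h1 n y : rho f (mono n y) = 0.
  have -> : mono n y = zX n.+1 (monoJ 1 y).
    apply/funext => z; rewrite /zX /monoJ /mono scalerA exprS -mulrA mulrCA expr1.
    by rewrite zval_conj mulr1.
  by rewrite -rho_zJX; have [_] := (H2P _).1 (h n.+1); exact.
apply: (L2_total sepF Lf h1) => -[|n] y; last exact: hf.
by have := h1 0%N y; congr (rho _ _ = _); apply/funext => z; rewrite /mono /monoJ !expr0.
Qed.

(** The Wold decomposition inside H2: the reducing part is null by [H2_analytic_tail], and
    restricting the partial isometries to their initial space makes them isometries. *)
Lemma beurling (L : set (T -> F)) : closedL2 L -> (forall f, L f -> L (shiftH f)) ->
  L `<=` @H2 R F -> exists (F0 : subspace_of F) (Theta : T -> bop F0 F),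
  [/\ Hinf Theta, forall z x y, iprod (Theta z x) (Theta z y) = iprod x y,
      forall x, L (fun z => Theta z x) &
      forall K, closedL2 K -> (forall n x, K (zX n (fun z => Theta z x))) -> L `<=` K].
Proof.
move=> clL shL LH; have [F0 [Psi [isoP projP bP LP minP]]] := wold sepF clL shL.
have [Th TE] := restrict_bop F0 Psi.
have TE' x : (fun z => Th z x) = (fun z => Psi z (subspace_incl x)).
  by apply/funext => z; exact: TE.
have inF0 (x : F0) : subspace_set F0 (subspace_incl x) by exact/set_mem/subspace_inclP.
exists F0, Th; split.
- split=> [|n x y]; last first.
    have [_ /(_ n y)] := LH _ (LP (subspace_incl x)).
    by congr (cintegral _ = _); apply/funext => z; rewrite TE.
  apply: (Linf_intro sepF) => [x|z x]; last by rewrite TE nrm_subspace.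
  by rewrite TE'; apply: (L2_wmeas sepF); apply: (closedL2_L2 clL); exact: LP.
- move=> z x y; rewrite !TE isoP; have [_ h] := projP (subspace_incl x).
  by have /eqP := h _ (inF0 y); rewrite iprodBl subr_eq0 => /eqP.
- by move=> x; rewrite TE'.
- move=> K clK hK; apply: minP => // [n u|g hg]; last first.
    have Hg : H2 g by apply: LH; have := hg 0%N; rewrite zJX0.
    have g0 : rho g g = 0 by apply: H2_analytic_tail => // n; exact: LH.
    apply: (closedL2_eq clK (p := 0)); first by case: clK.
      exact: H2_L2.
    by rewrite subr0.
  have [Pu hu] := projP u.
  (* With P the projection onto [F0], the image of u - Pu under Psi(z) has squared norm <P(u - Pu),
     u - Pu> = 0. *)
  suff -> : (fun z => Psi z u) = (fun z => Th z (SubspaceElt (mem_set Pu))) by exact: hK.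
  apply/funext => z; rewrite TE /=; apply/eqP; rewrite -subr_eq0 -linearB; apply/eqP/ripxx_eq0.
  have [Q hQ] := projP (u - orthoproj F0 u).
  by rewrite /rip isoP iprodC (hu _ Q) rmorph0.
Qed.

Lemma ae_iprod_cst f : L2 f -> (forall n y, rho f (mono n.+1 y) = 0) ->
  (forall n y, rho f (monoJ n.+1 y) = 0) ->
  forall x, exists k, \forall z \ae m, iprod (f z) x = k.
Proof.
move=> Lf h1 h2 x; have ci := ccint_iprod sepF Lf (L2_cst sepF x).
have [c1 c2] := ci.
pose k := \int[m]_z complex.Re (iprod (f z) x) +i* \int[m]_z complex.Im (iprod (f z) x).
exists k; apply: filterS (fourier0_ae (fourier0_sub_cst (k := k) ci _ _ _)) => [z /eqP|n c|n c|c].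
- by rewrite subr_eq0 => /eqP.
- rewrite -(h2 n (c^* *: x)); apply: eq_Rintegral => z _.
  by rewrite Re_mul_iprod rmorphXn.
- rewrite -(h1 n (c^* *: x)); apply: eq_Rintegral => z _.
  by rewrite Re_mul_iprod rmorphXn /= conjCK.
- case: c => a b /=; rewrite -!RintegralZl// -RintegralB//.
  + by apply: eq_Rintegral => z _; case: (iprod _ _).
  + exact: cintZ.
  + exact: cintZ.
Qed.

End Beurling.

Section RightExtremal.
Context {R : realType} {F : hilbertType R} (F0 : subspace_of F).
Local Notation T := (circle R).
Local Notation m := (circle_measure R).
Hypothesis sepF : dense_sequence F.

Let sep0 : dense_sequence F0. Proof. exact: dense_sequence_subspace. Qed.

(** y is Delta^* x, set to 0 on a null set containing the points where Delta is not unitary. Its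
    measurability is that of <x, Delta v>. *)
Lemma square_inner_adjoint (H : hilbertType R) (Delta : T -> bop H H) x :
  dense_sequence H -> square_inner Delta -> exists y : T -> H, L2 y /\
  \forall z \ae m, Delta z (y z) = x /\ forall v, iprod (Delta z v) x = iprod v (y z).
Proof.
move=> sepH [[LD _] [A [mA A0 hA]]].
pose y z := if z \in A then 0 else adjoint (Delta z) x.
have yE z : ~ A z -> Delta z (y z) = x /\ forall v, iprod (Delta z v) x = iprod v (y z).
  move=> nAz; have h u : adjoint (Delta z) (Delta z u) = u /\ Delta z (adjoint (Delta z) u) = u.
    by apply: contrapT => h; apply: nAz; apply: hA => /(_ u).
  rewrite /y memNset//; have [_ e] := h x; split=> // v.
  by have [/adjoint_spec/(_ v) + _] := h (adjoint (Delta z) x); rewrite e.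
have my : wmeas y.
  move=> v; rewrite (_ : (fun _ => _) = fun z => \1_(~` A) z * rip x (Delta z v)).
    apply: measurable_funM.
      by apply: measurable_indic; exact: measurableC.
    under eq_fun do rewrite rip_sym.
    exact: (Linf_wmeas v LD).
  apply/funext => z; rewrite indicE; have [Az|nAz] := pselect (A z).
    by rewrite memNset ?mul0r /y ?mem_set ?rip0l//; apply.
  by rewrite mem_set// mul1r rip_sym (rip_sym x) /rip; have [_ ->] := yE _ nAz.
exists y; split.
  apply: (L2_le sepH (g := fun=> rip x x) my (cint_cst _)) => z.
  have [Az|nAz] := pselect (A z); first by rewrite /y mem_set// rip0l rip_ge0.
  have [e h] := yE _ nAz.
  by rewrite [leRHS]/rip -{1}e h /rip.
exists A; split=> // z /= nz; apply: contrapT => nAz; apply: nz; exact: yE.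
Qed.

(* Here orth S is reducing.  The Beurling function of the analytic part of a
   reducing subspace cannot be divided by an inner function, because the
   quotient [Theta1] still takes its values in the reducing subspace. *)
Lemma right_extremal_orth (S : set (T -> F)) (Theta : T -> bop F0 F) :
  S `<=` @L2 R F -> (forall s, S s -> S (shiftH s) /\ S (shiftJ s)) ->
  Hinf Theta -> (forall z x y, iprod (Theta z x) (Theta z y) = iprod x y) ->
  (forall x, orth S (fun z => Theta z x)) ->
  (forall K, closedL2 K -> (forall n x, K (zX n (fun z => Theta z x))) ->
    @H2 R F `&` orth S `<=` K) ->
  right_extremal Theta.
Proof.
move=> SL2 Ssh hT isoT TS minT [Th [Delta [[_ hTh _] inD ncD fact]]]; apply: ncD.
have [LT _] := hT; have LT2 := L2op_mulop sep0 sepF LT; have [mulL2 _ _] := LT2.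
have isorho a b : rho (mulop Theta a) (mulop Theta b) = rho a b.
  by apply: eq_Rintegral => z _; rewrite /rip isoT.
have cO := closedL2_orth sepF SL2.
have Sn n s : S s -> S (zX n s).
  by move=> Ss; elim: n => [|n IH]; rewrite ?zX0// zXS; have [] := Ssh _ IH.
have SJn n s : S s -> S (zJX n s).
  by move=> Ss; elim: n => [|n IH]; rewrite ?zJX0// zJXS; have [] := Ssh _ IH.
(* S is invariant under z and z^-1, so powers of either sign can be moved from Theta x to S;
   [L2_min] extends this to all of L2. *)
have mulO y : L2 y -> orth S (mulop Theta y).
  have cK := closedL2_preimage sep0 LT2 cO.
  suff h : forall y, L2 y -> [set u | L2 u /\ orth S (mulop Theta u)] y by move=> /h[].
  apply: (L2_min sep0 cK) => n x.
    have Lm := L2_mono sep0 n x; split=> //; split; first exact: mulL2.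
    move=> s Ss; have [Lx h] := TS x.
    apply: (corthC sepF (SL2 _ Ss) (mulL2 _ Lm)); rewrite mulop_mono /corth -zXZ -!rho_zJX.
    by apply: (corthC sepF Lx (SL2 _ (SJn n _ Ss))); exact: h (SJn n _ Ss).
  split; first exact: L2_monoJ.
  split; first by apply: mulL2; exact: L2_monoJ.
  move=> s Ss; have [_ h] := TS x; rewrite mulop_monoJ /corth !rho_zJX zXZ.
  exact: h _ (Sn n _ Ss).
(* Delta^* x is analytic: Theta Delta^* x = Th x lies in H2 and in [orth S], hence by [minT] is
   orthogonal to z^-(n+1) Theta v, and Theta is isometric. *)
have quot x : exists2 y, H2 y & \forall z \ae m, forall v, iprod (Delta z v) x = iprod v (y z).
  have [y [Ly hy]] := square_inner_adjoint x sep0 inD; exists y; last first.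
    by apply: filterS hy => z [].
  have Hx := Hinf_H2 sep0 sepF x hTh.
  have Lm := mulL2 _ Ly.
  have [Lx e] : L2 (fun z => Th z x) /\ eqL2 (mulop Theta y) (fun z => Th z x).
    apply: (ae_eqL2 sepF Lm); first by apply: (L2_wmeas sepF); exact: H2_L2.
    by apply: filterS2 hy fact => z [e _] h; rewrite /mulop h e.
  have Kx : orth S (fun z => Th z x).
    by apply: (closedL2_eq cO (mulO _ Ly)) => //; exact: eqL2_sym.
  apply/H2P; split=> // n v.
  have Lv : L2 (zJX n.+1 (fun z => Theta z v)).
    by rewrite -mulop_monoJ; apply: mulL2; exact: L2_monoJ.
  have h : orth [set zJX n.+1 (fun z => Theta z v)] (fun z => Th z x).
    apply: minT => //; first by apply: closedL2_orth => // _ ->.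
    move=> k u; rewrite -mulop_mono; split; first by apply: mulL2; exact: L2_mono.
    move=> _ ->; rewrite -mulop_monoJ /corth isorho; split; first exact: rho_mono_monoJ.
    rewrite (_ : 'i%C *: mulop Theta (monoJ n.+1 v) = mulop Theta (monoJ n.+1 ('i%C *: v))).
      by rewrite isorho rho_mono_monoJ.
    by rewrite -monoJZ; apply/funext => z; rewrite /mulop linearZ.
  have [_ /(_ _ erefl)[h0 _]] := h.
  by rewrite -isorho mulop_monoJ (eqL2_rhol sepF Lm Lx Lv e).
(* <Delta v, x> has no negative coefficients since Delta is analytic, and no positive ones since
   Delta^* is. *)
have cst v x : exists k, \forall z \ae m, iprod (Delta z v) x = k.
  have [[LD D0] _] := inD; have HD := Hinf_H2 sep0 sep0 v (conj LD D0).
  have [_ hD] := (H2P _).1 HD.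
  apply: (ae_iprod_cst sep0 (H2_L2 HD)) => n y; last exact: hD.
  have [w Hw hw] := quot y; have [Lw h] := (H2P _).1 Hw.
  have Lm := L2_mono sep0 n.+1 y; have Lv := L2_monoJ sep0 n.+1 v.
  have e : \forall z \ae m,
      rip (Delta z v) (mono n.+1 y z) = rip (monoJ n.+1 v z) (w z).
    by apply: filterS hw => z hz; rewrite /rip iprodZr iprodZl hz rmorphXn.
  have [_ E] := cint_ae (cint_meas (cint_rip sep0 (H2_L2 HD) Lm)) (cint_rip sep0 Lv Lw) e.
  by rewrite [LHS]E -[LHS]/(rho _ _) rho_sym h.
have [d hd] := sep0.
have [k hk] := boolp.choice (fun p : nat * nat => cst (d p.1) (d p.2)).
have H : \forall z \ae m, forall i j, iprod (Delta z (d i)) (d j) = k (i, j).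
  by apply: ae_foralln => i; apply: ae_foralln => j; exact: (hk (i, j)).
(* Countably many entries are constant off one null set, so almost everywhere Delta equals its value
   at one good point. *)
have [z0 h0] := ae_ex H; exists (Delta z0); apply: filterS H => z hz.
by apply: (bop_dense_eq hd) => i; apply: (iprod_dense_inj hd) => j; rewrite hz h0.
Qed.
End RightExtremal.

(** * Construction of the symbols *)

Section Forward.
Context {R : realType} {E F : hilbertType R}.
Local Notation T := (circle R).
Local Notation m := (circle_measure R).
Local Notation G := (dsum E F).
Hypotheses (sepE : dense_sequence E) (sepF : dense_sequence F).

Let sepG : dense_sequence G. Proof. exact: dense_sequence_dsum. Qed.

Lemma nrm_fst (u : G) : nrm u.1 <= nrm u.
Proof. by rewrite -(@ler_pXn2r _ 2)// ?nnegrE ?nrm_ge0// nrm_dsum lerDl sqr_ge0. Qed.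

Lemma nrm_snd (u : G) : nrm u.2 <= nrm u.
Proof. by rewrite -(@ler_pXn2r _ 2)// ?nnegrE ?nrm_ge0// nrm_dsum lerDr sqr_ge0. Qed.

Lemma nrm_inl (x : E) : nrm ((x, 0) : G) = nrm x.
Proof.
apply/eqP; rewrite -(@eqrXn2 _ 2) ?nrm_ge0// nrm_dsum /= (_ : nrm 0 = 0) ?expr0n ?addr0//.
by apply/eqP; rewrite -sqrf_eq0 -ripxx rip0l.
Qed.

Lemma nrm_inr (y : F) : nrm ((0, y) : G) = nrm y.
Proof.
apply/eqP; rewrite -(@eqrXn2 _ 2) ?nrm_ge0// nrm_dsum /= (_ : nrm 0 = 0) ?expr0n ?add0r//.
by apply/eqP; rewrite -sqrf_eq0 -ripxx rip0l.
Qed.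

Lemma component (H K : hilbertType R) (i : H -> G) (p : G -> K) (Psi : T -> bop G G) :
  (forall (a : R[i]) x y, i (a *: x + y) = a *: i x + i y) ->
  (forall x, nrm (i x) <= nrm x) ->
  (forall (a : R[i]) u v, p (a *: u + v) = a *: p u + p v) ->
  (forall u, nrm (p u) <= nrm u) ->
  (forall z u, nrm (Psi z u) <= nrm u) ->
  exists L : T -> bop H K, forall z x, L z x = p (Psi z (i x)).
Proof.
move=> li ni lp np bP.
have ex z : exists L : bop H K, forall x, L x = p (Psi z (i x)).
  apply: (@bop_ex _ _ _ (fun x => p (Psi z (i x))) 1) => [a x y|x].
    by rewrite li linearP lp.
  by rewrite mul1r; apply: le_trans (np _) (le_trans (bP _ _) (ni _)).
by have [L hL] := boolp.choice ex; exists L.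
Qed.

Lemma symbol_of (Psi : T -> bop G G) : (forall z u, nrm (Psi z u) <= nrm u) ->
  exists Phi : symbol E F,
  [/\ forall z x, symA Phi z x = (Psi z ((x, 0) : G)).1,
      forall z y, symB Phi z y = (Psi z ((0, y) : G)).1,
      forall z x, symC Phi z x = (Psi z ((x, 0) : G)).2
    & forall z y, symD Phi z y = (Psi z ((0, y) : G)).2].
Proof.
move=> bP.
have l1 (a : R[i]) (x x' : E) : ((a *: x + x', 0) : G) = a *: ((x, 0) : G) + ((x', 0) : G).
  by congr (_, _); rewrite /= scaler0 addr0.
have l2 (a : R[i]) (y y' : F) : ((0, a *: y + y') : G) = a *: ((0, y) : G) + ((0, y') : G).
  by congr (_, _); rewrite /= scaler0 addr0.
have n1 (x : E) : nrm ((x, 0) : G) <= nrm x by rewrite nrm_inl.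
have n2 (y : F) : nrm ((0, y) : G) <= nrm y by rewrite nrm_inr.
have [A hA] := component l1 n1 (p := @fst E F) (fun _ _ _ => erefl) nrm_fst bP.
have [B hB] := component l2 n2 (p := @fst E F) (fun _ _ _ => erefl) nrm_fst bP.
have [C hC] := component l1 n1 (p := @snd E F) (fun _ _ _ => erefl) nrm_snd bP.
have [D hD] := component l2 n2 (p := @snd E F) (fun _ _ _ => erefl) nrm_snd bP.
by exists (Symbol A B C D).
Qed.

Section Components.
Variables (Psi : T -> bop G G) (Phi : symbol E F).
Hypotheses (bP : forall z u, nrm (Psi z u) <= nrm u).
Hypotheses (hA : forall z x, symA Phi z x = (Psi z ((x, 0) : G)).1)
  (hB : forall z y, symB Phi z y = (Psi z ((0, y) : G)).1)
  (hC : forall z x, symC Phi z x = (Psi z ((x, 0) : G)).2)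
  (hD : forall z y, symD Phi z y = (Psi z ((0, y) : G)).2).

Lemma symbol_opE z u : symbol_op Phi z u = Psi z u.
Proof.
have e : ((u.1, 0) : G) + ((0, u.2) : G) = u.
  by case: u => x y; congr (_, _); rewrite /= ?addr0 ?add0r.
by rewrite /symbol_op hA hB hC hD -[in RHS]e linearD.
Qed.

Lemma symbol_Gamma : (forall u, L2 (fun z => Psi z u)) ->
  (forall u, H2 (fstf (fun z => Psi z u))) -> Gamma Phi.
Proof.
move=> LP HP.
have w1 u : wmeas (fstf (fun z => Psi z u)) by exact: (L2_wmeas sepE (L2_fstf sepE sepF (LP u))).
have w2 u : wmeas (sndf (fun z => Psi z u)) by exact: (L2_wmeas sepF (L2_sndf sepE sepF (LP u))).
have fA x : (fun z => symA Phi z x) = fstf (fun z => Psi z ((x, 0) : G)) by exact/funext.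
have fB x : (fun z => symB Phi z x) = fstf (fun z => Psi z ((0, x) : G)) by exact/funext.
have fC x : (fun z => symC Phi z x) = sndf (fun z => Psi z ((x, 0) : G)) by exact/funext.
have fD x : (fun z => symD Phi z x) = sndf (fun z => Psi z ((0, x) : G)) by exact/funext.
have n1 z u : nrm (Psi z u).1 <= nrm u by apply: le_trans (nrm_fst _) (bP _ _).
have n2 z u : nrm (Psi z u).2 <= nrm u by apply: le_trans (nrm_snd _) (bP _ _).
split.
- split; first by apply: (Linf_intro sepE) => [x|z x]; rewrite ?fA// hA -(nrm_inl x).
  move=> n x y; have [_ /(_ n y)] := HP ((x, 0) : G).
  by congr (cintegral _ = _); apply/funext => z; rewrite hA.
- split; first by apply: (Linf_intro sepE) => [x|z x]; rewrite ?fB// hB -(nrm_inr x).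
  move=> n x y; have [_ /(_ n y)] := HP ((0, x) : G).
  by congr (cintegral _ = _); apply/funext => z; rewrite hB.
- by apply: (Linf_intro sepF) => [x|z x]; rewrite ?fC// hC -(nrm_inl x).
- by apply: (Linf_intro sepF) => [x|z x]; rewrite ?fD// hD -(nrm_inr x).
Qed.

End Components.

(* [flip_pair] carries the doubly infinite picture, where the invariant subspace
   becomes invariant under multiplication by [z], back to H2 + H2. *)
Definition flip_pair (u : T -> G) : T -> G := pairf (fstf u) (projH2 (flipJ (sndf u))).

Lemma L2op_flip_pair : L2op flip_pair.
Proof.
apply: L2op_pairf => //; first exact: L2op_fstf.
apply: (L2op_comp sepG sepF sepF (L2op_projH2 sepF)).
exact: (L2op_comp sepG sepF sepF (L2op_flipJ sepF) (L2op_sndf sepE sepF)).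
Qed.

(** V h is [flip_pair] of the pointwise product Psi h up to null functions: the first row is
    analytic, so the projection in its Toeplitz operators changes nothing. *)
Lemma Vop_flip_pair (Phi : symbol E F) (Psi : T -> bop G G) p q : Gamma Phi ->
  (forall z u, symbol_op Phi z u = Psi z u) -> H2 p -> H2 q ->
  [/\ L2 (Vop Phi (p, q)).1, L2 (Vop Phi (p, q)).2,
      eqL2 (Vop Phi (p, q)).1 (fstf (mulop Psi (pairf p q))) &
      eqL2 (Vop Phi (p, q)).2 (projH2 (flipJ (sndf (mulop Psi (pairf p q)))))].
Proof.
move=> [hA hB hC hD] hop Hp Hq.
have e1 : fstf (mulop Psi (pairf p q)) = mulop (symA Phi) p + mulop (symB Phi) q.
  by apply/funext => z; rewrite /fstf /mulop -hop.
have e2 : sndf (mulop Psi (pairf p q)) = mulop (symC Phi) p + mulop (symD Phi) q.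
  by apply/funext => z; rewrite /sndf /mulop -hop.
have [tA eA] := toeplitz_eq sepE sepE hA Hp; have [tB eB] := toeplitz_eq sepF sepE hB Hq.
have tC := H2_hankel sepE sepF hC Hp; have tD := H2_hankel sepF sepF hD Hq.
have LtA := H2_L2 tA; have LtB := H2_L2 tB; have LtC := H2_L2 tC; have LtD := H2_L2 tD.
have LA := H2_L2 (H2_mulop sepE sepE hA Hp); have LB := H2_L2 (H2_mulop sepF sepE hB Hq).
have [opC _ _] := L2op_mulop sepE sepF hC; have [opD _ _] := L2op_mulop sepF sepF hD.
have LC := L2_flipJ sepF (opC _ (H2_L2 Hp)); have LD := L2_flipJ sepF (opD _ (H2_L2 Hq)).
rewrite e1 e2; split.
- exact: (L2D sepE LtA LtB).
- exact: (L2D sepF LtC LtD).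
- by have := eqL2_lin sepE 1 LtA LtB LA LB eA eB; rewrite !scale1r.
- have := L2opD (L2op_projH2 sepF) LC LD => /eqL2_sym.
  congr eqL2; congr projH2.
  by have := flipJ_lin 1 (mulop (symC Phi) p) (mulop (symD Phi) q); rewrite !scale1r.
Qed.

(** * The symbols of a given invariant subspace *)

Section Construction.
Variable N : set ((T -> E) * (T -> F)).
Hypotheses (clN : closed_subspaceH2 N) (shN : shift_invariant N).

Let M : set (T -> G) := [set u | L2 u /\ lift_pairs N (flip_pair u)].

Let clM : closedL2 M.
Proof. by apply: (closedL2_preimage sepG L2op_flip_pair); exact: closedL2_lift. Qed.

Let shM f : M f -> M (shiftH f).
Proof.
move=> [Lf Nf]; have Ls := L2_shiftH sepG Lf; split=> //.
have [L1 L2'] := (L2_dsum sepE sepF f).1 Lf; have LJ := L2_flipJ sepF L2'.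
have := shN Nf; rewrite /= => h.
have e : flipJ (sndf (shiftH f)) = shiftJ (flipJ (sndf f)).
  exact: (flipJ_shift (sndf f)).
rewrite /lift_pairs /flip_pair /= !fstf_pairf !sndf_pairf e.
apply: (lift_eq sepE sepF clN h).
- by apply: (L2_shiftH sepE).
- by apply/H2_L2/(H2_projH2 sepF); exact: L2_shiftJ.
- exact: eqL2_refl.
- by apply: eqL2_sym; exact: adjointH2_projH2.
Qed.

Let tail : set (T -> G) := [set g | forall n, M (zJX n g)].

Let tail_L2 g : tail g -> M g.
Proof. by move/(_ 0%N); rewrite zJX0. Qed.

Let tail_shift g : tail g -> tail (shiftH g) /\ tail (shiftJ g).
Proof.
move=> hg; split=> [[|n]|n].
- by rewrite zJX0; apply: shM; exact: tail_L2.
- rewrite (_ : zJX n.+1 (shiftH g) = zJX n g); first exact: hg.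
  by rewrite zJXS -[RHS]shiftHK; congr shiftJ; apply/funext => z; exact: scaler_swap.
- rewrite (_ : zJX n (shiftJ g) = zJX n.+1 g); first exact: hg.
  by rewrite zJXS; apply/funext => z; exact: scaler_swap.
Qed.

Let tailZ c g : tail g -> tail (c *: g).
Proof.
move=> hg n; rewrite (_ : zJX n (c *: g) = c *: zJX n g).
  exact: (closedL2Z clM).
by apply/funext => z; exact: scaler_swap.
Qed.

Let M_fst g : M g -> H2 (fstf g).
Proof. by have [NH _ _ _] := clN; move=> [_ /NH[]]. Qed.

Let tail_fst g : tail g -> rho (fstf g) (fstf g) = 0.
Proof.
move=> hg; apply: (H2_analytic_tail sepE); first by apply: M_fst; exact: tail_L2.
by move=> n; exact: M_fst (hg n).
Qed.

Let S : set (T -> F) := [set flipJ (sndf g) | g in tail].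

Let S_L2 : S `<=` @L2 R F.
Proof.
move=> _ [g hg <-]; apply: (L2_flipJ sepF); apply: (L2_sndf sepE sepF).
by have [] := tail_L2 hg.
Qed.

Let S_shift s : S s -> S (shiftH s) /\ S (shiftJ s).
Proof.
move=> [g hg <-]; have [h1 h2] := tail_shift hg; split.
  exists (shiftJ g) => //; rewrite -{2}(shiftJK g) -[LHS]shiftJK; congr shiftH.
by exists (shiftH g) => //; exact: (flipJ_shift (sndf g)).
Qed.

Let L := @H2 R F `&` orth S.

Let clL : closedL2 L.
Proof. by apply: closedL2I; [exact: closedL2_H2|exact: closedL2_orth]. Qed.

Let shL f : L f -> L (shiftH f).
Proof.
move=> [Hf [Lf hf]]; split; first exact: H2_shift.
split; first exact: L2_shiftH.
move=> s Ss; have [_ Sj] := S_shift Ss; rewrite /corth !rho_shiftHl.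
have [h1 h2] := hf _ Sj; split=> //.
rewrite (_ : shiftJ ('i%C *: s) = 'i%C *: shiftJ s)//.
by apply/funext => z; exact: scaler_swap.
Qed.

Lemma forward : exists (Phi : symbol E F) (F1 : subspace_of F) (Theta : T -> bop F1 F),
  [/\ Gamma Phi, partial_isometry_valued Phi, Hinf Theta,
      op_zero Theta \/ (left_inner Theta /\ right_extremal Theta)
    & N = closed_span (rangeV Phi `|` [set 0] `*` Kspace Theta)].
Proof.
have [E0 [Psi [isoP projP bP MP minM]]] := wold sepG clM shM.
have [Phi [hA hB hC hD]] := symbol_of bP.
have hop := symbol_opE hA hB hC hD.
have LP u : L2 (fun z => Psi z u) by have [] := MP u.
have hG : Gamma Phi by apply: (symbol_Gamma bP hA hB hC hD LP) => u; exact: M_fst (MP u).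
have [F1 [Th [hT isoT LT minL]]] := beurling sepF clL shL (@subIsetl _ _ _).
have sep1 : dense_sequence F1 := dense_sequence_subspace F1 sepF.
have LinfT : Linf Th by case: hT.
have LinfP : Linf Psi.
  by apply: (Linf_intro sepG) => // u; exact: L2_wmeas.
have rX : right_extremal Th.
  apply: (right_extremal_orth sepF S_L2 S_shift hT isoT) => // x.
  by have [] := LT x.
have LTh h : H2 h -> L (mulop Th h).
  move=> Hh; apply: (mulop_min sep1 sepF LinfT clL _ Hh) => n x.
  exact: (M_zX shL n (LT x)).
exists Phi, F1, Th; split=> //.
- exists E0; apply: nearW => z u; rewrite (hop z u); apply: adjoint_uniq => v.
  by rewrite hop iprodC isoP -iprodC.
(* If [F1] is the zero space then Theta is zero; otherwise it is left inner. *)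
- have [[x x0]|h] := pselect (exists x : F1, x != 0).
    right; split=> //; split=> //; first by exists x.
    by apply: nearW => z y; apply: adjoint_uniq => v; exact: isoT.
  left; apply: nearW => z x; have -> : x = 0; last exact: bop0.
  by apply/eqP/negPn/negP => x0; apply: h; exists x.
set gens := _ `|` _.
have gN : gens `<=` N.
  move=> p [[[h1 h2] [/= H1 H2'] <-]|[/= p1 p2]].
    have Hh : H2 (pairf h1 h2) by exact/H2_dsum.
    have [Nu Mu] : M (mulop Psi (pairf h1 h2)).
      apply: (mulop_min sepG sepG LinfP clM _ Hh) => n u.
      exact: (M_zX shM n (MP u)).
    have [V1 V2 e1 e2] := Vop_flip_pair hG hop H1 H2'.
    by apply: (lift_eq sepE sepF clN Mu) => //; exact: eqL2_sym.
  (* For g in K_Theta the function u = (0, Jg) is to be found in M. Its remainder w after projection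
     to p in M has <w, p> = 0, so it suffices that <w, u> = <J w_2, g> = 0; this holds once J w_2
     lies in [L], the space generated by Theta. *)
  case: p p1 p2 => _ g /= -> [Hg gT]; have Lg := H2_L2 Hg; have LJ := L2_flipJ sepF Lg.
  have Lu : L2 (pairf 0 (flipJ g) : T -> G) by apply: L2_pairf => //; exact: L20.
  set u := pairf 0 (flipJ g) in Lu.
  have [p Mp up] := projection sepG clM Lu; have [Lp _] := Mp.
  have Lw : L2 (u - p) := L2B sepG Lu Lp.
  set w := u - p in Lw up.
  have [Lw1 Lw2] := (L2_dsum sepE sepF w).1 Lw.
  (* M contains (0, k) for every k in H2, because P J k is null. *)
  have wH k : H2 k -> rho (sndf w) k = 0.
    move=> Hk; have Lk := H2_L2 Hk.
    have Mk : M (pairf 0 k).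
      split; first by apply: L2_pairf => //; exact: L20.
      have [_ N0 _ _] := clN; apply: (lift_eq sepE sepF clN N0) => //.
      + exact: L20.
      + exact: (H2_L2 (H2_projH2 sepF (L2_flipJ sepF Lk))).
      + exact: eqL2_refl.
      + apply: eqL2_sym; apply: (projH2_uniq sepF); first exact: L2_flipJ.
          by case: (closedL2_H2 sepF).
        by move=> h Hh; rewrite subr0; exact: rho_flipJ_H2.
    have := up _ Mk; rewrite (rho_dsum sepE sepF) ?fstf_pairf ?sndf_pairf//; last first.
      by apply: L2_pairf => //; exact: L20.
    by rewrite rho0r add0r.
  have LJw : L2 (flipJ (sndf w)) by exact: L2_flipJ.
  (* J w_2 is analytic because w_2 is orthogonal to H2, and it is orthogonal to [S] because w is
     orthogonal to the reducing part, whose first components are null. *)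
  have wL : L (flipJ (sndf w)).
    split.
      apply/H2P; split=> // n x; rewrite -flipJ_mono rho_flipJ//; last exact: L2_mono.
      by apply: wH; exact: H2_mono.
    split=> // _ [h hh <-].
    have z0 k : tail k -> rho (flipJ (sndf w)) (flipJ (sndf k)) = 0.
      move=> hk; have [Lk _] := tail_L2 hk; have [Lk1 Lk2] := (L2_dsum sepE sepF k).1 Lk.
      rewrite rho_flipJ//; have := up _ (tail_L2 hk); rewrite (rho_dsum sepE sepF)//.
      by rewrite (rho_null sepE Lw1 Lk1 (tail_fst hk)) add0r.
    split; first exact: z0.
    rewrite (_ : 'i%C *: _ = flipJ (sndf ('i%C *: h))); first exact/z0/tailZ.
    by apply/funext => z; exact: scaler_swap.
  (* [minL] is applied to the orthogonal complement of g, which contains z^n Theta x because g lies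
     in [Kspace Th]. *)
  have [_ /(_ g erefl)[wg _]] : orth [set g] (flipJ (sndf w)).
    apply: minL wL; first by apply: closedL2_orth => // _ ->.
    move=> n x; rewrite -mulop_mono; have Hm := H2_mono sep1 n x.
    have Lm := H2_L2 (H2_mulop sep1 sepF hT Hm); split=> // _ ->.
    by apply: corthC => //; apply/iprodL2_eq0; exact: gT.
  have uw : rho w u = 0.
    rewrite (rho_dsum sepE sepF)// fstf_pairf sndf_pairf rho0r add0r.
    by rewrite -rho_flipJl.
  have Mu : M u.
    apply: (closedL2_eq clM Mp) => //; rewrite -/w {2}/w.
    by rewrite rhoBr// uw up// subrr.
  have [_ Nu] := Mu; apply: (lift_eq sepE sepF clN Nu) => //.
  - exact: L20.
  - exact: eqL2_refl.
  - by rewrite /flip_pair !sndf_pairf flipJK; exact: projH2_id.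
have clS := closed_span_closed clN gN.
have Sg : gens `<=` closed_span gens by exact: sub_smallest.
apply/seteqP; split; last exact: smallest_sub.
pose MS := [set u | L2 u /\ lift_pairs (closed_span gens) (flip_pair u)].
have clMS : closedL2 MS.
  by apply: (closedL2_preimage sepG L2op_flip_pair); exact: closedL2_lift.
(* [minM] leaves two kinds of generators: z^n Psi u, which [flip_pair] sends into the range of V,
   and the reducing part, which it sends into K_Theta, both up to null functions. *)
have MMS : M `<=` MS.
  apply: minM => // [n u|g hg].
    rewrite -mulop_mono; have Hm := H2_mono sepG n u.
    have Lm := M_zX shM n (MP u); rewrite -mulop_mono in Lm; have [LP' _] := Lm.
    have [L1 L2'] := (L2_dsum sepE sepF _).1 LP'.
    have [H1 H2'] := (H2_dsum sepE sepF _).1 Hm.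
    have [V1 V2 e1 e2] := Vop_flip_pair hG hop H1 H2'.
    split=> //.
    have SV : closed_span gens (Vop Phi (fstf (mono n u), sndf (mono n u))).
      by apply: Sg; left; exists (fstf (mono n u), sndf (mono n u)).
    apply: (lift_eq sepE sepF clS SV) => //.
    exact: (H2_L2 (H2_projH2 sepF (L2_flipJ sepF L2'))).
  have [Lg _] := tail_L2 hg; split=> //; have [L1 L2'] := (L2_dsum sepE sepF _).1 Lg.
  have LJ := L2_flipJ sepF L2'; have HP := H2_projH2 sepF LJ.
  (* P J g_2 is orthogonal to Theta H2, because the latter lies in [L], hence in [orth S]. *)
  have SV : closed_span gens (0, projH2 (flipJ (sndf g))).
    apply: Sg; right; split=> //; split=> // h Hh; apply/iprodL2_eq0.
    have [Hm [Lm om]] := LTh _ Hh.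
    rewrite !projH2_rho//; last exact: (closedL2Z (closedL2_H2 sepF)).
    have Sgg : S (flipJ (sndf g)) by exists g.
    by apply: (corthC sepF Lm LJ); exact: om.
  apply: (lift_eq sepE sepF clS SV) => //.
  - exact: H2_L2.
  - by rewrite /eqL2 sub0r rhoNN; exact: (tail_fst hg).
  - exact: eqL2_refl.
(* An element (p1, p2) of N comes from (p1, J p2) in M, since J is an involution and P p2 = p2 up to
   a null function. *)
move=> [p1 p2] Np; have [NH _ _ _] := clN; have [/= H1 H2'] := NH _ Np.
have Lp1 := H2_L2 H1; have Lp2 := H2_L2 H2'; have LJ := L2_flipJ sepF Lp2.
have Lu : L2 (pairf p1 (flipJ p2) : T -> G) by exact: L2_pairf.
have eP : eqL2 (projH2 (flipJ (flipJ p2))) p2 by rewrite flipJK; exact: projH2_id.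
have LP2 : L2 (projH2 (flipJ (flipJ p2))).
  exact: (H2_L2 (H2_projH2 sepF (L2_flipJ sepF LJ))).
have Mu : M (pairf p1 (flipJ p2)).
  split=> //; apply: (lift_eq sepE sepF clN Np) => //; first exact: eqL2_refl.
  exact: eqL2_sym.
have [_ Su] := MMS _ Mu; apply: (lift_eq sepE sepF clS Su) => //.
exact: eqL2_refl.
Qed.

End Construction.
End Forward.

Theorem theorem1p2 (R : realType) (E F : hilbertType R)
    (sepE : separable_space E) (sepF : separable_space F)
    (N : set ((circle R -> E) * (circle R -> F)))
    (closedN : closed_subspaceH2 N) :
  shift_invariant N <->
  exists (Phi : symbol E F) (F1 : subspace_of F)
         (Theta : circle R -> bop F1 F),
    [/\ Gamma Phi,
        symbol_zero Phi \/ partial_isometry_valued Phi,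
        Hinf Theta,
        op_zero Theta \/ (left_inner Theta /\ right_extremal Theta)
      & N = closed_span (rangeV Phi `|` [set 0] `*` Kspace Theta)].
Proof.
have dE := separable_dense_sequence sepE; have dF := separable_dense_sequence sepF.
split=> [shN|[Phi [F1 [Th [hG _ hT _ NE]]]]].
  have [Phi [F1 [Th [hG pi hT dich NE]]]] := forward dE dF closedN shN.
  by exists Phi, F1, Th; split=> //; right.
by rewrite NE in closedN *; exact: backward.
Qed.
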